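(* Let $B\in\mathbb F^{m\times n}$ be a sparse matrix for which the bipartite graph with adjacency matrix $$A=\begin{bmatrix}0&B^H \\ B&0\end{bmatrix}$$ has treewidth $\tau$. Then a peeled implicit LU factorization of $B$ can be computed with cost $O((m+n)\tau^{\omega-1})$. Further, the full LU factorization of $B$ may be obtained in the same complexity if $\max(m,n)-\operatorname{rank}(B)=O(\tau)$.
   Context: $\mathbb F$ is an arbitrary field with a fixed involution $a\mapsto a^*$ (a field automorphism with $(a^* )^*=a$, possibly the identity); $(X^H)_{ij}=x_{ji}^*$. The exponent $\omega>2$ is such that two $n\times n$ matrices over $\mathbb F$ can be multiplied in $O(n^\omega)$ arithmetic operations. Cost counts arithmetic operations in $\mathbb F$ only (not finding a tree decomposition, reordering, or permutations). The graph with adjacency matrix $A$ has an edge $\{i,j\}$, $i\ne j$, whenever $a_{ij}\neq0$. Treewidth is the minimum over tree decompositions of the maximum bag size minus one. A (full) LU factorization of $B$ with rank $r$ is $P^TBQ=LU$ with $P,Q$ permutation matrices, $L\in\mathbb F^{m\times r}$ lower trapezoidal with unit diagonal, and $U\in\mathbb F^{r\times n}$ upper trapezoidal with nonzero diagonal. A peeled implicit LU decomposition of $B$ is a sequence of pairs $(Y_1,Z_1),\dots,(Y_k,Z_k)$ successively transforming $B$ by row operations $Y_i$ and column operations $Z_i$ (at each step the current matrix $X$ is written $X=Y_iX'Z_i^H$ with $X'$ the next matrix), where each pair is one of: (a) $Y_i$ and $Z_i$ are permutation matrices acting on rows and columns not peeled or eliminated by prior transformations; (b) $Y_i$ and $Z_i$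 are elementary lower-triangular matrices with off-diagonal nonzeros only in the $j$th column, where $j-1$ is the number of prior elementary triangular transformations (these together eliminate a pivot of the current matrix); (c) $Y_i$ is a peeling transformation and $Z_i=I$: $Y_i=\begin{bmatrix}I \\ x^H\end{bmatrix}$, removing the last row of the current matrix, which is the linear combination with coefficients $x^H$ of other not-yet-eliminated rows; (d) $Z_i$ is a peeling transformation and $Y_i=I$: likewise for a column; such that there exists an LU factorization $P^TBQ=LU$ with $PL=\prod_iY_i$ and $QU^H=\prod_iZ_i$. *)

(* Defs.v *)
From HB Require Import structures.
From mathcomp Require Import all_boot all_order all_fingroup all_algebra.
From mathcomp Require Import reals exp.
Set Implicit Arguments.
Unset Strict Implicit.
Unset Printing Implicit Defensive.
Import Order.TTheory GRing.Theory Num.Theory.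
Local Open Scope ring_scope.

Definition ctrmx (F : fieldType) (star : F -> F) m n (X : 'M[F]_(m, n)) :
  'M[F]_(n, m) := map_mx star X^T.

Definition bip_mx (F : fieldType) (star : F -> F) m n (B : 'M[F]_(m, n)) :
  'M[F]_(n + m) := block_mx 0 (ctrmx star B) B 0.

Definition pattern (F : fieldType) m n (B : 'M[F]_(m, n)) : 'M[bool]_(m, n) :=
  map_mx (fun x => x != 0) B.

Definition adj_graph (F : fieldType) p (A : 'M[F]_p) : rel 'I_p :=
  fun i j => (i != j) && (A i j != 0).

Definition is_tree (T : finType) (t : rel T) : Prop :=
  [/\ (0 < #|T|)%N, symmetric t, irreflexive t,
      forall x y, connect t x y
    & forall c : seq T, ucycle t c -> (size c < 3)%N].

Definition is_tree_decomposition (V T : finType) (e : rel V) (t : rel T)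
    (bag : T -> {set V}) : Prop :=
  [/\ is_tree t,
      forall v, exists x, v \in bag x,
      forall u v, e u v -> exists x, (u \in bag x) && (v \in bag x)
    & forall v x y, v \in bag x -> v \in bag y ->
        connect [rel a b | [&& t a b, v \in bag a & v \in bag b]] x y].

(* Truncated predecessor: differs from the usual convention only for the graph
   without vertices, which gets width 0 instead of -1. *)
Definition td_width (V T : finType) (bag : T -> {set V}) : nat :=
  (\max_x #|bag x|).-1.

Definition is_treewidth (V : finType) (e : rel V) (tau : nat) : Prop :=
  (exists (T : finType) (t : rel T) (bag : T -> {set V}),
      is_tree_decomposition e t bag /\ td_width bag = tau) /\
  (forall (T : finType) (t : rel T) (bag : T -> {set V}),
      is_tree_decomposition e t bag -> (tau <= td_width bag)%N).

(* Algebraic computation trees over F.  The memory is an append-only list of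
   field elements, initially the input; every instruction appends its result,
   and operands and outputs are addresses in the memory.  The syntax is
   first-order (addresses rather than values are bound), so field elements can
   influence the control flow only through zero tests.  Only operations in F are
   counted: addressing, permutations, constants and output are free.  Zero tests
   are charged too, since over a finite field free tests would allow computing
   anything at no cost.  Division is MathComp's total one ([x / 0 = 0]), which
   partial division and a zero test can simulate at cost 2. *)

Inductive instr (F : Type) : Type :=
  | Const of F
  | Add of nat & nat
  | Sub of nat & nat
  | Mul of nat & nat
  | Div of nat & nat
  | Star of nat.

Inductive ctree (F O : Type) : Type :=
  | Output of O
  | Compute of instr F & ctree F O
  | IfZero of nat & ctree F O & ctree F O.

Definition fetch (F : fieldType) (mem : seq F) (a : nat) : F := nth 0 mem a.

Definition exec (F : fieldType) (star : F -> F) (mem : seq F) (c : instr F) :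
    F :=
  match c with
  | Const x => x
  | Add a b => fetch mem a + fetch mem b
  | Sub a b => fetch mem a - fetch mem b
  | Mul a b => fetch mem a * fetch mem b
  | Div a b => fetch mem a / fetch mem b
  | Star a => star (fetch mem a)
  end.

Definition instr_cost (F : Type) (c : instr F) : nat :=
  if c is Const _ then 0%N else 1%N.

Record outcome (F O : Type) : Type :=
  Outcome { result : O; memory : seq F; cost : nat }.

Fixpoint run_from (F : fieldType) (star : F -> F) (O : Type) (t : ctree F O)
    (mem : seq F) (k : nat) : outcome F O :=
  match t with
  | Output o => Outcome o mem k
  | Compute c t' =>
      run_from star t' (rcons mem (exec star mem c)) (k + instr_cost c)
  | IfZero a t1 t2 =>
      run_from star (if fetch mem a == 0 then t1 else t2) mem k.+1
  end.

Definition run (F : fieldType) (star : F -> F) (O : Type) (t : ctree F O)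
    (input : seq F) : outcome F O := run_from star t input 0.

Definition entries (F : Type) m n (A : 'M[F]_(m, n)) : seq F :=
  [seq A i j | i <- enum 'I_m, j <- enum 'I_n].

Definition matmul_exponent (R : realType) (F : fieldType) (star : F -> F)
    (omega : R) : Prop :=
  exists C : R, forall n : nat, exists t : ctree F 'M[nat]_n,
    forall A B : 'M[F]_n,
      let res := run star t (entries A ++ entries B) in
      map_mx (fetch (memory res)) (result res) = A *m B /\
      (cost res)%:R <= C * n%:R `^ omega.

(* [V] is the type of the entries: F for an actual
   factorization, nat (addresses) for the output of a computation tree. *)

Record lu_data (V : Type) (m n : nat) : Type := LUData {
  lu_rank : nat;
  lu_P : 'S_m;
  lu_Q : 'S_n;
  lu_L : 'M[V]_(m, lu_rank);
  lu_U : 'M[V]_(lu_rank, n) }.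

Definition map_lu (V W : Type) (f : V -> W) m n (d : lu_data V m n) :
    lu_data W m n :=
  LUData (lu_P d) (lu_Q d) (map_mx f (lu_L d)) (map_mx f (lu_U d)).

Definition lower_trapezoidal_unit (F : fieldType) m r (L : 'M[F]_(m, r)) :
    Prop :=
  forall (i : 'I_m) (j : 'I_r),
    ((i < j)%N -> L i j = 0) /\ ((i = j :> nat) -> L i j = 1).

Definition upper_trapezoidal_nz (F : fieldType) r n (U : 'M[F]_(r, n)) :
    Prop :=
  forall (i : 'I_r) (j : 'I_n),
    ((j < i)%N -> U i j = 0) /\ ((i = j :> nat) -> U i j != 0).

Definition is_LU (F : fieldType) m n (B : 'M[F]_(m, n)) (d : lu_data F m n) :
    Prop :=
  [/\ lu_rank d = \rank B,
      (perm_mx (lu_P d))^T *m B *m perm_mx (lu_Q d) = lu_L d *m lu_U d,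
      lower_trapezoidal_unit (lu_L d)
    & upper_trapezoidal_nz (lu_U d)].

(* Sequences of pairs (Y_1, Z_1), ..., (Y_k, Z_k) of composable matrices; both
   products have r columns. *)
Inductive transfs (V : Type) (r : nat) : nat -> nat -> Type :=
  | TNil : transfs V r r r
  | TCons p q p' q' (Y : 'M[V]_(p, p')) (Z : 'M[V]_(q, q'))
      (c : transfs V r p' q') : transfs V r p q.
Arguments TNil {V r}.

Fixpoint map_transfs (V W : Type) (f : V -> W) r p q (c : transfs V r p q) :
    transfs W r p q :=
  match c with
  | TNil => TNil
  | TCons _ _ _ _ Y Z c' => TCons (map_mx f Y) (map_mx f Z) (map_transfs f c')
  end.

Fixpoint prodY (F : fieldType) r p q (c : transfs F r p q) : 'M[F]_(p, r) :=
  match c with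
  | TNil => 1%:M
  | TCons _ _ _ _ Y _ c' => Y *m prodY c'
  end.

Fixpoint prodZ (F : fieldType) r p q (c : transfs F r p q) : 'M[F]_(q, r) :=
  match c with
  | TNil => 1%:M
  | TCons _ _ _ _ _ Z c' => Z *m prodZ c'
  end.

(* Identity outside the j-th column, counting columns from 0.  The j-th diagonal
   entry is not forced to be 1, because U, hence the product of the Z_i, carries
   the pivots. *)
Definition elementary_lower (F : fieldType) p (j : nat) (M : 'M[F]_p) : Prop :=
  forall i k : 'I_p,
    [/\ k <> j :> nat -> M i k = (i == k)%:R,
        k = j :> nat -> (i < j)%N -> M i k = 0
      & k = j :> nat -> i = j :> nat -> M i k != 0].

(* [peel_step star j X' Y Z j']: (Y, Z) is an admissible pair leading to the
   matrix X', where j and j' are the numbers of elementary pairs before and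
   after this step.  The eliminated rows and columns of the current matrix are
   the first j ones; peeled ones are no longer part of it. *)
Inductive peel_step (F : fieldType) (star : F -> F) (j : nat) :
    forall p q p' q' : nat, 'M[F]_(p', q') -> 'M[F]_(p, p') ->
      'M[F]_(q, q') -> nat -> Prop :=
  | StepPerm p q (X' : 'M[F]_(p, q)) (s : 'S_p) (t : 'S_q) :
      (forall i : 'I_p, (i < j)%N -> s i = i) ->
      (forall i : 'I_q, (i < j)%N -> t i = i) ->
      peel_step star j X' (perm_mx s) (perm_mx t) j
  | StepElim p q (X' : 'M[F]_(p, q)) (Y : 'M[F]_p) (Z : 'M[F]_q) :
      (j < p)%N -> (j < q)%N ->
      elementary_lower j Y -> elementary_lower j Z ->
      (forall (i : 'I_p) (k : 'I_q), (i = j :> nat) \/ (k = j :> nat) ->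
         X' i k = (i == k :> nat)%:R) ->
      peel_step star j X' Y Z j.+1
  | StepPeelRow p q (X' : 'M[F]_(p, q)) (x : 'cV[F]_p) :
      (j <= p)%N ->
      (forall i : 'I_p, (i < j)%N -> x i ord0 = 0) ->
      peel_step star j X' (col_mx 1%:M (ctrmx star x)) (1%:M : 'M[F]_q) j
  | StepPeelCol p q (X' : 'M[F]_(p, q)) (x : 'cV[F]_q) :
      (j <= q)%N ->
      (forall i : 'I_q, (i < j)%N -> x i ord0 = 0) ->
      peel_step star j X' (1%:M : 'M[F]_p) (col_mx 1%:M (ctrmx star x)) j.

Inductive peels (F : fieldType) (star : F -> F) (r : nat) :
    forall p q : nat, nat -> 'M[F]_(p, q) -> transfs F r p q -> Prop :=
  | PeelsNil j (X : 'M[F]_r) : peels star j X TNil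
  | PeelsCons p q p' q' j j' (X : 'M[F]_(p, q)) (X' : 'M[F]_(p', q'))
      (Y : 'M[F]_(p, p')) (Z : 'M[F]_(q, q')) (c : transfs F r p' q') :
      X = Y *m X' *m ctrmx star Z ->
      peel_step star j X' Y Z j' ->
      peels star j' X' c ->
      peels star j X (TCons Y Z c).

Record peeled_data (V : Type) (m n : nat) : Type := PeeledData {
  peeled_rank : nat;
  peeled_transfs : transfs V peeled_rank m n }.

Definition map_peeled (V W : Type) (f : V -> W) m n (d : peeled_data V m n) :
    peeled_data W m n :=
  PeeledData (map_transfs f (peeled_transfs d)).

Definition is_peeled_LU (F : fieldType) (star : F -> F) m n (B : 'M[F]_(m, n))
    (d : peeled_data F m n) : Prop :=
  peels star 0 B (peeled_transfs d) /\
  exists (P : 'S_m) (Q : 'S_n) (L : 'M[F]_(m, peeled_rank d))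
         (U : 'M[F]_(peeled_rank d, n)),
    [/\ is_LU B (LUData P Q L U),
        perm_mx P *m L = prodY (peeled_transfs d)
      & perm_mx Q *m ctrmx star U = prodZ (peeled_transfs d)].

(* Main.v *)
Require Import Defs.
From HB Require Import structures.
From mathcomp Require Import all_boot all_order all_fingroup all_algebra.
From mathcomp Require Import boolp reals exp.
From mathcomp Require Import zify ring lra.
Set Implicit Arguments.
Unset Strict Implicit.
Unset Printing Implicit Defensive.
Import Order.TTheory GRing.Theory Num.Theory.
Local Open Scope ring_scope.
(** A tree decomposition of width [tau] is turned into a schedule in which the
    rows and columns whose bags have been left accumulate until there are more
    than [2 k] of them, with [k = tau + 1]; they then form, with the current bag,
    a front of size O(k).  Gaussian elimination of the interior block of the front
    is done by recursion on the quadrants, in time O(k^omega) because [omega > 2]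
    makes four half-size calls cheaper than one product.  The interior rows that
    are left vanish on the interior columns, so they span a space of dimension at
    most the number of columns in the bag: all but a basis of them can be peeled.
    The same holds for columns.  At most [k] interior rows and columns survive, so
    each front gets rid of more than [k] of them and there are O((m + n) / k)
    fronts.

    For the full factorization, let [Z] consist of the rows and columns peeled in
    a first run.  The second run keeps [Z] in all bags, which adds O(tau) to the
    width.  The rows outside [Z] are linearly independent, and so are the columns,
    so that nothing is peeled and the second run is plain Gaussian elimination. *)

(** Everything symbolic has to precede the values. A tree returns addresses, so permutations,
    dimensions and the chain of transformations are built from a list of operations on the original
    indices, uniformly in the values; only the validity of that list is proved about the values.
    Block elimination keeps inverses of the triangular factors, so that merging two stages takes
    products only and no triangular solve. A front has at most [5 * k] vertices: two pending sets of
    at most [2 * k] that meet at a bag, and the bag. Rounding up to a power of two gives [10 * k].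
    The set of peeled vertices is small because an elimination lowers the rank by at most one while
    it uses up a row and a column; hence at most m + n - 2 rank(B) vertices are peeled. The zero
    matrix is treated apart: its graph has treewidth 0, so the bound allows no counted operation at
    all. *)

(** * Programs *)

(* The argument is the size of the memory, that is the next free address. *)
Definition prog (F A : Type) := nat -> ctree F A.

Definition ret (F A : Type) (a : A) : prog F A := fun _ => Output F a.

Fixpoint graft (F A B : Type) (t : ctree F A) (s : nat) (f : A -> prog F B) :
    ctree F B :=
  match t with
  | Output a => f a s
  | Compute c t' => Compute c (graft t' s.+1 f)
  | IfZero a t1 t2 => IfZero a (graft t1 s f) (graft t2 s f)
  end.

Definition bind (F A B : Type) (p : prog F A) (f : A -> prog F B) : prog F B :=
  fun s => graft (p s) s f.

Notation "'do' x <- p ; q" := (bind p (fun x => q))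
  (at level 200, x pattern, p at level 100, q at level 200).

Definition emit (F : Type) (c : instr F) : prog F nat :=
  fun s => Compute c (Output F s).

Definition branch (F A : Type) (a : nat) (p q : prog F A) : prog F A :=
  fun s => IfZero a (p s) (q s).

(** * Hoare triples with cost bounds *)

Section Spec.
Variables (R : realType) (F : fieldType) (star : F -> F).

(** The program is instantiated at the size of the starting memory. The prefix clause keeps every
    earlier address meaningful, so facts established before a call survive it. *)
Definition spec A (p : prog F A) (mem : seq F) (c : R)
    (Q : seq F -> A -> Prop) : Prop :=
  let o := run_from star (p (size mem)) mem 0 in
  [/\ prefix mem (memory o), (cost o)%:R <= c & Q (memory o) (result o)].

Lemma run_from_cost A (t : ctree F A) mem k :
  run_from star t mem k =
  Outcome (result (run_from star t mem 0)) (memory (run_from star t mem 0))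
    (k + cost (run_from star t mem 0)).
Proof.
elim: t mem k => [o|c t IH|a t1 IH1 t2 IH2] mem k /=.
- by rewrite addn0.
- by rewrite IH [in RHS]IH /= addnA.
- by case: ifP => _; [rewrite IH1 [in RHS]IH1|rewrite IH2 [in RHS]IH2]; rewrite /= addnA addn1.
Qed.

Lemma run_from_prefix A (t : ctree F A) mem k :
  prefix mem (memory (run_from star t mem k)).
Proof.
elim: t mem k => [o|c t IH|a t1 IH1 t2 IH2] mem k /=.
- exact: prefix_refl.
- by apply: prefix_trans (IH _ _); rewrite -cats1 prefix_prefix.
- by case: ifP.
Qed.

Lemma run_from_graft A B (t : ctree F A) (f : A -> prog F B) mem k :
  let o := run_from star t mem k in
  run_from star (graft t (size mem) f) mem k =
  run_from star (f (result o) (size (memory o))) (memory o) (cost o).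
Proof.
elim: t mem k => [o|c t IH|a t1 IH1 t2 IH2] mem k //=.
- by rewrite -IH size_rcons.
- by case: ifP.
Qed.

Lemma spec_ret A (a : A) mem (c : R) (Q : seq F -> A -> Prop) :
  0 <= c -> Q mem a -> spec (ret F a) mem c Q.
Proof. by move=> c0 Qa; split=> //=; exact: prefix_refl. Qed.

Lemma spec_bind A B (p : prog F A) (f : A -> prog F B) mem (c1 c2 c : R) Q1 Q2 :
  spec p mem c1 Q1 ->
  (forall mem' a, prefix mem mem' -> Q1 mem' a -> spec (f a) mem' c2 Q2) ->
  c1 + c2 <= c ->
  spec (bind p f) mem c Q2.
Proof.
move=> [pre le1 q1] h2 lec; rewrite /spec /bind run_from_graft.
have [pre2 le2 q2] := h2 _ _ pre q1.
rewrite run_from_cost; split=> //=.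
- exact: prefix_trans pre2.
- by rewrite natrD; apply: le_trans lec; apply: lerD.
Qed.

Lemma spec_weaken A (p : prog F A) mem (c1 c2 : R) (Q1 Q2 : seq F -> A -> Prop) :
  spec p mem c1 Q1 -> c1 <= c2 ->
  (forall mem' a, prefix mem mem' -> Q1 mem' a -> Q2 mem' a) ->
  spec p mem c2 Q2.
Proof.
move=> [h1 h2 h3] le h; split=> //; first exact: le_trans le.
exact: h.
Qed.

(** The bound on the address makes this stable under extension: [fetch] also reads 0 beyond the
    memory, and a later append could put another value there. *)
Definition holds (mem : seq F) (a : nat) (v : F) : Prop :=
  (a < size mem)%N /\ fetch mem a = v.

Lemma holds_prefix mem mem' a v : prefix mem mem' -> holds mem a v -> holds mem' a v.
Proof.
move=> /prefixP[s ->] [lt <-]; split; first by rewrite size_cat ltn_addr.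
by rewrite /fetch nth_cat lt.
Qed.

Lemma spec_emit c mem :
  spec (emit c) mem (instr_cost c)%:R
    (fun mem' a => holds mem' a (exec star mem c)).
Proof.
split=> //=; first by rewrite -cats1 prefix_prefix.
by split; [rewrite size_rcons | rewrite /fetch nth_rcons ltnn eqxx].
Qed.

Lemma spec_branch A a v (p q : prog F A) mem (c : R) Q :
  holds mem a v ->
  (v = 0 -> spec p mem c Q) -> (v != 0 -> spec q mem c Q) ->
  spec (branch a p q) mem (c + 1) Q.
Proof.
move=> [_ <-] h1 h2; rewrite /spec /branch /= run_from_cost /=.
case: eqP => [/h1|/eqP /h2] [? ? ?]; split=> //=;
  by rewrite natrD addrC lerD2r.
Qed.

Definition rep_on m n (I : {set 'I_m}) (J : {set 'I_n}) (mem : seq F)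
    (M' : 'M[nat]_(m, n)) (M : 'M[F]_(m, n)) : Prop :=
  forall i j, i \in I -> j \in J -> holds mem (M' i j) (M i j).

Definition rep m n (mem : seq F) (M' : 'M[nat]_(m, n)) (M : 'M[F]_(m, n)) : Prop :=
  forall i j, holds mem (M' i j) (M i j).

Definition restr m n (I : {set 'I_m}) (J : {set 'I_n}) (M : 'M[F]_(m, n)) :
    'M[F]_(m, n) :=
  \matrix_(i, j) if (i \in I) && (j \in J) then M i j else 0.

Lemma rep_prefix m n mem mem' (M' : 'M_(m, n)) M :
  prefix mem mem' -> rep mem M' M -> rep mem' M' M.
Proof. by move=> pre h i j; apply: holds_prefix pre (h i j). Qed.

Lemma rep_on_prefix m n (I : {set 'I_m}) (J : {set 'I_n}) mem mem' M' M :
  prefix mem mem' -> rep_on I J mem M' M -> rep_on I J mem' M' M.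
Proof. by move=> pre h i j Ii Jj; apply: holds_prefix pre (h i j Ii Jj). Qed.

Lemma rep_onW m n (I : {set 'I_m}) (J : {set 'I_n}) mem M' M :
  rep mem M' M -> rep_on I J mem M' M.
Proof. by move=> h i j _ _. Qed.

Lemma rep_onS m n (I I1 : {set 'I_m}) (J J1 : {set 'I_n}) mem M' M :
  I1 \subset I -> J1 \subset J -> rep_on I J mem M' M -> rep_on I1 J1 mem M' M.
Proof. by move=> /subsetP sI /subsetP sJ h i j /sI ? /sJ ?; apply: h. Qed.

Lemma rep_restr_on m n (I : {set 'I_m}) (J : {set 'I_n}) mem M' M :
  rep mem M' (restr I J M) -> rep_on I J mem M' M.
Proof. by move=> h i j Ii Jj; have := h i j; rewrite mxE Ii Jj. Qed.

Fixpoint fill m n (g : 'I_m -> 'I_n -> prog F nat) (s : seq ('I_m * 'I_n))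
    (M : 'M[nat]_(m, n)) : prog F 'M[nat]_(m, n) :=
  if s is x :: s' then
    do a <- g x.1 x.2;
    fill g s' (\matrix_(i, j) if (i, j) == x then a else M i j)
  else ret F M.

(** Cells outside [I] x [J] share one constant zero, which is free, so the cost depends on the block
    only while the result represents a matrix on all indices. *)
Definition build m n (I : {set 'I_m}) (J : {set 'I_n})
    (g : 'I_m -> 'I_n -> prog F nat) : prog F 'M[nat]_(m, n) :=
  do z <- emit (Const 0); fill g (enum (setX I J)) (const_mx z).

Lemma spec_fill m n (g : 'I_m -> 'I_n -> prog F nat) s (M' : 'M[nat]_(m, n))
    (M V : 'M[F]_(m, n)) (c : R) mem :
  (forall i j mem', (i, j) \in s -> prefix mem mem' ->
     spec (g i j) mem' c (fun mem'' a => holds mem'' a (V i j))) ->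
  rep mem M' M ->
  spec (fill g s M') mem (c *+ size s)
    (fun mem' X' => rep mem' X'
      (\matrix_(i, j) if (i, j) \in s then V i j else M i j)).
Proof.
elim: s mem M' M => [|x s IH] mem M' M hg hM.
  by apply: spec_ret => // i j; rewrite mxE in_nil; apply: hM.
rewrite [size _]/= mulrS /=.
have xin : (x.1, x.2) \in x :: s by rewrite -surjective_pairing mem_head.
apply: (spec_bind (hg _ _ _ xin (prefix_refl _)) _ (lexx _)).
move=> mem' a pre ha.
have hM' : rep mem' (\matrix_(i, j) if (i, j) == x then a else M' i j)
    (\matrix_(i, j) if (i, j) == x then V i j else M i j).
  move=> i j; rewrite !mxE; case: eqP => [xij|_]; last exact: holds_prefix (hM _ _).
  by rewrite -xij /= in ha.
apply: (spec_weaken (IH _ _ _ _ hM') (lexx _)).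
  move=> i j mem'' ijs pre'; apply: hg; first by rewrite inE ijs orbT.
  exact: prefix_trans pre'.
move=> mem'' X' pre' h i j; have := h i j; rewrite !mxE inE.
by case: ((i, j) \in s); rewrite ?orbT // orbF.
Qed.

Lemma spec_build m n (I : {set 'I_m}) (J : {set 'I_n}) g (V : 'M[F]_(m, n)) c mem (N : nat) :
  0 <= c ->
  (forall i j mem', i \in I -> j \in J -> prefix mem mem' ->
     spec (g i j) mem' c (fun mem'' a => holds mem'' a (V i j))) ->
  (#|I| <= N)%N -> (#|J| <= N)%N ->
  spec (build I J g) mem (c * (N * N)%:R)
    (fun mem' X' => rep mem' X' (restr I J V)).
Proof.
move=> c0 hg leI leJ; rewrite /build.
apply: (spec_bind (c2 := c * (N * N)%:R) (spec_emit (Const 0) mem)); last first.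
  by rewrite add0r.
move=> mem' z pre /= hz.
  apply: spec_weaken.
  + apply: (@spec_fill m n g _ _ 0 V c).
      move=> i j mem'' /=; rewrite mem_enum inE /= => /andP[Ii Jj] pre'.
      by apply: hg => //; apply: prefix_trans pre'.
    by move=> i j; rewrite !mxE.
  + rewrite -[c *+ _]mulr_natr ler_wpM2l // ler_nat -cardE cardsX.
    exact: leq_mul.
  + by move=> mem'' X' _ h i j; have := h i j; rewrite !mxE mem_enum !inE.
Qed.

End Spec.

(** * Matrix products *)

Definition rename_instr (F : Type) (f : nat -> nat) (c : instr F) : instr F :=
  match c with
  | Const x => Const x
  | Add a b => Add F (f a) (f b)
  | Defs.Sub a b => Defs.Sub F (f a) (f b)
  | Mul a b => Mul F (f a) (f b)
  | Div a b => Div F (f a) (f b)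
  | Star a => Star F (f a)
  end.

(* [mp] lists the addresses in the memory of the caller, currently of size [s],
   of the cells of the memory of [t]; [z] is the address of a zero, which is
   what [t] reads outside its own memory. *)
Fixpoint relocate (F O : Type) (t : ctree F O) (mp : seq nat) (z s : nat) :
    ctree F (O * seq nat) :=
  match t with
  | Output o => Output F (o, mp)
  | Compute c t' =>
      Compute (rename_instr (nth z mp) c) (relocate t' (rcons mp s) z s.+1)
  | IfZero a t1 t2 =>
      IfZero (nth z mp a) (relocate t1 mp z s) (relocate t2 mp z s)
  end.

(** A block is compressed to the positions in the enumerations of [I] and [J] and padded with [z]. A
    product of square matrices of one fixed size thus serves all smaller rectangular blocks, and
    [scatter] undoes the compression. *)
Definition gather (V : Type) m n p (I : {set 'I_m}) (J : {set 'I_n}) (z : V)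
    (A : 'M[V]_(m, n)) : 'M[V]_p :=
  \matrix_(i, j) if (onth (enum I) i, onth (enum J) j) is (Some a, Some b)
                 then A a b else z.

Definition scatter (V : Type) m n p (I : {set 'I_m}) (J : {set 'I_n}) (z : V)
    (A : 'M[V]_p) : 'M[V]_(m, n) :=
  \matrix_(a, b) if (a \in I) && (b \in J) then
      if (insub (index a (enum I)), insub (index b (enum J))) is (Some i, Some j)
      then A i j else z
    else z.

Definition block_mul (F : fieldType) n (t : ctree F 'M[nat]_n) m p q
    (I : {set 'I_m}) (K : {set 'I_p}) (J : {set 'I_q})
    (A : 'M[nat]_(m, p)) (B : 'M[nat]_(p, q)) : prog F 'M[nat]_(m, q) :=
  do z <- emit (Const 0);
  do r <- relocate t (entries (gather n I K z A) ++ entries (gather n K J z B)) z;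
  ret F (scatter I J z (map_mx (nth z r.2) r.1)).

Lemma map_entries (V W : Type) (f : V -> W) m n (A : 'M[V]_(m, n)) :
  map f (entries A) = entries (map_mx f A).
Proof.
rewrite /entries map_allpairs; apply: eq_allpairs => i j; by rewrite mxE.
Qed.

Lemma sum_onth (V : nmodType) (T : Type) (f : option T -> V) (s : seq T) n :
  f None = 0 -> (size s <= n)%N ->
  \sum_(k < n) f (onth s k) = \sum_(c <- s) f (Some c).
Proof.
move=> f0; elim: s n => [|x s IH] n /= lesn.
  by rewrite big_nil big1 // => i _; rewrite onth0n.
case: n lesn => // n lesn.
by rewrite big_ord_recl big_cons /=; congr (_ + _); apply: IH.
Qed.

Section BlockMul.
Variables (R : realType) (F : fieldType) (star : F -> F).
Implicit Types (mem : seq F).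

(** The two runs stay in lockstep: the hypothesis on [holds] is an invariant under which every
    instruction reads equal operands and every zero test takes the same branch. *)
Lemma run_relocate O (t : ctree F O) mp z lm gm k :
  size mp = size lm ->
  (forall a, holds gm (nth z mp a) (fetch lm a)) ->
  let o := run_from star t lm k in
  let o' := run_from star (relocate t mp z (size gm)) gm k in
  [/\ (result o').1 = result o, cost o' = cost o
    & forall a, holds (memory o') (nth z (result o').2 a) (fetch (memory o) a)].
Proof.
elim: t mp lm gm k => [o|c t IH|a t1 IH1 t2 IH2] mp lm gm k eqs h //=.
- have ex : exec star gm (rename_instr (nth z mp) c) = exec star lm c.
    by case: c => //= *; rewrite ?(h _).2.
  rewrite -(size_rcons gm (exec star gm (rename_instr (nth z mp) c))).
  have -> : instr_cost (rename_instr (nth z mp) c) = instr_cost c by case: (c).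
  rewrite ex; apply: IH; first by rewrite !size_rcons eqs.
  move=> a; rewrite /fetch !nth_rcons eqs.
  case: ltnP => [lt|_].
    by apply: holds_prefix (h a); rewrite -cats1 prefix_prefix.
  case: eqP => _.
    by split; [rewrite size_rcons | rewrite /fetch nth_rcons ltnn eqxx].
  (* A read beyond the private memory must still give 0. It is redirected to [z], and the old
     invariant at [size mp] says that [z] holds 0. *)
  have := h (size mp); rewrite /fetch !nth_default ?eqs //.
  by apply: holds_prefix; rewrite -cats1 prefix_prefix.
- have -> : fetch gm (nth z mp a) = fetch lm a := (h a).2.
  by case: ifP => _; [apply: IH1 | apply: IH2].
Qed.

Lemma mulmx_gather m p q n (I : {set 'I_m}) (K : {set 'I_p}) (J : {set 'I_q})
    (A : 'M[F]_(m, p)) (B : 'M[F]_(p, q)) :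
  (#|I| <= n)%N -> (#|K| <= n)%N -> (#|J| <= n)%N ->
  scatter I J 0 (gather n I K 0 A *m gather n K J 0 B) =
  restr I setT (restr setT K A *m restr setT J B).
Proof.
move=> leI leK leJ; apply/matrixP => a b; rewrite !mxE.
have idx (r : nat) (S : {set 'I_r}) c : c \in S -> (#|S| <= n)%N ->
    exists2 i : 'I_n, insub (index c (enum S)) = Some i & onth (enum S) i = Some c.
  move=> cS leS; have lt : (index c (enum S) < size (enum S))%N.
    by rewrite index_mem mem_enum.
  rewrite -cardE in lt; exists (Ordinal (leq_trans lt leS)).
    by rewrite insubT ?(leq_trans lt leS) // => lt'; congr Some; apply: val_inj.
  by rewrite onthE (nth_map c) ?nth_index ?index_mem ?mem_enum.
rewrite inE andbT; case: (boolP (a \in I)) => aI /=; last by [].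
case: (boolP (b \in J)) => bJ /=; last first.
  by rewrite big1 // => k _; rewrite !mxE !inE (negPf bJ) mulr0.
have [i -> hi] := idx _ _ _ aI leI; have [j -> hj] := idx _ _ _ bJ leJ.
pose f (c : option 'I_p) := if c is Some c then A a c * B c b else 0.
rewrite mxE (eq_bigr (fun k : 'I_n => f (onth (enum K) k))); last first.
  by move=> k _; rewrite !mxE hi hj /f; case: onth => //; rewrite mul0r.
rewrite sum_onth -?cardE // big_enum /= big_mkcond /=.
apply: eq_bigr => k _; rewrite !mxE !inE bJ /=.
by case: ifP => //; rewrite mul0r.
Qed.

(** Since the terms outside [K] vanish, the block product is a restriction of the full product
    [A *m B], to which the matrix identities of the elimination apply directly. *)
Lemma spec_block_mul n (t : ctree F 'M[nat]_n) (c : R) :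
  (forall A B : 'M[F]_n,
     let res := run star t (entries A ++ entries B) in
     map_mx (fetch (memory res)) (result res) = A *m B /\ (cost res)%:R <= c) ->
  forall m p q (I : {set 'I_m}) (K : {set 'I_p}) (J : {set 'I_q}) A' A B' B mem,
  rep_on I K mem A' A -> rep_on K J mem B' B ->
  (forall i j k, i \in I -> j \in J -> k \notin K -> A i k * B k j = 0) ->
  (#|I| <= n)%N -> (#|K| <= n)%N -> (#|J| <= n)%N ->
  spec star (block_mul t I K J A' B') mem c
    (fun mem' C' => rep mem' C' (restr I J (A *m B))).
Proof.
move=> ht m p q I K J A' A B' B mem hA hB h0 leI leK leJ; rewrite /block_mul.
apply: (spec_bind (c2 := c) (spec_emit R star (Const 0) mem)); last first.
  by rewrite add0r.
move=> mem1 z pre1 /= hz.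
have hG m1 n1 (I1 : {set 'I_m1}) (J1 : {set 'I_n1}) M' M :
    rep_on I1 J1 mem M' M ->
    forall i j, holds mem1 (gather n I1 J1 z M' i j) (gather n I1 J1 0 M i j).
  move=> hM i j; rewrite !mxE.
  case E1 : (onth _ i) => [a|]; last by [].
  case E2 : (onth _ j) => [b|]; last by [].
  apply: holds_prefix pre1 _; apply: hM.
    by rewrite -mem_enum; apply/onthP; exists i.
  by rewrite -mem_enum; apply/onthP; exists j.
set A1 := gather n I K 0 A; set B1 := gather n K J 0 B.
set mp := _ ++ _.
have hfm m1 n1 (M1 : 'M[nat]_(m1, n1)) (M2 : 'M[F]_(m1, n1)) :
    (forall i j, holds mem1 (M1 i j) (M2 i j)) ->
    map (fetch mem1) (entries M1) = entries M2.
  move=> h; rewrite map_entries; congr entries; apply/matrixP => i j.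
  by rewrite mxE (h i j).2.
have hlm : map (fetch mem1) mp = entries A1 ++ entries B1.
  by rewrite map_cat (hfm _ _ _ _ (hG _ _ _ _ _ _ hA)) (hfm _ _ _ _ (hG _ _ _ _ _ _ hB)).
have hall a : holds mem1 (nth z mp a) (fetch (entries A1 ++ entries B1) a).
  rewrite -hlm /fetch; case: (ltnP a (size mp)) => [lt|le]; last first.
    by rewrite !nth_default // size_map.
  rewrite (nth_map z) //; split=> //.
  have : nth z mp a \in mp by rewrite mem_nth.
  rewrite mem_cat => /orP[] /allpairsP[[i j] /= [_ _ ->]].
    by have [] := hG _ _ _ _ _ _ hA i j.
  by have [] := hG _ _ _ _ _ _ hB i j.
have [|r1 r2 r3] := @run_relocate _ t mp z (entries A1 ++ entries B1) mem1 0 _ hall.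
  by rewrite -hlm size_map.
have [hres hcost] := ht A1 B1.
apply: (spec_bind (c1 := c) (c2 := 0) (Q1 := fun mem' r =>
    prefix mem1 mem' /\ rep mem' (map_mx (nth z r.2) r.1) (A1 *m B1))); last first.
- by rewrite addr0.
- move=> mem' r pre' [_ hr]; apply: spec_ret => // a b.
  have -> : restr I J (A *m B) = scatter I J 0 (A1 *m B1).
    rewrite mulmx_gather //; apply/matrixP => i j; rewrite !mxE inE andbT.
    case: (boolP (i \in I)) => iI //=.
    case: (boolP (j \in J)) => jJ /=; last first.
      by rewrite big1 // => k _; rewrite !mxE !inE (negPf jJ) mulr0.
    apply: eq_bigr => k _; rewrite !mxE !inE jJ /=.
    by case: (boolP (k \in K)) => // kK; rewrite h0 // mul0r.
  rewrite !mxE; case: ifP => _; last exact: holds_prefix hz.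
  case: insub => [i|]; last exact: holds_prefix hz.
  case: insub => [j|]; last exact: holds_prefix hz.
  exact: hr.
- split; first exact: run_from_prefix.
  + by rewrite r2.
  + split; first exact: run_from_prefix.
    move=> i j; rewrite mxE r1; split; first
      by have [] := r3 (result (run star t (entries A1 ++ entries B1)) i j).
    by rewrite (r3 _).2 -hres mxE.
Qed.

End BlockMul.

(** * Gaussian elimination *)

Section Gauss.
Variables (F : fieldType).

(* Pivots are eliminated in the order given by [ps]; the factors of the pivot in
   row [i] are column [i] of [L] and row [i] of [U]. *)
Fixpoint gauss m n (X : 'M[F]_(m, n)) (ps : seq ('I_m * 'I_n)) (L : 'M[F]_m)
    (U X' : 'M[F]_(m, n)) : Prop :=
  if ps is (i, j) :: ps' then
    let X1 := X - col i L *m row i U in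
    [/\ L i i = 1, U i j != 0, row i X1 = 0, col j X1 = 0
      & gauss X1 ps' L U X']
  else X' = X.

Lemma gauss_cat m n (X S S' : 'M[F]_(m, n)) ps1 ps2 L U :
  gauss X ps1 L U S -> gauss S ps2 L U S' -> gauss X (ps1 ++ ps2) L U S'.
Proof.
elim: ps1 X => [|[i j] ps1 IH] X /=; first by move=> ->.
by move=> [? ? ? ? h] h2; split=> //; apply: IH.
Qed.

Lemma eq_gauss m n (X X' : 'M[F]_(m, n)) ps L L' U U' :
  (forall i, i \in map fst ps -> col i L = col i L') ->
  (forall i, i \in map fst ps -> row i U = row i U') ->
  gauss X ps L U X' -> gauss X ps L' U' X'.
Proof.
elim: ps X => [|[i j] ps IH] X //= hL hU.
rewrite -(hL i) ?mem_head // -(hU i) ?mem_head // => -[h1 h2 h3 h4 h5].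
split=> //.
- by have /matrixP/(_ i ord0) := hL i (mem_head _ _); rewrite !mxE => <-.
- by have /matrixP/(_ ord0 j) := hU i (mem_head _ _); rewrite !mxE => <-.
- by apply: IH => // k kin; [apply: hL | apply: hU]; rewrite inE kin orbT.
Qed.

Lemma rank1E m n (L : 'M[F]_m) (U : 'M[F]_(m, n)) i a b :
  (col i L *m row i U) a b = L a i * U i b.
Proof. by rewrite mxE big_ord1 !mxE. Qed.

(** The normalization [L i i = 1] forces row [i] of [U] to be row [i] of [X]; the cleared column
    then determines column [i] of [L]. *)
Lemma gauss_step m n (X : 'M[F]_(m, n)) i j L U :
  let X1 := X - col i L *m row i U in
  L i i = 1 -> row i X1 = 0 -> col j X1 = 0 ->
  (forall b, X i b = U i b) /\ (forall a, X a j = L a i * U i j).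
Proof.
move=> X1 Li hr hc; split=> [b|a].
  have /matrixP/(_ ord0 b) := hr.
  by rewrite mxE !mxE big_ord1 !mxE Li mul1r => /eqP; rewrite subr_eq0 => /eqP.
have /matrixP/(_ a ord0) := hc.
by rewrite mxE !mxE big_ord1 !mxE => /eqP; rewrite subr_eq0 => /eqP.
Qed.

(** As each pivot is nonzero, a zero row gets multiplier 0 and stays zero. Applied to a row that has
    just been eliminated, this makes the pivots distinct. *)
Lemma gauss_row0 m n (X X' : 'M[F]_(m, n)) ps L U a :
  gauss X ps L U X' -> (forall b, X a b = 0) ->
  [/\ forall b, X' a b = 0, a \notin map fst ps
    & forall i, i \in map fst ps -> L a i = 0].
Proof.
elim: ps X => [|[i j] ps IH] X /=; first by move=> ->.
move=> [Li Uij hr hc hg] X0.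
have [_ hX] := gauss_step Li hr hc.
have La : L a i = 0.
  by have := X0 j; rewrite hX => /eqP; rewrite mulf_eq0 (negPf Uij) orbF => /eqP.
have [|h1 h2 h3] := IH _ hg.
  by move=> b; rewrite mxE mxE X0 rank1E La mul0r subrr.
split=> //.
- rewrite inE negb_or h2 andbT; apply: contraPneq La => ->.
  by rewrite Li; apply/eqP; rewrite oner_eq0.
- by move=> k; rewrite inE => /orP[/eqP->|] //; apply: h3.
Qed.

Lemma gauss_col0 m n (X X' : 'M[F]_(m, n)) ps L U b :
  gauss X ps L U X' -> (forall a, X a b = 0) ->
  [/\ forall a, X' a b = 0, b \notin map snd ps
    & forall i, i \in map fst ps -> U i b = 0].
Proof.
elim: ps X => [|[i j] ps IH] X /=; first by move=> ->.
move=> [Li Uij hr hc hg] X0.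
have [hX _] := gauss_step Li hr hc.
have Ub : U i b = 0 by rewrite -hX.
have [|h1 h2 h3] := IH _ hg.
  by move=> a; rewrite mxE mxE X0 rank1E Ub mulr0 subrr.
split=> //.
- rewrite inE negb_or h2 andbT; apply: contraNneq Uij => <-.
  by rewrite Ub.
- by move=> k; rewrite inE => /orP[/eqP->|] //; apply: h3.
Qed.

Lemma row_eq0P m n (X : 'M[F]_(m, n)) i : row i X = 0 -> forall b, X i b = 0.
Proof. by move=> /matrixP/(_ ord0) h b; have := h b; rewrite !mxE. Qed.

Lemma col_eq0P m n (X : 'M[F]_(m, n)) j : col j X = 0 -> forall a, X a j = 0.
Proof. by move=> /matrixP h a; have := h a ord0; rewrite !mxE. Qed.

Lemma gauss_pivots m n (X X' : 'M[F]_(m, n)) ps L U :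
  gauss X ps L U X' ->
  [/\ uniq (map fst ps), uniq (map snd ps),
      forall a b, a \in map fst ps -> X' a b = 0
    & forall a b, b \in map snd ps -> X' a b = 0].
Proof.
elim: ps X => [|[i j] ps IH] X //= [Li Uij /row_eq0P hr /col_eq0P hc hg].
have [u1 u2 h1 h2] := IH _ hg.
have [r1 r2 _] := gauss_row0 hg hr; have [c1 c2 _] := gauss_col0 hg hc.
rewrite u1 u2 r2 c2; split=> // a b; rewrite inE => /orP[/eqP->|] //;
  by [apply: h1 | apply: h2].
Qed.

Definition idm m (s : seq 'I_m) : 'M[F]_m := \matrix_(i, j) ((i == j) && (i \in s))%:R.

Lemma idm_mull m n (s : seq 'I_m) (A : 'M[F]_(m, n)) i j :
  (idm s *m A) i j = if i \in s then A i j else 0.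
Proof.
rewrite mxE (bigD1 i) //= big1 => [|k ki]; last by rewrite !mxE eq_sym (negPf ki) mul0r.
by rewrite !mxE eqxx /= addr0; case: ifP; rewrite ?mul1r ?mul0r.
Qed.

Lemma idm_mulr m n (s : seq 'I_n) (A : 'M[F]_(m, n)) i j :
  (A *m idm s) i j = if j \in s then A i j else 0.
Proof.
rewrite mxE (bigD1 j) //= big1 => [|k ki]; last by rewrite !mxE (negPf ki) mulr0.
by rewrite !mxE eqxx /= addr0; case: ifP; rewrite ?mulr1 ?mulr0.
Qed.

Lemma idm_disjoint m (s t : seq 'I_m) :
  (forall i, i \in s -> i \notin t) -> idm s *m idm t = 0.
Proof.
move=> h; apply/matrixP => i j; rewrite idm_mull !mxE.
by case: ifP => // /h /negPf ->; rewrite andbF.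
Qed.

Lemma idm_cat m (s t : seq 'I_m) :
  (forall i, i \in s -> i \notin t) -> idm (s ++ t) = idm s + idm t.
Proof.
move=> h; apply/matrixP => i j; rewrite !mxE mem_cat.
case: eqP => _ /=; last by rewrite addr0.
by case: (boolP (i \in s)) => [/h /negPf ->|_]; rewrite ?addr0 ?add0r.
Qed.

(** The Schur complement, with [U *m L] in the role of the inverse of the pivot block. It is kept at
    full size, with zero rows and columns at the pivots. *)
Definition resid m n (M : 'M[F]_(m, n)) (L : 'M[F]_m) (U : 'M[F]_(n, m)) :=
  M - M *m U *m (L *m M).

(* [U *m L] is a generalized inverse of [M] on the pivots: it is obtained from
   the inverses of the triangular factors of the pivot block. *)
Definition elim m n (M : 'M[F]_(m, n)) ps (L : 'M[F]_m) (U : 'M[F]_(n, m)) :=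
  [/\ gauss M ps (M *m U) (L *m M) (resid M L U),
      L *m M *m U = idm (map fst ps),
      idm (map fst ps) *m L = L, U *m idm (map fst ps) = U
    & L *m idm (map fst ps) = L /\ idm (map snd ps) *m U = U].

Lemma idm_mull_sub m n (s t : seq 'I_m) (A : 'M[F]_(m, n)) :
  {subset s <= t} -> idm s *m A = A -> idm t *m A = A.
Proof.
move=> sub <-; apply/matrixP => i j; rewrite !idm_mull.
by case: (boolP (i \in s)) => [/sub ->|_] //; rewrite if_same.
Qed.

Lemma idm_mulr_sub m n (s t : seq 'I_n) (A : 'M[F]_(m, n)) :
  {subset s <= t} -> A *m idm s = A -> A *m idm t = A.
Proof.
move=> sub <-; apply/matrixP => i j; rewrite !idm_mulr.
by case: (boolP (j \in s)) => [/sub ->|_] //; rewrite if_same.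
Qed.

Lemma elim_nil m n (M : 'M[F]_(m, n)) : elim M [::] 0 0.
Proof.
split=> /=; rewrite /resid ?mulmx0 ?mul0mx ?subr0 //.
by apply/matrixP => i j; rewrite !mxE andbF.
Qed.

Lemma elim_single m n (M : 'M[F]_(m, n)) i j :
  M i j != 0 ->
  elim M [:: (i, j)] (delta_mx i i) ((M i j)^-1 *: delta_mx j i).
Proof.
move=> Mij; set L := delta_mx i i; set U := _ *: _.
have hMU a b : (M *m U) a b = M a j / M i j *+ (b == i).
  rewrite mxE (bigD1 j) //= big1 => [|k kj]; rewrite !mxE ?(negPf kj) /= ?mulr0 // eqxx /=.
  by case: eqP => _; rewrite ?mulr0 ?addr0 ?mulr1 ?mulr0n ?mulr1n.
have hLM a b : (L *m M) a b = M i b *+ (a == i).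
  rewrite mxE (bigD1 i) //= big1 => [|k ki]; rewrite !mxE ?(negPf ki) ?andbF ?mul0r //.
  by rewrite eqxx andbT addr0; case: eqP; rewrite ?mul1r ?mul0r.
have hR : M - col i (M *m U) *m row i (L *m M) = resid M L U.
  congr (M - _); apply/matrixP => a b; rewrite rank1E [RHS]mxE (bigD1 i) //=.
  by rewrite big1 ?addr0 // => k ki; rewrite hMU (negPf ki) mul0r.
have hRE a b : resid M L U a b = M a b - M a j / M i j * M i b.
  by rewrite -hR mxE mxE rank1E hMU hLM eqxx.
split=> /=.
- rewrite hR; split=> //.
  + by rewrite hMU eqxx mulfV.
  + by rewrite hLM eqxx.
  + by apply/rowP => b; rewrite mxE hRE [RHS]mxE mulfV // mul1r subrr.
  + by apply/colP => a; rewrite mxE hRE [RHS]mxE mulfVK // subrr.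
- apply/matrixP => a b; rewrite mxE (bigD1 j) //= big1; last first.
    by move=> k kj; rewrite !mxE (negPf kj) !(mulr0, mul0r).
  rewrite hLM !mxE eqxx /= addr0 inE.
  case: (eqVneq b i) => [->|bi]; last first.
    rewrite !mulr0; case: eqP => [->|_] //=; by rewrite (negPf bi).
  by rewrite andbb; case: eqP; rewrite ?mulr1 ?mul0r ?mulfV.
- apply/matrixP => a b; rewrite idm_mull inE mxE.
  by case: eqP.
- apply/matrixP => a b; rewrite idm_mulr inE !mxE.
  by case: (eqVneq b i); rewrite ?andbF ?mulr0.
- split; apply/matrixP => a b; rewrite ?idm_mulr ?idm_mull inE !mxE.
    by case: (eqVneq b i); rewrite ?andbF.
  by case: (eqVneq a j); rewrite ?mulr0.
Qed.

(** With [S] the first Schur complement, the merged data should satisfy [L *m M = L1 *m M + L2 *m S]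
    and [M *m U = M *m U1 + S *m U2]. Expanding [S] gives the two formulas. *)
Lemma elim_cat m n (M : 'M[F]_(m, n)) ps1 L1 U1 ps2 L2 U2 :
  elim M ps1 L1 U1 -> elim (resid M L1 U1) ps2 L2 U2 ->
  let L := L1 + L2 - L2 *m (M *m U1) *m L1 in
  let U := U1 + U2 - U1 *m (L1 *m (M *m U2)) in
  elim M (ps1 ++ ps2) L U /\ resid M L U = resid (resid M L1 U1) L2 U2.
Proof.
have [S SE] : exists S, S = resid M L1 U1 by exists (resid M L1 U1).
rewrite -SE; set D1 := idm (map fst ps1); set D2 := idm (map fst ps2).
move=> [g1 LMU1 DL1 UD1 [LD1 DU1]] [g2 LSU2 DL2 UD2 [LD2 DU2]] L U; rewrite -SE in g1.
(* Pivot rows of the first stage are zero in [S] and cannot be pivots again, so the two index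
   projections are orthogonal and the cross products [U1 *m L2] and [U2 *m L1] vanish. *)
have dis i : i \in map fst ps1 -> i \notin map fst ps2.
  move=> i1; have [_ _ h _] := gauss_pivots g1.
  by have [|_ ? _] := gauss_row0 (a := i) g2 => // b; apply: h.
have dis' i : i \in map fst ps2 -> i \notin map fst ps1.
  by move=> i2; apply/negP => /dis; rewrite i2.
have D12 : D1 *m D2 = 0 by apply: idm_disjoint.
have D21 : D2 *m D1 = 0 by apply: idm_disjoint.
have U1L2 : U1 *m L2 = 0 by rewrite -UD1 -DL2 mulmxA -(mulmxA U1) D12 mulmx0 mul0mx.
have U2L1 : U2 *m L1 = 0 by rewrite -UD2 -DL1 mulmxA -(mulmxA U2) D21 mulmx0 mul0mx.
have LM : L *m M = L1 *m M + L2 *m S.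
  by rewrite /L SE /resid mulmxBl mulmxDl mulmxBr !mulmxA addrA.
have MU : M *m U = M *m U1 + S *m U2.
  by rewrite /U SE /resid mulmxBr mulmxDr mulmxBl !mulmxA addrA.
have SU1 : S *m U1 = 0.
  by rewrite SE /resid mulmxBl -!mulmxA (mulmxA L1) LMU1 UD1 subrr.
have hres : resid M L U = resid S L2 U2.
  rewrite {1}/resid MU LM mulmxDl !mulmxDr.
  have -> : M *m U1 *m (L2 *m S) = 0 by rewrite mulmxA -(mulmxA M) U1L2 mulmx0 mul0mx.
  have -> : S *m U2 *m (L1 *m M) = 0 by rewrite mulmxA -(mulmxA S) U2L1 mulmx0 mul0mx.
  by rewrite addr0 add0r opprD addrA -/(resid M L1 U1) -SE.
split=> //; split.
- rewrite hres.
  have hD2 i : i \in map fst ps1 -> col i (S *m U2) = 0.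
    move=> i1; apply/colP => a; rewrite !mxE -UD2 big1 // => k _.
    by rewrite idm_mulr (negPf (dis _ i1)) mulr0.
  have hD1 i : i \in map fst ps2 -> col i (M *m U1) = 0.
    move=> i1; apply/colP => a; rewrite !mxE -UD1 big1 // => k _.
    by rewrite idm_mulr (negPf (dis' _ i1)) mulr0.
  have hE2 i : i \in map fst ps1 -> row i (L2 *m S) = 0.
    move=> i1; apply/rowP => a; rewrite !mxE -DL2 big1 // => k _.
    by rewrite idm_mull (negPf (dis _ i1)) mul0r.
  have hE1 i : i \in map fst ps2 -> row i (L1 *m M) = 0.
    move=> i1; apply/rowP => a; rewrite !mxE -DL1 big1 // => k _.
    by rewrite idm_mull (negPf (dis' _ i1)) mul0r.
  apply: (@gauss_cat _ _ _ S).
    apply: eq_gauss g1 => i i1; rewrite ?MU ?LM linearD /=.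
      by rewrite hD2 // addr0.
    by rewrite hE2 // addr0.
  apply: eq_gauss g2 => i i1; rewrite ?MU ?LM linearD /=.
    by rewrite hD1 // add0r.
  by rewrite hE1 // add0r.
- rewrite map_cat idm_cat // -/D1 -/D2 LM /U mulmxDl !mulmxBr !mulmxDr.
  rewrite -!(mulmxA L2) SU1 !(mulmxA _ U1) SU1.
  rewrite LMU1 (mulmxA L2 S) LSU2 !mul0mx !mulmx0 add0r subr0.
  rewrite mulmxA -/D1 DL1 mulmxA.
  by rewrite addrK.
- rewrite map_cat idm_cat // -/D1 -/D2 /L mulmxDl.
  rewrite !mulmxBr !mulmxDr DL1 DL2.
  have -> : D2 *m L1 = 0 by rewrite -DL1 mulmxA D21 mul0mx.
  have D1L2 : D1 *m L2 = 0 by rewrite -DL2 mulmxA D12 mul0mx.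
  rewrite !(mulmxA D1) !(mulmxA D2) D1L2 DL2 !mul0mx add0r addr0 subr0.
  by rewrite addrA.
- rewrite map_cat idm_cat // -/D1 -/D2 /U mulmxDr.
  rewrite !mulmxBl !mulmxDl UD1 UD2.
  have -> : U1 *m D2 = 0 by rewrite -UD1 -mulmxA D12 mulmx0.
  have U2D1 : U2 *m D1 = 0 by rewrite -UD2 -mulmxA D21 mulmx0.
  rewrite -!(mulmxA U1) -!(mulmxA L1) -!(mulmxA M) U2D1 UD2 !mulmx0 add0r addr0 subr0.
  by rewrite addrA.
- have s1 : {subset map fst ps1 <= map fst (ps1 ++ ps2)}.
    by move=> x x1; rewrite map_cat mem_cat x1.
  have s2 : {subset map fst ps2 <= map fst (ps1 ++ ps2)}.
    by move=> x x1; rewrite map_cat mem_cat x1 orbT.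
  have t1 : {subset map snd ps1 <= map snd (ps1 ++ ps2)}.
    by move=> x x1; rewrite map_cat mem_cat x1.
  have t2 : {subset map snd ps2 <= map snd (ps1 ++ ps2)}.
    by move=> x x1; rewrite map_cat mem_cat x1 orbT.
  split.
    rewrite /L mulmxBl mulmxDl -[L2 *m _ *m _ *m _]mulmxA.
    by rewrite (idm_mulr_sub s1 LD1) (idm_mulr_sub s2 LD2).
  rewrite /U mulmxBr mulmxDr (mulmxA (idm _)).
  by rewrite (idm_mull_sub t1 DU1) (idm_mull_sub t2 DU2).
Qed.

Definition supp m n (I : {set 'I_m}) (J : {set 'I_n}) (A : 'M[F]_(m, n)) : Prop :=
  forall i j, A i j != 0 -> (i \in I) && (j \in J).

Definition zero_on m n (I : {set 'I_m}) (J : {set 'I_n}) (A : 'M[F]_(m, n)) : Prop :=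
  forall i j, i \in I -> j \in J -> A i j = 0.

Lemma suppE m n (I : {set 'I_m}) (J : {set 'I_n}) (A : 'M[F]_(m, n)) i j :
  supp I J A -> ~~ ((i \in I) && (j \in J)) -> A i j = 0.
Proof. by move=> h; apply: contraNeq => /h. Qed.

Lemma supp_restr m n (I : {set 'I_m}) (J : {set 'I_n}) (A : 'M[F]_(m, n)) :
  supp I J A -> restr I J A = A.
Proof.
by move=> h; apply/matrixP => i j; rewrite mxE; case: ifPn => // /(suppE h) ->.
Qed.

Lemma suppS m n (I I1 : {set 'I_m}) (J J1 : {set 'I_n}) (A : 'M[F]_(m, n)) :
  I \subset I1 -> J \subset J1 -> supp I J A -> supp I1 J1 A.
Proof.
by move=> /subsetP sI /subsetP sJ h i j /h /andP[/sI -> /sJ ->].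
Qed.

Lemma supp_mul m n p (I : {set 'I_m}) (K1 K2 : {set 'I_n}) (J : {set 'I_p})
    (A : 'M[F]_(m, n)) (B : 'M[F]_(n, p)) :
  supp I K1 A -> supp K2 J B -> supp I J (A *m B).
Proof.
move=> hA hB i j; apply: contraNT => nij; rewrite mxE big1 // => k _.
case: (boolP (i \in I)) nij => /= [iI jJ|iI _].
  by rewrite (suppE hB) ?mulr0 // (negPf jJ) andbF.
by rewrite (suppE hA) ?mul0r // (negPf iI).
Qed.

Lemma suppD m n (I : {set 'I_m}) (J : {set 'I_n}) (A B : 'M[F]_(m, n)) :
  supp I J A -> supp I J B -> supp I J (A + B).
Proof.
move=> hA hB i j; apply: contraNT => nij.
by rewrite mxE (suppE hA) // (suppE hB) // addr0.
Qed.

Lemma suppN m n (I : {set 'I_m}) (J : {set 'I_n}) (A : 'M[F]_(m, n)) :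
  supp I J A -> supp I J (- A).
Proof. by move=> hA i j; rewrite mxE oppr_eq0; apply: hA. Qed.

Lemma supp0 m n (I : {set 'I_m}) (J : {set 'I_n}) : supp I J (0 : 'M[F]_(m, n)).
Proof. by move=> i j; rewrite mxE eqxx. Qed.

(** In the first case row [a] of [S *m U] is zero, in the second column [b] of [L *m S], so nothing
    is subtracted. This is why a later quadrant does not refill an earlier one. *)
Lemma resid_fix m n (R : {set 'I_m}) (C : {set 'I_n}) (S : 'M[F]_(m, n)) L U a b :
  supp R R L -> supp C R U ->
  (forall c, c \in C -> S a c = 0) \/ (forall r, r \in R -> S r b = 0) ->
  resid S L U a b = S a b.
Proof.
move=> hL hU h; rewrite mxE mxE mxE big1 ?subr0 // => k _; case: h => h.
  rewrite mxE big1 ?mul0r // => c _; case: (boolP (c \in C)) => cC.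
    by rewrite h // mul0r.
  by rewrite (suppE hU) ?mulr0 // (negPf cC).
rewrite [(L *m S) k b]mxE big1 ?mulr0 // => r _; case: (boolP (r \in R)) => rR.
  by rewrite h // mulr0.
by rewrite (suppE hL) ?mul0r // (negPf rR) andbF.
Qed.

End Gauss.

(** * Recursive elimination of a block *)

(* Transports what is known about a memory to an extension of it. *)
Ltac lift pre :=
  match type of pre with
  | is_true (prefix ?m _) => repeat match goal with
    | H : rep m _ _ |- _ => apply (rep_prefix pre) in H
    | H : rep_on _ _ m _ _ |- _ => apply (rep_on_prefix pre) in H
    | H : holds m _ _ |- _ => apply (holds_prefix pre) in H
    end
  end; clear pre.

Section Lift.
Variables (R : realType) (F : fieldType) (star : F -> F).

Lemma spec_step A B (p : prog F A) (f : A -> prog F B) mem (c1 c : R) Q1 Q2 :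
  spec star p mem c1 Q1 ->
  (forall mem' a, prefix mem mem' -> Q1 mem' a -> spec star (f a) mem' (c - c1) Q2) ->
  spec star (bind p f) mem c Q2.
Proof. by move=> h1 h2; apply: (spec_bind h1 h2); rewrite addrC subrK. Qed.

Lemma spec_le A (p : prog F A) mem (c1 c2 : R) Q :
  c1 <= c2 -> spec star p mem c1 Q -> spec star p mem c2 Q.
Proof. by move=> le [h1 h2 h3]; split=> //; apply: le_trans le. Qed.

Lemma spec_const A (x : F) (f : nat -> prog F A) mem (c : R) Q :
  (forall mem' z, prefix mem mem' -> holds mem' z x -> spec star (f z) mem' c Q) ->
  spec star (do z <- emit (Const x); f z) mem c Q.
Proof.
move=> h; apply: (spec_bind (spec_emit R star _ _) (c2 := c)); last by rewrite add0r.
by move=> mem' a pre /= ha; apply: h.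
Qed.

End Lift.

Definition matrix_sub (F : fieldType) m n (I : {set 'I_m}) (J : {set 'I_n})
    (A B : 'M[nat]_(m, n)) : prog F 'M[nat]_(m, n) :=
  build I J (fun i j => emit (Defs.Sub F (A i j) (B i j))).

Definition matrix_add (F : fieldType) m n (I : {set 'I_m}) (J : {set 'I_n})
    (A B : 'M[nat]_(m, n)) : prog F 'M[nat]_(m, n) :=
  build I J (fun i j => emit (Add F (A i j) (B i j))).

Definition matrix_star (F : fieldType) m n (I : {set 'I_m}) (J : {set 'I_n})
    (A : 'M[nat]_(m, n)) : prog F 'M[nat]_(m, n) :=
  build I J (fun i j => emit (Star F (A i j))).

(* [L], [U] describe the pivots already found in [M], whose Schur complement is
   [X]; the block R x C of [X] is eliminated next. *)
Definition lu_step (F : fieldType) m n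
    (mul : forall m p q : nat, {set 'I_m} -> {set 'I_p} -> {set 'I_q} ->
       'M[nat]_(m, p) -> 'M[nat]_(p, q) -> prog F 'M[nat]_(m, q))
    (rec : {set 'I_m} -> {set 'I_n} -> 'M[nat]_(m, n) ->
       prog F (seq ('I_m * 'I_n) * 'M[nat]_m * 'M[nat]_(n, m)))
    (I : {set 'I_m}) (J : {set 'I_n}) (M : 'M[nat]_(m, n))
    (R : {set 'I_m}) (C : {set 'I_n})
    (st : seq ('I_m * 'I_n) * 'M[nat]_m * 'M[nat]_(n, m) * 'M[nat]_(m, n)) :
    prog F (seq ('I_m * 'I_n) * 'M[nat]_m * 'M[nat]_(n, m) * 'M[nat]_(m, n)) :=
  let: (ps, L, U, X) := st in
  do d <- rec R C X;
  let: (ps2, L2, U2) := d in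
  do SU <- mul _ _ _ I J I X U2;
  do LS <- mul _ _ _ I I J L2 X;
  do V <- mul _ _ _ I I J SU LS;
  do X' <- matrix_sub F I J X V;
  do A1 <- mul _ _ _ I J I M U;
  do A2 <- mul _ _ _ I I I L2 A1;
  do A3 <- mul _ _ _ I I I A2 L;
  do A4 <- matrix_add F I I L L2;
  do L' <- matrix_sub F I I A4 A3;
  do B1 <- mul _ _ _ I J I M U2;
  do B2 <- mul _ _ _ I I I L B1;
  do B3 <- mul _ _ _ J I I U B2;
  do B4 <- matrix_add F J I U U2;
  do U' <- matrix_sub F J I B4 B3;
  ret F (ps ++ ps2, L', U', X').

Definition half m h (I : {set 'I_m}) : {set 'I_m} :=
  [set i in take (2 ^ h) (enum I)].

Definition lu_empty (F : fieldType) m n :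
    prog F (seq ('I_m * 'I_n) * 'M[nat]_m * 'M[nat]_(n, m)) :=
  do z <- emit (Const 0); ret F ([::], const_mx z, const_mx z).

Definition lu_single (F : fieldType) m n (M : 'M[nat]_(m, n)) i j :
    prog F (seq ('I_m * 'I_n) * 'M[nat]_m * 'M[nat]_(n, m)) :=
  do z <- emit (Const 0);
  do o <- emit (Const 1);
  do v <- emit (Div F o (M i j));
  ret F ([:: (i, j)],
         \matrix_(a, b) if (a == i) && (b == i) then o else z,
         \matrix_(a, b) if (a == j) && (b == i) then v else z).

(* The rows and columns of the pivots are zero in the Schur complements, so the
   later calls can be given whole half-size blocks; the order of the calls keeps
   the blocks already treated equal to zero. *)
Fixpoint lu (F : fieldType) (t : forall h, ctree F 'M[nat]_(2 ^ h)) m n (h : nat)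
    (I : {set 'I_m}) (J : {set 'I_n}) (M : 'M[nat]_(m, n)) :
    prog F (seq ('I_m * 'I_n) * 'M[nat]_m * 'M[nat]_(n, m)) :=
  match h with
  | 0 => if ([pick i in I], [pick j in J]) is (Some i, Some j) then
           branch (M i j) (lu_empty F m n) (lu_single F M i j)
         else lu_empty F m n
  | h'.+1 =>
    let step := lu_step (fun m p q => @block_mul F _ (t h) m p q)
                  (@lu F t m n h') I J M in
    let I1 := half h' I in let J1 := half h' J in
    do z <- emit (Const 0);
    do s1 <- step I1 J1 ([::], const_mx z, const_mx z, M);
    do s2 <- step I1 (J :\: J1) s1;
    do s3 <- step (I :\: I1) J1 s2;
    do s4 <- step (I :\: I1) (J :\: J1) s3;
    let: (ps, L, U, _) := s4 in ret F (ps, L, U)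
  end.

Lemma card_half m h (I : {set 'I_m}) : (#|half h I| <= 2 ^ h)%N.
Proof.
rewrite /half cardsE (leq_trans (card_size _)) // size_take.
by case: ltnP.
Qed.

Lemma half_sub m h (I : {set 'I_m}) : half h I \subset I.
Proof.
by apply/subsetP => i; rewrite inE => /mem_take; rewrite mem_enum.
Qed.

Lemma card_halfC m h (I : {set 'I_m}) :
  (#|I| <= 2 ^ h.+1)%N -> (#|I :\: half h I| <= 2 ^ h)%N.
Proof.
move=> leI.
have -> : I :\: half h I = [set i in drop (2 ^ h) (enum I)].
  apply/setP => i; rewrite !inE -[i \in I]mem_enum.
  have u := enum_uniq I; move: u; rewrite -{1 3}(cat_take_drop (2 ^ h) (enum I)).
  rewrite cat_uniq mem_cat => /and3P[_ /hasPn dis _].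
  by case: (boolP (i \in drop _ _)) => [/dis /= ->|]; rewrite ?orbT // orbF andNb.
rewrite cardsE (leq_trans (card_size _)) // size_drop -cardE.
by rewrite leq_subLR addnn -mul2n -expnS.
Qed.

Section LU.
Variables (R : realType) (F : fieldType) (star : F -> F).
Variable t : forall h, ctree F 'M[nat]_(2 ^ h).
Variables (u T : nat -> R).
Hypothesis tP : forall h (A B : 'M[F]_(2 ^ h)),
  let res := run star (t h) (entries A ++ entries B) in
  map_mx (fetch (memory res)) (result res) = A *m B /\ (cost res)%:R <= u h.
(** Lets [u h] pay for entrywise operations as well as for products. *)
Hypothesis u_sq : forall h, ((2 ^ h) * (2 ^ h))%:R <= u h.
(** A 1 x 1 block costs one zero test and one division. *)
Hypothesis T0 : 2 <= T 0.
(** Four half-size calls, each followed by the 9 products and 5 entrywise operations of [lu_step] at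
    full size. *)
Hypothesis TS : forall h, 4 * (T h + 14 * u h.+1) <= T h.+1.

Lemma spec_mul h m p q (I : {set 'I_m}) (K : {set 'I_p}) (J : {set 'I_q})
    A' A B' B mem :
  rep_on I K mem A' A -> rep_on K J mem B' B ->
  supp setT K A \/ supp K setT B ->
  (#|I| <= 2 ^ h)%N -> (#|K| <= 2 ^ h)%N -> (#|J| <= 2 ^ h)%N ->
  spec star (block_mul (t h) I K J A' B') mem (u h)
    (fun mem' C' => rep mem' C' (restr I J (A *m B))).
Proof.
move=> hA hB hs; apply: (spec_block_mul (@tP h)) => // i j k _ _ kK.
case: hs => hs; last by rewrite (suppE hs) ?mulr0 // (negPf kK).
by rewrite (suppE hs) ?mul0r // (negPf kK) andbF.
Qed.

Lemma spec_entrywise h m n (I : {set 'I_m}) (J : {set 'I_n}) g (V : 'M[F]_(m, n)) mem :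
  (forall i j mem', i \in I -> j \in J -> prefix mem mem' ->
     spec star (g i j) mem' (1 : R) (fun mem'' a => holds mem'' a (V i j))) ->
  (#|I| <= 2 ^ h)%N -> (#|J| <= 2 ^ h)%N ->
  spec star (build I J g) mem (u h) (fun mem' X' => rep mem' X' (restr I J V)).
Proof.
move=> hg leI leJ; apply: (spec_weaken (spec_build ler01 hg leI leJ)) => //.
by rewrite mul1r.
Qed.

Lemma spec_sub h m n (I : {set 'I_m}) (J : {set 'I_n}) A' A B' B mem :
  rep_on I J mem A' A -> rep_on I J mem B' B ->
  (#|I| <= 2 ^ h)%N -> (#|J| <= 2 ^ h)%N ->
  spec star (matrix_sub F I J A' B') mem (u h)
    (fun mem' C' => rep mem' C' (restr I J (A - B))).
Proof.
move=> hA hB; apply: spec_entrywise => i j mem' iI jJ pre; lift pre.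
apply: (spec_weaken (spec_emit _ _ _ _)) => //= mem'' a _.
by rewrite !mxE (hA i j iI jJ).2 (hB i j iI jJ).2.
Qed.

Lemma spec_add h m n (I : {set 'I_m}) (J : {set 'I_n}) A' A B' B mem :
  rep_on I J mem A' A -> rep_on I J mem B' B ->
  (#|I| <= 2 ^ h)%N -> (#|J| <= 2 ^ h)%N ->
  spec star (matrix_add F I J A' B') mem (u h)
    (fun mem' C' => rep mem' C' (restr I J (A + B))).
Proof.
move=> hA hB; apply: spec_entrywise => i j mem' iI jJ pre; lift pre.
apply: (spec_weaken (spec_emit _ _ _ _)) => //= mem'' a _.
by rewrite !mxE (hA i j iI jJ).2 (hB i j iI jJ).2.
Qed.

Lemma spec_star h m n (I : {set 'I_m}) (J : {set 'I_n}) A' A mem :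
  rep_on I J mem A' A ->
  (#|I| <= 2 ^ h)%N -> (#|J| <= 2 ^ h)%N ->
  spec star (matrix_star F I J A') mem (u h)
    (fun mem' C' => rep mem' C' (restr I J (map_mx star A))).
Proof.
move=> hA; apply: spec_entrywise => i j mem' iI jJ pre; lift pre.
apply: (spec_weaken (spec_emit _ _ _ _)) => //= mem'' a _.
by rewrite !mxE (hA i j iI jJ).2.
Qed.

Definition within m n (I : {set 'I_m}) (J : {set 'I_n}) (ps : seq ('I_m * 'I_n)) :=
  all (fun p => (p.1 \in I) && (p.2 \in J)) ps.

Definition lu_post m n (I : {set 'I_m}) (J : {set 'I_n}) (M : 'M[F]_(m, n)) mem
    (d : seq ('I_m * 'I_n) * 'M[nat]_m * 'M[nat]_(n, m)) (L : 'M_m) (U : 'M_(n, m)) :=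
  [/\ rep mem d.1.2 L /\ rep mem d.2 U, elim M d.1.1 L U, supp I I L, supp J I U
    & within I J d.1.1].

Lemma restr_mulr m n p (I : {set 'I_m}) (J : {set 'I_n}) (K : {set 'I_p}) A B :
  supp J K B -> restr I K (A *m B) = restr I setT A *m (B : 'M[F]_(n, p)).
Proof.
move=> hB; apply/matrixP => i k; rewrite !mxE.
case: (boolP (i \in I)) => iI /=; last first.
  by rewrite big1 // => j _; rewrite mxE (negPf iI) mul0r.
case: ifPn => kK; last rewrite big1 //; last first.
  by move=> j _; rewrite (suppE hB) ?mulr0 // (negPf kK) andbF.
by apply: eq_bigr => j _; rewrite mxE iI inE.
Qed.

Lemma supp_restrT m n (I : {set 'I_m}) (A : 'M[F]_(m, n)) : supp I setT (restr I setT A).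
Proof. by move=> i j; rewrite mxE inE andbT; case: ifP => // _; rewrite eqxx. Qed.

Lemma mul_restrl m n p (J : {set 'I_m}) (I : {set 'I_n}) (A : 'M[F]_(m, n)) (B : 'M[F]_(n, p)) :
  supp J I A -> A *m restr I setT B = A *m B.
Proof.
move=> hA; apply/matrixP => i k; rewrite !mxE; apply: eq_bigr => j _.
rewrite mxE inE andbT; case: ifPn => // jI.
by rewrite (suppE hA) ?mul0r // (negPf jI) andbF.
Qed.

(** The final clause records which entries the step leaves alone; the caller needs it to keep the
    blocks already treated equal to zero. *)
Lemma spec_lu_step h m n (rec : {set 'I_m} -> {set 'I_n} -> 'M[nat]_(m, n) ->
       prog F (seq ('I_m * 'I_n) * 'M[nat]_m * 'M[nat]_(n, m)))
    (I I0 : {set 'I_m}) (J J0 : {set 'I_n}) (c : R) M' (M : 'M[F]_(m, n)) st S L U mem :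
  (forall S' S mem, rep_on I0 J0 mem S' S ->
    spec star (rec I0 J0 S') mem c (fun mem' d => exists L U,
       lu_post I0 J0 S mem' d L U /\ zero_on I0 J0 (resid S L U))) ->
  I0 \subset I -> J0 \subset J -> (#|I| <= 2 ^ h)%N -> (#|J| <= 2 ^ h)%N ->
  rep_on I J mem M' M ->
  rep_on I J mem st.2 S -> lu_post I J M mem st.1 L U -> S = resid M L U ->
  spec star (lu_step (fun m p q => @block_mul F _ (t h) m p q) rec I J M' I0 J0 st)
    mem (c + 14 * u h)
    (fun mem' st' => exists S2 L2 U2,
      [/\ rep_on I J mem' M' M, rep_on I J mem' st'.2 S2,
          lu_post I J M mem' st'.1 L2 U2, S2 = resid M L2 U2
        & zero_on I0 J0 S2 /\
          forall a b, (forall j, j \in J0 -> S a j = 0) \/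
             (forall i, i \in I0 -> S i b = 0) -> S2 a b = S a b]).
Proof.
case: st => [[[ps L'] U'] S'] hrec sI sJ leI leJ rM /= rS [[rL rU] E sL sU W] SE.
apply: (spec_step (hrec _ _ _ (rep_onS sI sJ rS))).
move=> mem1 [[ps2 L2'] U2'] pre [L2 [U2 [[/= [rL2 rU2] E2 sL2 sU2 W2] Z2]]].
lift pre.
have sL2' := suppS sI sI sL2; have sU2' := suppS sJ sI sU2.
have [E3 RE] := elim_cat E (eq_rect _ (fun S => elim S ps2 L2 U2) E2 _ SE).
have sT k l (A : {set 'I_k}) (B : {set 'I_l}) X : supp A B X -> supp setT B (X : 'M[F]_(k, l)).
  by apply: suppS.
have sT' k l (A : {set 'I_k}) (B : {set 'I_l}) X : supp A B X -> supp A setT (X : 'M[F]_(k, l)).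
  by apply: suppS.
apply: (spec_step (spec_mul rS (rep_onW rU2) (or_intror (sT' _ _ _ _ _ sU2')) leI leJ leI)).
move=> mem2 SU pre rSU; lift pre.
rewrite (restr_mulr _ _ sU2') in rSU.
apply: (spec_step (spec_mul (rep_onW rL2) rS (or_introl (sT _ _ _ _ _ sL2'))
  leI leI leJ)).
move=> mem3 LS pre rLS; lift pre.
have sSU := supp_mul (@supp_restrT _ _ I S) sU2'.
apply: (spec_step (spec_mul (rep_onW rSU) (rep_restr_on rLS) (or_introl (sT _ _ _ _ _ sSU))
  leI leI leJ)).
move=> mem4 V pre rV; lift pre.
apply: (spec_step (spec_sub rS (rep_restr_on rV) leI leJ)).
move=> mem5 S2' pre rS2; lift pre.
have {}rS2 : rep_on I J mem5 S2' (resid S L2 U2).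
  move=> a b aI bJ; have := rS2 a b; rewrite mxE aI bJ /= -(restr_mulr I S sU2').
  congr (holds _ _ _); rewrite /resid mxE [RHS]mxE; congr (_ + _).
  rewrite mxE [RHS]mxE; congr (- _); rewrite mxE [RHS]mxE; apply: eq_bigr => k _.
  rewrite mxE aI /=; case: ifPn => // kI.
  rewrite [in RHS]mxE big1 ?mul0r // => l _.
  by rewrite (suppE sU2') ?mulr0 // (negPf kI) andbF.
clear rSU rLS rV.
apply: (spec_step (spec_mul rM (rep_onW rU) (or_intror (sT' _ _ _ _ _ sU)) leI leJ leI)).
move=> mem6 A1 pre rA1; lift pre.
rewrite (restr_mulr _ _ sU) in rA1.
apply: (spec_step (spec_mul (rep_onW rL2) (rep_onW rA1) (or_introl (sT _ _ _ _ _ sL2'))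
  leI leI leI)).
move=> mem7 A2 pre rA2; lift pre.
have sMU : supp I I (restr I setT M *m U) by exact: supp_mul (@supp_restrT _ _ _ _) sU.
have sA2 := supp_mul sL2' sMU.
rewrite (supp_restr sA2) in rA2.
(* [M] is represented on [I] x [J] only, but the columns of [L2] are supported in [I], so the other
   rows of [M] do not matter. *)
have A2E : L2 *m (restr I setT M *m U) = L2 *m (M *m U).
  by rewrite mulmxA (mul_restrl _ sL2') -mulmxA.
rewrite A2E in rA2 sA2.
apply: (spec_step (spec_mul (rep_onW rA2) (rep_onW rL) (or_introl (sT _ _ _ _ _ sA2))
  leI leI leI)).
move=> mem8 A3 pre rA3; lift pre.
have sA3 := supp_mul sA2 sL; rewrite (supp_restr sA3) in rA3.
apply: (spec_step (spec_add (rep_onW rL) (rep_onW rL2) leI leI)).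
move=> mem9 A4 pre rA4; lift pre.
have sA4 := suppD sL sL2'; rewrite (supp_restr sA4) in rA4.
apply: (spec_step (spec_sub (rep_onW rA4) (rep_onW rA3) leI leI)).
move=> mem10 L3' pre rL3; lift pre.
have sL3 := suppD sA4 (suppN sA3); rewrite (supp_restr sL3) in rL3.
apply: (spec_step (spec_mul rM (rep_onW rU2) (or_intror (sT' _ _ _ _ _ sU2')) leI leJ leI)).
move=> mem11 B1 pre rB1; lift pre.
rewrite (restr_mulr _ _ sU2') in rB1.
have sMU2 : supp I I (restr I setT M *m U2) by exact: supp_mul (@supp_restrT _ _ _ _) sU2'.
apply: (spec_step (spec_mul (rep_onW rL) (rep_onW rB1) (or_introl (sT _ _ _ _ _ sL))
  leI leI leI)).
move=> mem12 B2 pre rB2; lift pre.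
have sB2 := supp_mul sL sMU2.
rewrite (supp_restr sB2) in rB2.
have B2E : L *m (restr I setT M *m U2) = L *m (M *m U2).
  by rewrite mulmxA (mul_restrl _ sL) -mulmxA.
rewrite B2E in rB2 sB2.
apply: (spec_step (spec_mul (rep_onW rU) (rep_onW rB2) (or_introl (sT _ _ _ _ _ sU))
  leJ leI leI)).
move=> mem13 B3 pre rB3; lift pre.
have sB3 := supp_mul sU sB2; rewrite (supp_restr sB3) in rB3.
apply: (spec_step (spec_add (rep_onW rU) (rep_onW rU2) leJ leI)).
move=> mem14 B4 pre rB4; lift pre.
have sB4 := suppD sU sU2'; rewrite (supp_restr sB4) in rB4.
apply: (spec_step (spec_sub (rep_onW rB4) (rep_onW rB3) leJ leI)).
move=> mem15 U3' pre rU3; lift pre.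
have sU3 := suppD sB4 (suppN sB3); rewrite (supp_restr sU3) in rU3.
apply: spec_ret; first by lra.
rewrite -SE in RE.
exists (resid S L2 U2); exists (L + L2 - L2 *m (M *m U) *m L).
exists (U + U2 - U *m (L *m (M *m U2))); split=> //.
- split=> //=; rewrite /within all_cat; apply/andP; split=> //.
  apply/allP => p /(allP W2) /andP[p1 p2].
  by rewrite (subsetP sI _ p1) (subsetP sJ _ p2).
- by split=> // a b hab; apply: resid_fix sL2 sU2 hab.
Qed.

Lemma resid0 m n (M : 'M[F]_(m, n)) : resid M 0 0 = M.
Proof. by rewrite /resid mulmx0 mul0mx subr0. Qed.

Lemma spec_lu_empty m n (I : {set 'I_m}) (J : {set 'I_n}) (M : 'M[F]_(m, n)) mem (c : R) :
  0 <= c -> zero_on I J M ->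
  spec star (lu_empty F m n) mem c (fun mem' d => exists L U,
    lu_post I J M mem' d L U /\ zero_on I J (resid M L U)).
Proof.
move=> c0 Z; apply: spec_const => mem' z pre hz; apply: spec_ret => //.
exists 0; exists 0; rewrite resid0; split=> //; split=> //; try exact: supp0.
  by split=> i j; rewrite !mxE.
exact: elim_nil.
Qed.

Lemma spec_lu_single m n (I : {set 'I_m}) (J : {set 'I_n})
    (M' : 'M[nat]_(m, n)) (M : 'M[F]_(m, n)) i j mem (c : R) :
  1 <= c -> i \in I -> j \in J -> (#|I| <= 1)%N -> (#|J| <= 1)%N ->
  holds mem (M' i j) (M i j) -> M i j != 0 ->
  spec star (lu_single F M' i j) mem c (fun mem' d => exists L U,
    lu_post I J M mem' d L U /\ zero_on I J (resid M L U)).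
Proof.
move=> c1 iI jJ leI leJ hM M0.
apply: spec_const => mem1 z pre hz; lift pre.
apply: spec_const => mem2 o pre ho; lift pre.
apply: (spec_step (spec_emit R star _ _)) => mem3 v pre /=.
rewrite ho.2 hM.2 div1r => hv; lift pre.
apply: spec_ret; first by rewrite subr_ge0.
have E := elim_single M0.
exists (delta_mx i i); exists ((M i j)^-1 *: delta_mx j i); split; first split=> //=.
- split=> a b; rewrite !mxE; first by case: ifP.
  by case: ifP => _; rewrite /= ?mulr1 ?mulr0.
- move=> a b; rewrite mxE; case: (eqVneq a i) => [->|]; last by rewrite eqxx.
  by case: (eqVneq b i) => [->|]; rewrite ?iI // eqxx.
- move=> a b; rewrite !mxE; case: (eqVneq a j) => [->|]; last by rewrite mulr0 eqxx.
  by case: (eqVneq b i) => [->|]; rewrite ?iI ?jJ // mulr0 eqxx.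
- by rewrite iI jJ.
(* [I] has a single element, so row [a] is the pivot row, which the Schur complement clears. *)
- move=> a b aI bJ; have [g _ _ _ _] := E.
  have [_ _ h _] := gauss_pivots g; apply: h => /=.
  by rewrite inE; apply/eqP; apply: (card_le1_eqP leI).
Qed.

Lemma T_ge h : 2 <= T h.
Proof.
elim: h => [|h IH]; first exact: T0.
have := TS h; have : 0 <= u h.+1 := le_trans (ler0n _ _) (u_sq _).
lra.
Qed.

Lemma spec_lu m n h (I : {set 'I_m}) (J : {set 'I_n}) M' (M : 'M[F]_(m, n)) mem :
  (#|I| <= 2 ^ h)%N -> (#|J| <= 2 ^ h)%N -> rep_on I J mem M' M ->
  spec star (lu t h I J M') mem (T h) (fun mem' d => exists L U,
    lu_post I J M mem' d L U /\ zero_on I J (resid M L U)).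
Proof.
elim: h I J M' M mem => [|h IH] I J M' M mem leI leJ rM.
  have {}leI : (#|I| <= 1)%N := leI; have {}leJ : (#|J| <= 1)%N := leJ.
  rewrite /=; case: pickP => [i iI|I0]; last first.
    by apply: spec_lu_empty => [|a b aI]; [have := T0; lra | have := I0 a; rewrite /= aI].
  case: pickP => [j jJ|J0]; last first.
    by apply: spec_lu_empty => [|a b _ bJ]; [have := T0; lra | have := J0 b; rewrite /= bJ].
  apply: (spec_le (c1 := 1 + 1)); first by have := T0; lra.
  apply: (spec_branch (rM i j iI jJ)).
  + move=> Mij; apply: spec_lu_empty => // a b aI bJ.
    have -> : a = i := card_le1_eqP leI i a iI aI.
    by have -> : b = j := card_le1_eqP leJ j b jJ bJ.
  + by move=> Mij; apply: spec_lu_single => //; apply: rM.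
set I1 := half h I; set J1 := half h J; set I2 := I :\: I1; set J2 := J :\: J1.
have sI1 : I1 \subset I := half_sub _ _; have sJ1 : J1 \subset J := half_sub _ _.
have sI2 : I2 \subset I := subsetDl _ _; have sJ2 : J2 \subset J := subsetDl _ _.
have cI1 : (#|I1| <= 2 ^ h)%N := card_half _ _.
have cJ1 : (#|J1| <= 2 ^ h)%N := card_half _ _.
have cI2 : (#|I2| <= 2 ^ h)%N := card_halfC leI.
have cJ2 : (#|J2| <= 2 ^ h)%N := card_halfC leJ.
have step I0 J0 := @spec_lu_step h.+1 m n (@lu F t m n h) I I0 J J0 (T h) M' M.
have rec (I0 : {set 'I_m}) (J0 : {set 'I_n})
    (cI0 : (#|I0| <= 2 ^ h)%N) (cJ0 : (#|J0| <= 2 ^ h)%N) S' S mem0 :=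
  @IH I0 J0 S' S mem0 cI0 cJ0.
have TSh := TS h.
apply: spec_const => mem0 z pre hz; lift pre.
have P0 : lu_post I J M mem0 ([::], const_mx z, const_mx z) 0 0.
  by split=> //; [split=> i j; rewrite !mxE | exact: elim_nil | exact: supp0 | exact: supp0].
apply: (spec_step (step I1 J1 ([::], const_mx z, const_mx z, M') _ _ _ _
  (rec _ _ cI1 cJ1) sI1 sJ1 leI leJ rM rM P0 (esym (resid0 _)))).
move=> mem1 st1 pre {P0 hz rM} [S1 [L1 [U1 [rM rS P SE [Z1 _]]]]]; clear pre.
apply: (spec_step (step I1 J2 st1 _ _ _ _
  (rec _ _ cI1 cJ2) sI1 sJ2 leI leJ rM rS P SE)).
move=> mem2 st2 pre {P rM rS SE} [S2 [L2 [U2 [rM rS P SE [Z2 F2]]]]]; clear pre.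
apply: (spec_step (step I2 J1 st2 _ _ _ _
  (rec _ _ cI2 cJ1) sI2 sJ1 leI leJ rM rS P SE)).
move=> mem3 st3 pre {P rM rS SE} [S3 [L3 [U3 [rM rS P SE [Z3 F3]]]]]; clear pre.
apply: (spec_step (step I2 J2 st3 _ _ _ _
  (rec _ _ cI2 cJ2) sI2 sJ2 leI leJ rM rS P SE)).
move=> mem4 [[[ps L'] U'] S'] pre {P rM rS SE} [S4 [L4 [U4 [rM rS P SE [Z4 F4]]]]]; clear pre.
apply: spec_ret; first by lra.
exists L4; exists U4; split=> //; rewrite -SE.
have split_in k (A B : {set 'I_k}) a : a \in A -> a \in B \/ a \in A :\: B.
  by move=> aA; case: (boolP (a \in B)) => aB; [left | right; rewrite inE aB].
(* The second call pivots in the rows [I1], where the columns of [J1] are already zero. *)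
have Z2' : zero_on I1 J1 S2.
  by move=> a b aI bJ; rewrite F2 ?Z1 //; right=> i iI; apply: Z1.
have Z3' : zero_on I1 J S3.
  move=> a b aI bJ; rewrite F3; last by left=> j jJ; apply: Z2'.
  by case: (split_in _ _ J1 b bJ) => bJ'; [apply: Z2' | apply: Z2].
(* The last call pivots in [I2] x [J2]: columns of [J1] vanish on [I2], and rows of [I1] vanish on
   [J2], so only the last quadrant changes among the four. *)
move=> a b aI bJ; case: (split_in _ _ J1 b bJ) => bJ'.
  rewrite F4; last by right=> i iI; apply: Z3.
  by case: (split_in _ _ I1 a aI) => aI'; [apply: Z3' | apply: Z3].
case: (split_in _ _ I1 a aI) => aI'; last exact: Z4.
by rewrite F4 ?Z3' //; left=> j jJ; apply: Z3' => //; rewrite (subsetP sJ2).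
Qed.

End LU.

(** * From a list of operations to a peeled factorization *)

Definition row_vertex n m (i : 'I_m) : 'I_(n + m) := rshift n i.
Definition col_vertex n m (j : 'I_n) : 'I_(n + m) := lshift m j.

(* Rows and columns keep their original indices.  An elimination holds the
   column of L, the row of U and its image by the involution; a row peeling holds
   the coefficients of the other rows; a column peeling holds the images by the
   involution of the coefficients of the other columns. *)
Inductive op (V : Type) (m n : nat) : Type :=
  | OElim of 'I_m & 'I_n & ('I_m -> V) & ('I_n -> V) & ('I_n -> V)
  | ORow of 'I_m & ('I_m -> V)
  | OCol of 'I_n & ('I_n -> V).

Definition map_op (V W : Type) (f : V -> W) m n (x : op V m n) : op W m n :=
  match x with
  | OElim i j l u us => OElim i j (f \o l) (f \o u) (f \o us)
  | ORow i w => ORow n i (f \o w)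
  | OCol j w => OCol m j (f \o w)
  end.

Arguments map_op {V W} f {m n} x.

(** [Al] collects the rows and columns neither eliminated nor peeled. Peeled ones are zeroed instead
    of removed, so that all intermediate matrices have the same type. *)
Fixpoint valid (F : fieldType) (star : F -> F) m n (Al : {set 'I_(n + m)})
    (X : 'M[F]_(m, n)) (ops : seq (op F m n)) (Al' : {set 'I_(n + m)})
    (X' : 'M[F]_(m, n)) : Prop :=
  match ops with
  | [::] => Al' = Al /\ X' = X
  | OElim i j l u us :: ops' =>
    let X1 := \matrix_(a, b) (X a b - l a * u b) in
    [/\ [/\ row_vertex n i \in Al, col_vertex m j \in Al, l i = 1 & u j != 0],
        forall b, us b = star (u b),
        forall b, X1 i b = 0, forall a, X1 a j = 0
      & valid star (Al :\ row_vertex n i :\ col_vertex m j) X1 ops' Al' X']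
  | ORow i w :: ops' =>
    [/\ row_vertex n i \in Al,
        forall k, w k != 0 -> row_vertex n k \in Al :\ row_vertex n i,
        forall b, X i b = \sum_k w k * X k b
      & valid star (Al :\ row_vertex n i)
          (\matrix_(a, b) if a == i then 0 else X a b) ops' Al' X']
  | OCol j w :: ops' =>
    [/\ col_vertex m j \in Al,
        forall k, w k != 0 -> col_vertex m k \in Al :\ col_vertex m j,
        forall a, X a j = \sum_k X a k * star (w k)
      & valid star (Al :\ col_vertex m j)
          (\matrix_(a, b) if b == j then 0 else X a b) ops' Al' X']
  end.

(** * Permutations times lower trapezoidal matrices *)

Section LowerPerm.
Variables (F : fieldType).

Definition lower_trap (P : F -> Prop) p r (L : 'M[F]_(p, r)) : Prop :=
  forall (i : 'I_p) (k : 'I_r),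
    ((i < k)%N -> L i k = 0) /\ (i = k :> nat -> P (L i k)).

(** Invariant of the products of the tails of a chain; on the diagonal, [P] means equal to 1 for the
    [Y] side and nonzero for the [Z] side. Since the permutation fixes the eliminated indices, it
    can be pulled to the left through the next elementary matrix. *)
Definition lower_perm (P : F -> Prop) j p r (M : 'M[F]_(p, r)) : Prop :=
  exists2 s : 'S_p, (forall i : 'I_p, (i < j)%N -> s i = i) &
  exists2 L, M = perm_mx s *m L & lower_trap P L.

Lemma perm_mxE p (s : 'S_p) i k : (perm_mx s : 'M[F]_p) i k = (s i == k)%:R.
Proof. by rewrite !mxE. Qed.

Lemma perm_mul_mxE p r (s : 'S_p) (A : 'M[F]_(p, r)) i k :
  (perm_mx s *m A) i k = A (s i) k.
Proof. by rewrite -row_permE mxE. Qed.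

Lemma lower_perm1 P j p : P 1 -> lower_perm P j (1%:M : 'M[F]_p).
Proof.
move=> P1; exists 1%g => [i _|]; first by rewrite perm1.
exists 1%:M => [|i k]; first by rewrite perm_mx1 mul1mx.
rewrite mxE; split=> [lt|/val_inj ->]; last by rewrite eqxx.
by rewrite -val_eqE /= (ltn_eqF lt).
Qed.

Lemma lower_perm_mul P j p r (s : 'S_p) (M : 'M[F]_(p, r)) :
  (forall i : 'I_p, (i < j)%N -> s i = i) ->
  lower_perm P j M -> lower_perm P j (perm_mx s *m M).
Proof.
move=> hs [s' hs' [L -> hL]]; exists (s * s')%g => [i lt|].
  by rewrite permM hs // hs'.
by exists L => //; rewrite perm_mxM mulmxA.
Qed.

Lemma elementary_mul p q (j : 'I_p) (Y : 'M[F]_p) (C : 'M[F]_(p, q)) i b :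
  elementary_lower j Y ->
  (Y *m C) i b = Y i j * C j b + (if i == j then 0 else C i b).
Proof.
move=> hY; rewrite mxE (bigD1 j) //=; congr (_ + _).
case: (eqVneq i j) => [->|ij].
  rewrite big1 // => a aj; have [h _ _] := hY j a.
  by rewrite h ?(negPf aj) 1?eq_sym ?(negPf aj) ?mul0r //; apply/eqP.
rewrite (bigD1 i) //= big1 => [|a /andP[aj ai]].
  have [h _ _] := hY i i; rewrite h ?eqxx ?mul1r ?addr0 //.
  by move/val_inj/eqP; rewrite (negPf ij).
have [h _ _] := hY i a; rewrite h 1?eq_sym ?(negPf ai) ?mul0r //.
by move/val_inj/eqP; rewrite (negPf aj).
Qed.

(* Conjugating [Y] by a permutation that fixes the indices up to [j] leaves it
   elementary in column [j]. *)
Lemma lower_perm_elementary P p r (j : 'I_p) (Y : 'M[F]_p) (M : 'M[F]_(p, r)) :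
  (forall x y, P x -> P y -> P (x * y)) -> P (Y j j) ->
  elementary_lower j Y -> lower_perm P j.+1 M -> lower_perm P j (Y *m M).
Proof.
move=> Pm Pj hY [s hs [L -> hL]].
exists s => [i lt|]; first by apply: hs; apply: leqW.
have hs' (i : 'I_p) : (i < j.+1)%N -> (s^-1)%g i = i.
  by move=> /hs {1}<-; rewrite permK.
pose Y' := \matrix_(i, k) Y ((s^-1)%g i) ((s^-1)%g k).
have hY' : elementary_lower j Y'.
  move=> i k; have [h1 h2 h3] := hY ((s^-1)%g i) ((s^-1)%g k); rewrite mxE.
  split=> [kj|/val_inj kj ij|/val_inj kj ij].
  - rewrite h1 ?(inj_eq perm_inj) // => /val_inj kj'; apply: kj.
    by rewrite -[k](permKV s) kj' hs.
  - by rewrite h2 //; [rewrite kj hs' | rewrite hs' // ltnW].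
  - by rewrite h3 //; [rewrite kj hs' | rewrite hs' // ij].
exists (Y' *m L).
  rewrite !mulmxA; congr (_ *m L); apply/matrixP => i k.
  rewrite perm_mul_mxE !mxE permK (bigD1 ((s^-1)%g k)) //= big1 => [|l lk].
    by rewrite perm_mxE permKV eqxx mulr1 addr0.
  by rewrite perm_mxE -(inj_eq (@perm_inj _ s^-1)) permK (negPf lk) mulr0.
move=> i k; rewrite (elementary_mul _ _ _ hY').
have hj : forall k : 'I_r, (j < k)%N -> L j k = 0 by move=> k' lt; case: (hL j k') => h _; apply: h.
split=> [lt|ik].
- case: (ltngtP i j) => [ij|ji|/val_inj ij].
  + have [_ h _] := hY' i j; rewrite h // mul0r add0r.
    by case: (hL i k) => -> // _; case: eqP.
  + rewrite hj ?(ltn_trans ji) // mulr0 add0r; case: eqP => // _.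
    by case: (hL i k) => ->.
  + by rewrite ij eqxx hj ?mulr0 ?addr0 // -ij.
- case: (ltngtP i j) => [ij|ji|/val_inj ij].
  + have [_ h _] := hY' i j; rewrite h // mul0r add0r.
    case: eqP => [eij|_]; first by rewrite eij ltnn in ij.
    by case: (hL i k) => _; apply.
  + rewrite hj -?ik // mulr0 add0r.
    case: eqP => [eij|_]; first by rewrite eij ltnn in ji.
    by case: (hL i k) => _; apply.
  + rewrite ij eqxx addr0 mxE hs' //; apply: Pm => //.
    by case: (hL j k) => _; apply; rewrite -ij.
Qed.

(** The new row has index [p], and [r <= p] puts it below every diagonal position: its entries are
    unconstrained, and the permutation is extended by a fixed point. *)
Lemma lower_perm_peel P j p r (w : 'rV[F]_p) (M : 'M[F]_(p, r)) :
  (j <= p)%N -> (r <= p)%N ->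
  lower_perm P j M -> lower_perm P j (col_mx 1%:M w *m M).
Proof.
move=> lejp lerp [s hs [L -> hL]].
pose g (i : 'I_(p + 1)) : 'I_(p + 1) :=
  match split i with inl k => lshift 1 (s k) | inr k => rshift p k end.
have gl k : g (lshift 1 k) = lshift 1 (s k).
  by rewrite /g -[lshift 1 k]/(unsplit (inl k)) unsplitK.
have gr k : g (rshift p k) = rshift p k.
  by rewrite /g -[rshift p k]/(unsplit (inr k)) unsplitK.
have g_inj : injective g.
  move=> a b; rewrite -[a]splitK -[b]splitK.
  case: (split a) => a'; case: (split b) => b' /=; rewrite ?gl ?gr //.
  - by move=> /lshift_inj /perm_inj ->.
  - by move/eqP; rewrite eq_lrshift.
  - by move/eqP; rewrite eq_rlshift.
exists (perm g_inj) => [i lt|].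
  rewrite permE; have ip : (i < p)%N := leq_trans lt lejp.
  have -> : i = lshift 1 (Ordinal ip) by apply: val_inj.
  by rewrite gl hs.
exists (col_mx L (w *m (perm_mx s *m L))).
  apply/matrixP => i k; rewrite perm_mul_mxE permE mul_col_mx mul1mx.
  rewrite -[i]splitK; case: (split i) => i' /=.
    by rewrite gl !col_mxEu perm_mul_mxE.
  by rewrite gr !col_mxEd.
move=> i k; rewrite -[i]splitK; case: (split i) => i'.
  by rewrite /unsplit col_mxEu; apply: hL.
rewrite /unsplit col_mxEd; split=> [lt|eq].
  by have := ltn_trans lt (leq_trans (ltn_ord k) lerp); rewrite /= ltnNge leq_addr.
by have := leq_trans (ltn_ord k) lerp; rewrite -eq /= ltnNge leq_addr.
Qed.

(** The leading square block of size [r] is triangular with nonzero diagonal. *)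
Lemma lower_trap_rank P p r (L : 'M[F]_(p, r)) :
  (forall x, P x -> x != 0) -> (r <= p)%N -> lower_trap P L -> \rank L = r.
Proof.
move=> Pnz le hL; apply/eqP; rewrite eqn_leq rank_leq_col /=.
pose L0 : 'M[F]_r := rowsub (widen_ord le) L.
have L0u : L0 \in unitmx.
  rewrite unitmxE (_ : \det L0 = \prod_i L0 i i).
    rewrite unitfE; apply/prodf_neq0 => i _; apply: Pnz; rewrite mxE.
    by case: (hL (widen_ord le i) i) => _; apply.
  apply: det_trig; apply/is_trig_mxP => i k lt; rewrite mxE.
  by case: (hL (widen_ord le i) k) => ->.
rewrite -{1}(mxrank_unit L0u) /L0 (_ : rowsub _ L = rowsub (widen_ord le) 1%:M *m L).
  exact: mxrankM_maxr.
by rewrite mul_rowsub_mx mul1mx.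
Qed.

End LowerPerm.

(** * Operations as admissible pairs *)

Section Convert.
Variables (F : fieldType) (star : {rmorphism F -> F}).
Hypothesis star_involutive : involutive star.
Variables (m n : nat).

(* The current p x q matrix when [sg] and [ta] list the rows and columns that are
   not peeled, the [j] eliminated ones coming first. *)
Definition current (X : 'M[F]_(m, n)) p q (j : nat) (sg : 'I_p -> 'I_m)
    (ta : 'I_q -> 'I_n) : 'M[F]_(p, q) :=
  \matrix_(i, k) if (i < j)%N || (k < j)%N then (i == k :> nat)%:R
                 else X (sg i) (ta k).

(** The positions from [j] on are those of the alive indices. Peeled indices need no position, which
    is why [sg] is only injective. *)
Definition lists (T V : finType) (g : V -> T) (Al : {set T}) p (j : nat) (sg : 'I_p -> V) : Prop :=
  [/\ (j <= p)%N, injective sg, forall i : 'I_p, (j <= i)%N = (g (sg i) \in Al)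
    & forall a, g a \in Al -> exists i, sg i = a].

Definition perm_addr (z o : nat) p (s : 'S_p) : 'M[nat]_p :=
  \matrix_(i, k) if s i == k then o else z.

Lemma map_perm_addr (f : nat -> F) z o p (s : 'S_p) :
  f z = 0 -> f o = 1 -> map_mx f (perm_addr z o s) = perm_mx s.
Proof. by move=> fz fo; apply/matrixP => i k; rewrite !mxE; case: eqP. Qed.

Lemma ctrmxK p q (A : 'M[F]_(p, q)) : ctrmx star (ctrmx star A) = A.
Proof. by apply/matrixP => i k; rewrite !mxE star_involutive. Qed.

Lemma ctrmx_mul p q r (A : 'M[F]_(p, q)) (B : 'M[F]_(q, r)) :
  ctrmx star (A *m B) = ctrmx star B *m ctrmx star A.
Proof. by rewrite /ctrmx trmx_mul map_mxM. Qed.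

Lemma ctrmx_perm p (s : 'S_p) : ctrmx star (perm_mx s) = perm_mx s^-1.
Proof. by rewrite /ctrmx tr_perm_mx map_perm_mx. Qed.

Lemma ctrmx1 p : ctrmx star (1%:M : 'M[F]_p) = 1%:M.
Proof. by rewrite /ctrmx trmx1 map_mx1. Qed.

Definition factors (j r p q : nat) (X : 'M[F]_(p, q)) (c : transfs F r p q) : Prop :=
  [/\ peels star j X c, X = prodY c *m ctrmx star (prodZ c),
      lower_perm (fun x => x = 1) j (prodY c)
    & lower_perm (fun x => x != 0) j (prodZ c)].

Lemma lists_tperm (T V : finType) (g : V -> T) Al p j (sg : 'I_p -> V) (a b : 'I_p) :
  lists g Al j sg -> (j <= a)%N -> (j <= b)%N -> lists g Al j (sg \o tperm a b).
Proof.
move=> [h1 h2 h3 h4] ja jb; split=> // [|i|x /h4 [i <-]].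
- exact: inj_comp h2 perm_inj.
- rewrite /= -h3; case: tpermP => [->|->|_ _] //; by rewrite ja jb.
- by exists (tperm a b i); rewrite /= tpermK.
Qed.

Lemma tperm_fix p (j : nat) (a b i : 'I_p) :
  (j <= a)%N -> (j <= b)%N -> (i < j)%N -> tperm a b i = i.
Proof.
move=> ja jb ij; rewrite tpermD //; apply: contraTneq ij => <-; by rewrite -leqNgt.
Qed.

Lemma tperm_lt p (j : nat) (a b i : 'I_p) :
  (j <= a)%N -> (j <= b)%N -> (tperm a b i < j)%N = (i < j)%N.
Proof. by move=> ja jb; case: tpermP => [->|->|_ _] //; rewrite !ltnNge ja jb. Qed.

Definition fixes p (j : nat) (s : 'S_p) : Prop :=
  (forall i : 'I_p, (i < j)%N -> s i = i) /\ forall i : 'I_p, (s i < j)%N = (i < j)%N.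

Lemma fixes_tperm p j (a b : 'I_p) : (j <= a)%N -> (j <= b)%N -> fixes j (tperm a b).
Proof. by move=> ja jb; split=> i; [apply: tperm_fix | apply: tperm_lt]. Qed.

Lemma fixes1 p j : fixes j (1%g : 'S_p).
Proof. by split=> i; rewrite perm1. Qed.

Lemma current_perm X p q j (sg sg1 : 'I_p -> 'I_m) (ta ta1 : 'I_q -> 'I_n) (s : 'S_p) (t : 'S_q) :
  fixes j s -> fixes j t ->
  (forall i, sg i = sg1 (s i)) -> (forall k, ta k = ta1 (t k)) ->
  current X j sg ta = perm_mx s *m current X j sg1 ta1 *m ctrmx star (perm_mx t).
Proof.
move=> [sfix slt] [tfix tlt] hsg hta; rewrite ctrmx_perm -mulmxA -col_permE -row_permE.
apply/matrixP => i k; rewrite !mxE ?invgK hsg hta slt tlt.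
case: (ltnP i j) => [ij|ji] /=; first rewrite (sfix _ ij).
  case: (ltnP k j) => kj; first by rewrite (tfix _ kj).
  have -> : (i == k :> nat) = false by apply: ltn_eqF; apply: leq_trans kj.
  have -> // : (i == t k :> nat) = false.
  by apply: ltn_eqF; apply: leq_trans ij _; rewrite leqNgt tlt -leqNgt.
case: (ltnP k j) => kj //; rewrite (tfix _ kj).
have -> : (i == k :> nat) = false by apply: gtn_eqF; apply: leq_trans ji.
have -> // : (s i == k :> nat) = false.
by apply: gtn_eqF; apply: leq_trans kj _; rewrite leqNgt slt -leqNgt.
Qed.

Lemma factors_cons j j' r p q p' q' (X : 'M[F]_(p, q)) (X' : 'M[F]_(p', q'))
    (Y : 'M[F]_(p, p')) (Z : 'M[F]_(q, q')) (c : transfs F r p' q') :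
  X = Y *m X' *m ctrmx star Z -> peel_step star j X' Y Z j' ->
  factors j' X' c ->
  lower_perm (fun x => x = 1) j (Y *m prodY c) ->
  lower_perm (fun x => x != 0) j (Z *m prodZ c) ->
  factors j X (TCons Y Z c).
Proof.
move=> XE st [h1 h2 _ _] h3 h4; split=> //=; first exact: PeelsCons XE st h1.
by rewrite XE h2 ctrmx_mul !mulmxA.
Qed.

Lemma factors_perm j r p q (X X' : 'M[F]_(p, q)) (s : 'S_p) (t : 'S_q) (c : transfs F r p q) :
  fixes j s -> fixes j t ->
  X = perm_mx s *m X' *m ctrmx star (perm_mx t) ->
  factors j X' c -> factors j X (TCons (perm_mx s) (perm_mx t) c).
Proof.
move=> [hs _] [ht _] XE hc; have [_ _ h3 h4] := hc.
apply: factors_cons XE (StepPerm _ _ hs ht) hc _ _; exact: lower_perm_mul.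
Qed.

Lemma factors_elim j r p q (X X' : 'M[F]_(p, q)) Y Z (c : transfs F r p q)
    (jp : (j < p)%N) (jq : (j < q)%N) :
  elementary_lower j Y -> elementary_lower j Z -> Y (Ordinal jp) (Ordinal jp) = 1 ->
  (forall (i : 'I_p) (k : 'I_q), (i = j :> nat) \/ (k = j :> nat) ->
         X' i k = (i == k :> nat)%:R) ->
  X = Y *m X' *m ctrmx star Z ->
  factors j.+1 X' c -> factors j X (TCons Y Z c).
Proof.
move=> hY hZ Y1 hX' XE hc; have [_ _ h3 h4] := hc.
apply: factors_cons XE (StepElim _ jp jq hY hZ hX') hc _ _.
- by apply: (lower_perm_elementary (j := Ordinal jp)) h3 => // x y -> ->; rewrite mul1r.
- apply: (lower_perm_elementary (j := Ordinal jq)) h4 => //.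
    by move=> x y; apply: mulf_neq0.
  by have [_ _ h] := hZ (Ordinal jq) (Ordinal jq); apply: h.
Qed.

Lemma factors_row j r p q (X : 'M[F]_(p + 1, q)) (X' : 'M[F]_(p, q)) (w : 'rV[F]_p)
    (c : transfs F r p q) :
  (j <= p)%N -> (r <= p)%N -> (forall i : 'I_p, (i < j)%N -> w ord0 i = 0) ->
  X = col_mx 1%:M w *m X' ->
  factors j X' c -> factors j X (TCons (col_mx 1%:M w) 1%:M c).
Proof.
move=> jp rp hw XE hc; have [_ _ h3 h4] := hc.
have wE : w = ctrmx star (ctrmx star w) by rewrite ctrmxK.
rewrite {1}wE; apply: factors_cons hc _ _.
- by rewrite -wE ctrmx1 mulmx1.
- by apply: StepPeelRow => // i /hw; rewrite !mxE => ->; rewrite rmorph0.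
- by rewrite -wE; apply: lower_perm_peel.
- by rewrite mul1mx.
Qed.

Lemma factors_col j r p q (X : 'M[F]_(p, q + 1)) (X' : 'M[F]_(p, q)) (w : 'rV[F]_q)
    (c : transfs F r p q) :
  (j <= q)%N -> (r <= q)%N -> (forall i : 'I_q, (i < j)%N -> w ord0 i = 0) ->
  X = X' *m ctrmx star (col_mx 1%:M w) ->
  factors j X' c -> factors j X (TCons 1%:M (col_mx 1%:M w) c).
Proof.
move=> jq rq hw XE hc; have [_ _ h3 h4] := hc.
have wE : w = ctrmx star (ctrmx star w) by rewrite ctrmxK.
rewrite {1}wE; apply: factors_cons hc _ _.
- by rewrite -wE mul1mx.
- by apply: StepPeelCol => // i /hw; rewrite !mxE => ->; rewrite rmorph0.
- by rewrite mul1mx.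
- by rewrite -wE; apply: lower_perm_peel.
Qed.

(** Eliminated positions get the address of a zero whatever [l] holds there, so the matrix is lower
    triangular by construction. *)
Definition elem_addr (z o : nat) p (j : nat) (l : 'I_p -> nat) : 'M[nat]_p :=
  \matrix_(i, k) if k == j :> nat then if (i < j)%N then z else l i
                 else if i == k then o else z.

Lemma map_elem_addr (f : nat -> F) z o p j (l : 'I_p -> nat) i k :
  f z = 0 -> f o = 1 ->
  map_mx f (elem_addr z o j l) i k =
  if k == j :> nat then if (i < j)%N then 0 else f (l i) else (i == k)%:R.
Proof. by move=> fz fo; rewrite !mxE; do !case: ifP. Qed.

Lemma elementary_elem_addr (f : nat -> F) z o p j (l : 'I_p -> nat) (jp : (j < p)%N) :
  f z = 0 -> f o = 1 -> f (l (Ordinal jp)) != 0 ->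
  elementary_lower j (map_mx f (elem_addr z o j l)).
Proof.
move=> fz fo lj i k; rewrite map_elem_addr //; split.
- by move/eqP/negPf ->.
- by move=> -> ij; rewrite eqxx ij.
- move=> -> ij; rewrite eqxx ij ltnn.
  by rewrite (_ : i = Ordinal jp) //; apply: val_inj.
Qed.

(** On the alive part, the two elementary factors put back the rank-one term [l a * u b]; the unit
    row and column at position [j] of the next matrix carry it. *)
Lemma current_elim (X : 'M[F]_(m, n)) p q j (sg : 'I_p -> 'I_m) (ta : 'I_q -> 'I_n)
    (jp : (j < p)%N) (jq : (j < q)%N) (l : 'I_m -> F) (u : 'I_n -> F)
    (Y : 'M[F]_p) (Z : 'M[F]_q) :
  let X1 := \matrix_(a, b) (X a b - l a * u b) in
  (forall b, X1 (sg (Ordinal jp)) b = 0) -> (forall a, X1 a (ta (Ordinal jq)) = 0) ->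
  elementary_lower j Y -> elementary_lower j Z ->
  (forall i : 'I_p, Y i (Ordinal jp) = if (i < j)%N then 0 else l (sg i)) ->
  (forall k : 'I_q, Z k (Ordinal jq) = if (k < j)%N then 0 else star (u (ta k))) ->
  current X j sg ta = Y *m current X1 j.+1 sg ta *m ctrmx star Z.
Proof.
move=> X1 hr hc hY hZ YE ZE; set C := current X1 _ _ _.
have tr (A : 'M[F]_(p, q)) i k : (A *m ctrmx star Z) i k = star ((Z *m ctrmx star A) k i).
  by rewrite -[A in LHS]ctrmxK -ctrmx_mul !mxE.
have CE (a : 'I_p) (b : 'I_q) : C a b =
    if (a < j.+1)%N || (b < j.+1)%N then (a == b :> nat)%:R else X1 (sg a) (ta b).
  by rewrite mxE.
have YC i k : (Y *m C) i k = Y i (Ordinal jp) * (j == k :> nat)%:R +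
    (if i == j :> nat then 0 else C i k).
  by rewrite (elementary_mul (j := Ordinal jp)) // CE /= ltnSn.
have YCj i : (Y *m C) i (Ordinal jq) = if (i < j)%N then 0 else l (sg i).
  by rewrite YC /= eqxx mulr1 YE CE /= ltnSn orbT; case: eqP => _; rewrite addr0.
have YCk i (k : 'I_q) : k != j :> nat -> (Y *m C) i k = if i == j :> nat then 0 else C i k.
  by move=> kj; rewrite YC eq_sym (negPf kj) mulr0 add0r.
have main i k : (Y *m C *m ctrmx star Z) i k =
    (if (k < j)%N then 0 else u (ta k)) * (if (i < j)%N then 0 else l (sg i)) +
    (if (k == j :> nat) || (i == j :> nat) then 0 else C i k).
  rewrite tr (elementary_mul (j := Ordinal jq)) // ZE [ctrmx _ _ (Ordinal jq) i]mxE.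
  rewrite [_^T _ _]mxE YCj rmorphD rmorphM /= star_involutive; congr (_ * _ + _).
    by case: ifP; rewrite ?rmorph0 ?star_involutive.
  rewrite -val_eqE /=; case: (eqVneq (k : nat) j) => kj /=; first by rewrite rmorph0.
  by rewrite [ctrmx _ _ _ _]mxE [_^T _ _]mxE star_involutive YCk.
apply/matrixP => i k; rewrite main CE !ltnS.
have XE a b : X a b = l a * u b + X1 a b by rewrite mxE addrC subrK.
rewrite mxE; case: (ltngtP i j) => [ij|ij|ij] /=.
- rewrite mulr0 add0r /= orbF.
  by case: (eqVneq (k : nat) j) => // ->; rewrite (ltn_eqF ij).
- rewrite orbF; case: (ltngtP k j) => [kj|kj|kj] /=.
  + by rewrite mul0r add0r.
  + by rewrite XE mulrC.
  + by rewrite addr0 XE mulrC (_ : k = Ordinal jq) ?hc ?addr0 //; exact: val_inj.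
- rewrite orbT addr0; case: (ltnP k j) => kj.
    by rewrite mul0r ij (gtn_eqF kj).
  by rewrite XE mulrC (_ : i = Ordinal jp) ?hr ?addr0 //; exact: val_inj.
Qed.

End Convert.

Section ConvertOps.
Variables (F : fieldType) (star : {rmorphism F -> F}).
Hypothesis star_involutive : involutive star.

Lemma sum_inj (V : nmodType) (T : finType) p (h : 'I_p -> T) (G : T -> V) (P : pred 'I_p) :
  injective h -> (forall a, G a != 0 -> exists2 i, P i & h i = a) ->
  \sum_a G a = \sum_(i | P i) G (h i).
Proof.
move=> h_inj hG; rewrite -(big_imset (h := h) (A := P) G) /=; last by move=> x y _ _; apply: h_inj.
rewrite [RHS]big_mkcond; apply: eq_bigr => a _; case: ifPn => // /imsetP na.
by apply/eqP; apply/negPn/negP => /hG [i Pi ia]; apply: na; exists i.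
Qed.

Lemma current_row m n (X : 'M[F]_(m, n)) p q j (sg : 'I_(p + 1) -> 'I_m) (ta : 'I_q -> 'I_n)
    (w : 'I_m -> F) (w' : 'rV[F]_p) :
  (j <= p)%N -> injective sg ->
  (forall k, w k != 0 -> exists2 i : 'I_p, (j <= i)%N & sg (lshift 1 i) = k) ->
  (forall b, X (sg (rshift p ord0)) b = \sum_k w k * X k b) ->
  (forall i, w' ord0 i = if (i < j)%N then 0 else w (sg (lshift 1 i))) ->
  current X j sg ta = col_mx 1%:M w' *m
    current (\matrix_(a, b) if a == sg (rshift p ord0) then 0 else X a b) j
      (sg \o lshift 1) ta.
Proof.
move=> jp sgI hw hX hw'; rewrite mul_col_mx mul1mx; apply/matrixP => i k.
rewrite -[i]splitK; case: (split i) => i'; rewrite /unsplit.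
  rewrite col_mxEu !mxE /=; case: ifP => // _.
  case: eqP => // /sgI /eqP; by rewrite eq_lrshift.
rewrite col_mxEd mxE [i']ord1 /= addn0 ltnNge jp /=.
(* An eliminated column of the current matrix is a unit vector, and its row has coefficient 0; the
   other columns follow from the relation on [X]. *)
rewrite mxE; case: (ltnP k j) => kj.
  rewrite (gtn_eqF (leq_trans kj jp)).
  rewrite (bigD1 (Ordinal (leq_trans kj jp))) //= big1 => [|a ak].
    by rewrite hw' /= kj mul0r addr0.
  by rewrite mxE kj orbT -val_eqE /= in ak *; rewrite (negPf ak) mulr0.
rewrite hX (sum_inj (h := sg \o lshift 1) (P := fun i : 'I_p => (j <= i)%N)).
- rewrite big_mkcond; apply: eq_bigr => a _; rewrite hw' mxE /= leqNgt.
  case: (ltnP a j) => aj /=; first by rewrite mul0r.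
  rewrite ltnNge kj /= mxE; case: eqP => // /sgI /eqP; by rewrite eq_lrshift.
- by move=> a b /= /sgI /lshift_inj.
- move=> a; rewrite mulf_eq0 negb_or => /andP[/hw [i0 ? ?] _]; by exists i0.
Qed.

Lemma current_col m n (X : 'M[F]_(m, n)) p q j (sg : 'I_p -> 'I_m) (ta : 'I_(q + 1) -> 'I_n)
    (w : 'I_n -> F) (w' : 'rV[F]_q) :
  (j <= q)%N -> injective ta ->
  (forall k, w k != 0 -> exists2 i : 'I_q, (j <= i)%N & ta (lshift 1 i) = k) ->
  (forall a, X a (ta (rshift q ord0)) = \sum_k X a k * star (w k)) ->
  (forall i, w' ord0 i = if (i < j)%N then 0 else w (ta (lshift 1 i))) ->
  current X j sg ta =
    current (\matrix_(a, b) if b == ta (rshift q ord0) then 0 else X a b) j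
      sg (ta \o lshift 1) *m ctrmx star (col_mx 1%:M w').
Proof.
move=> jq taI hw hX hw'.
(* Conjugate transposition exchanges the two lists of [current], which reduces columns to rows. *)
have tr p1 q1 (sg1 : 'I_p1 -> 'I_m) (ta1 : 'I_q1 -> 'I_n) (A : 'M[F]_(m, n)) :
    current A j sg1 ta1 = ctrmx star (current (ctrmx star A) j ta1 sg1).
  apply/matrixP => a b; rewrite !mxE orbC; case: ifP => _.
    by rewrite eq_sym; case: eqP; rewrite ?rmorph0 ?rmorph1.
  by rewrite star_involutive.
rewrite tr (@current_row _ _ _ _ _ _ _ _ w w') //; last first.
  move=> b; rewrite !mxE hX rmorph_sum; apply: eq_bigr => k _.
  by rewrite rmorphM /= star_involutive !mxE mulrC.
rewrite ctrmx_mul [in RHS]tr; congr (ctrmx _ (current _ _ _ _) *m _).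
by apply/matrixP => a b; rewrite !mxE; case: ifP; rewrite ?rmorph0.
Qed.

Lemma lists_eliminate (T V : finType) (g : V -> T) (Al : {set T}) p j (sg : 'I_p -> V) (jp : (j < p)%N) :
  injective g -> lists g Al j sg -> lists g (Al :\ g (sg (Ordinal jp))) j.+1 sg.
Proof.
move=> gI [h1 h2 h3 h4]; split=> // [i|a]; last by rewrite !inE => /andP[_ /h4].
rewrite !inE -h3 (inj_eq gI) (inj_eq h2) -val_eqE /= ltn_neqAle eq_sym.
by [].
Qed.

Lemma lists_other (T V : finType) (g : V -> T) (Al : {set T}) x p j (sg : 'I_p -> V) :
  (forall a, g a != x) -> lists g Al j sg -> lists g (Al :\ x) j sg.
Proof.
move=> gx [h1 h2 h3 h4]; split=> // [i|a]; first by rewrite !inE gx h3.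
by rewrite !inE => /andP[_ /h4].
Qed.

Lemma lists_peel (T V : finType) (g : V -> T) (Al : {set T}) p j (sg : 'I_(p + 1) -> V) :
  injective g -> (j <= p)%N -> lists g Al j sg ->
  lists g (Al :\ g (sg (rshift p ord0))) j (sg \o lshift 1).
Proof.
move=> gI jp [h1 h2 h3 h4]; split=> // [|i|a].
- by apply: inj_comp h2 _; apply: lshift_inj.
- by rewrite /= !inE (inj_eq gI) (inj_eq h2) eq_lrshift -h3.
- rewrite !inE (inj_eq gI) => /andP[ax /h4 [i ia]].
  move: ia ax; rewrite -[i]splitK; case: (split i) => i' <-; first by exists i'.
  by rewrite [i']ord1 eqxx.
Qed.

Variables (m n : nat).

(** A placeholder, for lists of operations that are valid for no values. *)
Lemma transfs_exists p q : exists r (c : transfs nat r p q), (r <= p)%N /\ (r <= q)%N.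
Proof. by exists 0; exists (TCons (const_mx 0) (const_mx 0) (TNil (r := 0))). Qed.

Definition represents (z o : nat) (f : nat -> F) := f z = 0 /\ f o = 1.

(** The chain is chosen before [f], since a tree outputs addresses only. An operation becomes two
    pairs: a transposition that brings its index to position [j] or to the end, and the elementary
    or peeling pair. *)
Lemma convert_ops z o (ops : seq (op nat m n)) p q j (sg : 'I_p -> 'I_m) (ta : 'I_q -> 'I_n)
    (Al : {set 'I_(n + m)}) :
  lists (@row_vertex n m) Al j sg -> lists (@col_vertex n m) Al j ta ->
  exists r (c : transfs nat r p q), [/\ (r <= p)%N, (r <= q)%N &
    forall f X X', represents z o f ->
      valid star Al X (map (map_op f) ops) set0 X' ->
      factors star j (current X j sg ta) (map_transfs f c)].
Proof.
have rI := @rshift_inj n m : injective (@row_vertex n m).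
have cI := @lshift_inj n m : injective (@col_vertex n m).
elim: ops p q j sg ta Al => [|x ops IH] p q j sg ta Al hsg hta.
  (* A valid list ends with [Al] empty. All positions are then eliminated, so [p], [q] and [j]
     coincide and give the inner dimension. *)
  case: (pselect (Al = set0)) => [Al0|nAl]; last first.
    have [r [c [rp rq]]] := transfs_exists p q.
    by exists r; exists c; split=> // f X X' _ /= [/esym].
  have jE k (V : finType) (g : V -> 'I_(n + m)) (h : 'I_k -> V) : lists g Al j h -> j = k.
    case=> h1 _ h3 _; apply/eqP; rewrite eqn_leq h1 leqNgt; apply/negP => lt.
    by have := h3 (Ordinal lt); rewrite Al0 inE /= leqnn.
  have jp := jE _ _ _ _ hsg; have jq := jE _ _ _ _ hta; subst p; subst q.
  exists j; exists TNil; split=> // f X X' _ _ /=.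
  have -> : current X j sg ta = 1%:M.
    by apply/matrixP => i k; rewrite !mxE ltn_ord.
  by split; [exact: PeelsNil | rewrite /= ctrmx1 mulmx1
            | exact: lower_perm1 | apply: lower_perm1; exact: oner_neq0].
(* Whether the index of an operation is alive does not depend on the values, so a single valid
   instance tells where the index sits in the lists. *)
case: (pselect (exists f X X', represents z o f /\
    valid star Al X (map (map_op f) (x :: ops)) set0 X')); last first.
  move=> no; have [r [c [rp rq]]] := transfs_exists p q.
  by exists r; exists c; split=> // f X X' h1 h2; case: no; exists f, X, X'.
move=> [f0 [X0 [X0' [[f0z f0o] val0]]]].
have [jp sgI sgAl sgS] := hsg; have [jq taI taAl taS] := hta.
case: x val0 => [i0 j0 l u us|i0 w|j0 w] /=.
- move=> [[/[dup] /sgS [a ai] iAl /[dup] /taS [b bj] jAl li uj] _ _ _ _].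
  have ja : (j <= a)%N by rewrite sgAl ai.
  have jb : (j <= b)%N by rewrite taAl bj.
  have ltp : (j < p)%N := leq_ltn_trans ja (ltn_ord a).
  have ltq : (j < q)%N := leq_ltn_trans jb (ltn_ord b).
  pose sg1 := sg \o tperm (Ordinal ltp) a; pose ta1 := ta \o tperm (Ordinal ltq) b.
  have sg1j : sg1 (Ordinal ltp) = i0 by rewrite /sg1 /= tpermL.
  have ta1j : ta1 (Ordinal ltq) = j0 by rewrite /ta1 /= tpermL.
  have hsg1 : lists (@row_vertex n m) (Al :\ row_vertex n i0 :\ col_vertex m j0) j.+1 sg1.
    apply: lists_other => [k|]; first by rewrite /row_vertex /col_vertex eq_rlshift.
    rewrite -sg1j; apply: lists_eliminate => //; exact: lists_tperm.
  have hta1 : lists (@col_vertex n m) (Al :\ row_vertex n i0 :\ col_vertex m j0) j.+1 ta1.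
    rewrite setDDl setUC -setDDl -ta1j.
    apply: lists_other => [k|]; first by rewrite /row_vertex /col_vertex eq_lrshift.
    apply: lists_eliminate => //; exact: lists_tperm.
  have [r [c [rp rq hc]]] := IH _ _ _ _ _ _ hsg1 hta1.
  exists r; exists (TCons (perm_addr z o (tperm (Ordinal ltp) a))
                 (perm_addr z o (tperm (Ordinal ltq) b))
         (TCons (elem_addr z o j (l \o sg1)) (elem_addr z o j (us \o ta1)) c)).
  split=> // f X X' [fz fo] /= [[_ _ fli fuj] fus hr hcl hval].
  rewrite !map_perm_addr //.
  apply: (factors_perm (X' := current X j sg1 ta1)) => //.
  + exact: fixes_tperm.
  + exact: fixes_tperm.
  + by apply: current_perm; [exact: fixes_tperm | exact: fixes_tperm
      | move=> i; rewrite /sg1 /= tpermK | move=> i; rewrite /ta1 /= tpermK].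
  have hY : elementary_lower j (map_mx f (elem_addr z o j (l \o sg1))).
    by apply: (elementary_elem_addr (jp := ltp)) => //; rewrite /= sg1j fli oner_neq0.
  have hZ : elementary_lower j (map_mx f (elem_addr z o j (us \o ta1))).
    apply: (elementary_elem_addr (jp := ltq)) => //.
    by rewrite /= ta1j; have := fus j0 => /= ->; rewrite fmorph_eq0.
  have YE (i : 'I_p) : map_mx f (elem_addr z o j (l \o sg1)) i (Ordinal ltp) =
      if (i < j)%N then 0 else (f \o l) (sg1 i).
    by rewrite map_elem_addr //= eqxx.
  have ZE (i : 'I_q) : map_mx f (elem_addr z o j (us \o ta1)) i (Ordinal ltq) =
      if (i < j)%N then 0 else star ((f \o u) (ta1 i)).
    by rewrite map_elem_addr //= eqxx; case: ifP => // _; apply: fus.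
  apply: (factors_elim (jp := ltp) ltq hY hZ _ _ _ (hc f _ X' (conj fz fo) hval)).
  + by rewrite YE ltnn sg1j.
  + by move=> i k ik; rewrite mxE !ltnS; case: ik => ->; rewrite leqnn ?orbT.
  + apply: (current_elim star_involutive _ _ hY hZ YE ZE) => x; rewrite ?sg1j ?ta1j.
      exact: hr.
    exact: hcl.
- move=> [/[dup] /sgS [a ai] iAl _ _ _].
  have ja : (j <= a)%N by rewrite sgAl ai.
  have pE : p = (p.-1 + 1)%N by rewrite addn1 prednK // (leq_ltn_trans _ (ltn_ord a)).
  move: (p.-1) pE => p' pE; subst p.
  have jp' : (j <= p')%N by have := leq_ltn_trans ja (ltn_ord a); rewrite addn1 ltnS.
  pose e := rshift p' (ord0 : 'I_1); have je : (j <= e)%N by rewrite /= addn0.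
  pose sg1 := sg \o tperm e a.
  have sg1e : sg1 e = i0 by rewrite /sg1 /= tpermL.
  have lsg1 : lists (@row_vertex n m) Al j sg1 by exact: lists_tperm.
  have hsg1 : lists (@row_vertex n m) (Al :\ row_vertex n i0) j (sg1 \o lshift 1).
    by rewrite -sg1e; apply: lists_peel.
  have hta1 : lists (@col_vertex n m) (Al :\ row_vertex n i0) j ta.
    by apply: lists_other => // k; rewrite /row_vertex /col_vertex eq_lrshift.
  have [r [c [rp rq hc]]] := IH _ _ _ _ _ _ hsg1 hta1.
  pose w' : 'rV[nat]_p' := \row_i if (i < j)%N then z else w (sg1 (lshift 1 i)).
  exists r; exists (TCons (perm_addr z o (tperm e a)) (perm_addr z o (1%g : 'S_q))
    (TCons (col_mx (\matrix_(i, k) if i == k then o else z) w')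
           (\matrix_(i, k) if i == k then o else z) c)).
  split=> //; first by apply: leq_trans rp _; rewrite leq_addr.
  move=> f X X' [fz fo] /= [_ hw hX hval].
  have id_map k : map_mx f (\matrix_(i, k) if i == k then o else z) = 1%:M :> 'M_k.
    by apply/matrixP => x y; rewrite !mxE; case: eqP.
  rewrite !map_perm_addr // map_col_mx !id_map.
  have [_ _ hsgAl hsgS] := hsg1.
  apply: (factors_perm (X' := current X j sg1 ta)) => //.
  + exact: fixes_tperm.
  + exact: fixes1.
  + by apply: current_perm; [exact: fixes_tperm | exact: fixes1
      | move=> i; rewrite /sg1 /= tpermK | move=> i; rewrite perm1].
  apply: (factors_row star_involutive jp' rp _ _ (hc f _ X' (conj fz fo) hval)).
  + by move=> i ij; rewrite !mxE ij.
  + rewrite -sg1e; apply: (@current_row _ _ _ _ _ _ _ _ (f \o w)) => //.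
    * by have [] := lsg1.
    * move=> k /hw kAl; have [i ik] := hsgS _ kAl; exists i => //.
      by rewrite hsgAl ik.
    * by move=> b; rewrite sg1e.
    * by move=> i; rewrite !mxE; case: ifP.
- move=> [/[dup] /taS [a ai] iAl _ _ _].
  have ja : (j <= a)%N by rewrite taAl ai.
  have qE : q = (q.-1 + 1)%N by rewrite addn1 prednK // (leq_ltn_trans _ (ltn_ord a)).
  move: (q.-1) qE => q' qE; subst q.
  have jq' : (j <= q')%N by have := leq_ltn_trans ja (ltn_ord a); rewrite addn1 ltnS.
  pose e := rshift q' (ord0 : 'I_1); have je : (j <= e)%N by rewrite /= addn0.
  pose ta1 := ta \o tperm e a.
  have ta1e : ta1 e = j0 by rewrite /ta1 /= tpermL.
  have lta1 : lists (@col_vertex n m) Al j ta1 by exact: lists_tperm.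
  have hta1 : lists (@col_vertex n m) (Al :\ col_vertex m j0) j (ta1 \o lshift 1).
    by rewrite -ta1e; apply: lists_peel.
  have hsg1 : lists (@row_vertex n m) (Al :\ col_vertex m j0) j sg.
    by apply: lists_other => // k; rewrite /row_vertex /col_vertex eq_rlshift.
  have [r [c [rp rq hc]]] := IH _ _ _ _ _ _ hsg1 hta1.
  pose w' : 'rV[nat]_q' := \row_i if (i < j)%N then z else w (ta1 (lshift 1 i)).
  exists r; exists (TCons (perm_addr z o (1%g : 'S_p)) (perm_addr z o (tperm e a))
    (TCons (\matrix_(i, k) if i == k then o else z)
       (col_mx (\matrix_(i, k) if i == k then o else z) w') c)).
  split=> //; first by apply: leq_trans rq _; rewrite leq_addr.
  move=> f X X' [fz fo] /= [_ hw hX hval].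
  have id_map k : map_mx f (\matrix_(i, k) if i == k then o else z) = 1%:M :> 'M_k.
    by apply/matrixP => x y; rewrite !mxE; case: eqP.
  rewrite !map_perm_addr // map_col_mx !id_map.
  have [_ _ htaAl htaS] := hta1.
  apply: (factors_perm (X' := current X j sg ta1)) => //.
  + exact: fixes1.
  + exact: fixes_tperm.
  + by apply: current_perm; [exact: fixes1 | exact: fixes_tperm
      | move=> i; rewrite perm1 | move=> i; rewrite /ta1 /= tpermK].
  apply: (factors_col star_involutive jq' rq _ _ (hc f _ X' (conj fz fo) hval)).
  + by move=> i ij; rewrite !mxE ij.
  + rewrite -ta1e; apply: (@current_col _ _ _ _ _ _ _ _ (f \o w)) => //.
    * by have [] := lta1.
    * move=> k /hw kAl; have [i ik] := htaS _ kAl; exists i => //.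
      by rewrite htaAl ik.
    * by move=> b; rewrite ta1e.
    * by move=> i; rewrite !mxE; case: ifP.
Qed.

End ConvertOps.

(** * Complete factorizations from lists of operations *)

Section Conversions.
Variables (F : fieldType) (star : {rmorphism F -> F}).
Hypothesis star_involutive : involutive star.
Variables (m n : nat).

Lemma rank_perm (B : 'M[F]_(m, n)) (s : 'S_m) (t : 'S_n) :
  \rank ((perm_mx s)^T *m B *m perm_mx t) = \rank B.
Proof.
rewrite mxrankMfree ?row_free_unit ?unitmx_perm // tr_perm_mx.
by rewrite eqmxMfull // row_full_unit unitmx_perm.
Qed.

Lemma convert_peeled z o (ops : seq (op nat m n)) :
  exists d : peeled_data nat m n, forall f (B X' : 'M[F]_(m, n)),
    represents z o f -> valid star setT B (map (map_op f) ops) set0 X' ->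
    is_peeled_LU star B (map_peeled f d).
Proof.
have hr : lists (@row_vertex n m) setT 0 (@id 'I_m).
  by split=> // [i|a _]; [rewrite inE | exists a].
have hc : lists (@col_vertex n m) setT 0 (@id 'I_n).
  by split=> // [i|a _]; [rewrite inE | exists a].
have [r [c [rm rn h]]] := convert_ops star_involutive z o ops hr hc.
exists (PeeledData c) => f B X' hf hv.
have [h1 h2 h3 h4] := h f B X' hf hv; split=> /=.
  suff -> : B = current B 0 id id by [].
  by apply/matrixP => i k; rewrite mxE.
have {h2}BE : B = prodY (map_transfs f c) *m ctrmx star (prodZ (map_transfs f c)).
  by rewrite -h2; apply/matrixP => i k; rewrite mxE.
case: h3 => s _ [L LE hL]; case: h4 => t _ [V VE hV].
have nz1 (x : F) : x = 1 -> x != 0 by move=> ->; apply: oner_neq0.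
have rkL : \rank L = r := lower_trap_rank nz1 rm hL.
have rkV : \rank V = r by apply: lower_trap_rank rn hV.
exists s; exists t; exists L; exists (ctrmx star V); split=> //.
- have LUE : (perm_mx s)^T *m B *m perm_mx t = L *m ctrmx star V.
    rewrite BE LE VE ctrmx_mul ctrmx_perm tr_perm_mx !mulmxA -perm_mxM mulVg perm_mx1 mul1mx.
    by rewrite -!mulmxA -perm_mxM mulVg perm_mx1 mulmx1.
  split=> //=.
    (* Both factors have full rank [r], so the inner dimension of the chain is the rank of [B]. *)
    rewrite -(rank_perm B s t) LUE.
    rewrite mxrankMfree ?rkL // -row_leq_rank /ctrmx -map_trmx mxrank_tr mxrank_map rkV.
    by [].
  move=> i k; rewrite !mxE; case: (hV k i) => v1 v2; split=> [/v1 ->|ik].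
    by rewrite rmorph0.
  by rewrite fmorph_eq0; apply: v2.
- by rewrite ctrmxK.
Qed.

Lemma perm_extend k (s : seq 'I_k) : uniq s ->
  exists p : 'S_k, forall x0 (t : 'I_k), (t < size s)%N -> p t = nth x0 s t.
Proof.
move=> us; case: k s us => [|k] s us.
  by exists 1%g => x0 [].
pose s' := s ++ [seq i <- enum 'I_k.+1 | i \notin s].
have us' : uniq s'.
  rewrite cat_uniq us filter_uniq ?enum_uniq // andbT /=.
  by apply/hasPn => x; rewrite mem_filter => /andP[].
have sz : size s' = k.+1.
  rewrite -[RHS](card_ord k.+1) -(card_uniqP us'); apply: eq_card => x.
  by rewrite mem_cat mem_filter mem_enum andbT inE orbN.
have inj : injective (fun t : 'I_k.+1 => nth ord0 s' t).
  move=> a b /eqP; rewrite nth_uniq ?sz // => /eqP; exact: val_inj.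
exists (perm inj) => x0 t lt; rewrite permE /s' nth_cat lt.
by apply: set_nth_default.
Qed.

Definition is_elim (V : Type) (x : op V m n) : bool :=
  if x is OElim _ _ _ _ _ then true else false.

Definition elim_data (V : Type) (x : op V m n) :
    option ('I_m * 'I_n * ('I_m -> V) * ('I_n -> V)) :=
  if x is OElim i j l u _ then Some (i, j, l, u) else None.

Lemma valid_zero_row Al Al' (X X' : 'M[F]_(m, n)) ops a :
  all (@is_elim F) ops -> valid star Al X ops Al' X' -> (forall b, X a b = 0) ->
  forall e, List.In e (pmap (@elim_data F) ops) -> e.1.2 a = 0.
Proof.
elim: ops Al X => [|[i j l u us|//|//] ops IH] Al X //= h [[_ _ _ uj] _ _ hc hv] X0 e.
have la : l a = 0.
  have := hc a; rewrite mxE X0 sub0r => /eqP; rewrite oppr_eq0 mulf_eq0.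
  by rewrite (negPf uj) orbF => /eqP.
case=> [<- //|]; apply: (IH _ _ h hv) => b.
by rewrite mxE X0 la mul0r subrr.
Qed.

Lemma valid_zero_col Al Al' (X X' : 'M[F]_(m, n)) ops b :
  all (@is_elim F) ops -> valid star Al X ops Al' X' -> (forall a, X a b = 0) ->
  forall e, List.In e (pmap (@elim_data F) ops) -> e.2 b = 0.
Proof.
elim: ops Al X => [|[i j l u us|//|//] ops IH] Al X //= h [[_ _ li _] _ hr _ hv] X0 e.
have ub : u b = 0.
  by have := hr b; rewrite mxE X0 sub0r li mul1r => /eqP; rewrite oppr_eq0 => /eqP.
case=> [<- //|]; apply: (IH _ _ h hv) => a.
by rewrite mxE X0 ub mulr0 subrr.
Qed.

Lemma valid_sum Al Al' (X X' : 'M[F]_(m, n)) ops :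
  all (@is_elim F) ops -> valid star Al X ops Al' X' ->
  forall a b, X a b = \sum_(e <- pmap (@elim_data F) ops) e.1.2 a * e.2 b + X' a b.
Proof.
elim: ops Al X => [|[i j l u us|//|//] ops IH] Al X //=.
  by move=> _ [_ ->] a b; rewrite big_nil add0r.
move=> h [_ _ _ _ hv] a b.
by rewrite big_cons /= -addrA -(IH _ _ h hv) mxE addrC subrK.
Qed.

(** A step clears its pivot row and column, and zero rows and columns get zero multipliers in all
    later steps: in pivot order the factors are triangular. *)
Lemma valid_triangular Al Al' (X X' : 'M[F]_(m, n)) ops e0 :
  all (@is_elim F) ops -> valid star Al X ops Al' X' ->
  let es := pmap (@elim_data F) ops in
  (forall s t, (s < t < size es)%N ->
     (nth e0 es t).1.2 (nth e0 es s).1.1.1 = 0 /\ (nth e0 es t).2 (nth e0 es s).1.1.2 = 0) /\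
  (forall t, (t < size es)%N ->
        (nth e0 es t).1.2 (nth e0 es t).1.1.1 = 1 /\ (nth e0 es t).2 (nth e0 es t).1.1.2 != 0).
Proof.
elim: ops Al X => [|[i j l u us|//|//] ops IH] Al X //=.
  by move=> _ _; split=> // s t; rewrite ltn0 andbF.
move=> h [[_ _ li uj] _ hr hc hv].
have [h2 h3] := IH _ _ h hv; split.
- move=> [|s] [|t] //= lt; last exact: h2.
  have tin : List.In (nth e0 (pmap (@elim_data F) ops) t) (pmap (@elim_data F) ops).
    elim: (pmap _ ops) t lt {h2 h3} => //= e es IH' [|t] /= lt; first by left.
    by right; apply: IH'.
  by rewrite (valid_zero_row h hv hr tin) (valid_zero_col h hv hc tin).
- by move=> [|t] //= lt; apply: h3.
Qed.

Lemma valid_uniq_pivots Al Al' (X X' : 'M[F]_(m, n)) ops :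
  all (@is_elim F) ops -> valid star Al X ops Al' X' ->
  let es := pmap (@elim_data F) ops in
  [/\ uniq (map (fun e => e.1.1.1) es),
      forall i, i \in map (fun e => e.1.1.1) es -> row_vertex n i \in Al,
      uniq (map (fun e => e.1.1.2) es)
    & forall i, i \in map (fun e => e.1.1.2) es -> col_vertex m i \in Al].
Proof.
elim: ops Al X => [|[i j l u us|//|//] ops IH] Al X //= h [[iAl jAl _ _] _ _ _ hv].
have [u1 h1 u2 h2] := IH _ _ h hv; rewrite u1 u2; split.
- by rewrite andbT; apply/negP => /h1; rewrite !inE eqxx andbF.
- by move=> k; rewrite inE => /orP[/eqP -> //|/h1]; rewrite !inE => /andP[_ /andP[]].
- by rewrite andbT; apply/negP => /h2; rewrite !inE eqxx.
- by move=> k; rewrite inE => /orP[/eqP -> //|/h2]; rewrite !inE => /andP[_ /andP[]].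
Qed.

Lemma size_uniq_ord k (s : seq 'I_k) : uniq s -> (size s <= k)%N.
Proof. by move=> /card_uniqP <-; rewrite -[X in (_ <= X)%N]card_ord max_card. Qed.

Lemma convert_lu (ops : seq (op nat m n)) :
  exists d : lu_data nat m n, forall f (B : 'M[F]_(m, n)) Al',
    all (@is_elim nat) ops -> valid star setT B (map (map_op f) ops) Al' 0 ->
    is_LU B (map_lu f d).
Proof.
pose es := pmap (@elim_data nat) ops.
pose rows := map (fun e => e.1.1.1) es; pose cols := map (fun e => e.1.1.2) es.
pose g (f : nat -> F) (e : 'I_m * 'I_n * ('I_m -> nat) * ('I_n -> nat)) :=
  (e.1.1, f \o e.1.2, f \o e.2).
have esE f : pmap (@elim_data F) (map (map_op f) ops) = map (g f) es.
  by rewrite /es; elim: (ops) => //= -[i j l u us|i w|j w] s /= ->.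
have hall f : all (@is_elim nat) ops -> all (@is_elim F) (map (map_op f) ops).
  by rewrite all_map (eq_all (a2 := @is_elim nat)) // => -[].
(* Repeated pivots contradict validity, so any data serves in that case. *)
case: (boolP (uniq rows && uniq cols)) => [/andP[urows ucols]|nu]; last first.
  exists (LUData 1%g 1%g (const_mx 0%N) (const_mx 0%N : 'M_(0, n))) => f B Al' h hv.
  have [] := valid_uniq_pivots (hall f h) hv; rewrite esE -!map_comp => h1 _ h2 _.
  by case/negP: nu; rewrite h1 h2.
have [p hp] := perm_extend urows; have [q hq] := perm_extend ucols.
have szr := size_uniq_ord urows; have szc := size_uniq_ord ucols.
rewrite size_map in szr; rewrite size_map in szc.
pose e_ (t : 'I_(size es)) := tnth (in_tuple es) t.
(* [p] and [q] send a position to the pivot used there; the transpose and the side in [is_LU] turn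
   them into inverses. *)
exists (LUData p^-1 q^-1 (\matrix_(i, t) (e_ t).1.2 (p i)) (\matrix_(t, k) (e_ t).2 (q k))).
move=> f B Al' h hv.
have elims e0 := valid_triangular e0 (hall f h) hv; rewrite esE in elims.
have e_E x0 t : e_ t = nth x0 es t by rewrite /e_ (tnth_nth x0).
have nthE e0 (t : 'I_(size es)) : nth (g f e0) (map (g f) es) t = g f (e_ t).
  by rewrite (nth_map e0) // (e_E e0).
have pE (t : 'I_(size es)) : p (widen_ord szr t) = (e_ t).1.1.1.
  by rewrite (hp (p (widen_ord szr t))) /rows ?size_map /= ?ltn_ord // (nth_map (e_ t)) // -e_E.
have qE (t : 'I_(size es)) : q (widen_ord szc t) = (e_ t).1.1.2.
  by rewrite (hq (q (widen_ord szc t))) /cols ?size_map /= ?ltn_ord // (nth_map (e_ t)) // -e_E.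
have hL : lower_trapezoidal_unit (map_mx f (\matrix_(i, t) (e_ t).1.2 (p i))).
  move=> i t; rewrite !mxE; have [h2 h3] := elims (g f (e_ t)).
  rewrite size_map in h2 h3; split=> [it|it].
    have is_ : (i < size es)%N := ltn_trans it (ltn_ord t).
    have := h2 i t; rewrite it ltn_ord => /(_ isT) [+ _].
    rewrite nthE (nthE _ (Ordinal is_)) /= -pE => <-.
    by congr (f (_ (p _))); apply: val_inj.
  have := h3 t (ltn_ord t) => -[+ _]; rewrite nthE /= -pE => <-.
  by congr (f (_ (p _))); apply: val_inj.
have hU : upper_trapezoidal_nz (map_mx f (\matrix_(t, k) (e_ t).2 (q k))).
  move=> t k; rewrite !mxE; have [h2 h3] := elims (g f (e_ t)).
  rewrite size_map in h2 h3; split=> [it|it].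
    have is_ : (k < size es)%N := ltn_trans it (ltn_ord t).
    have := h2 k t; rewrite it ltn_ord => /(_ isT) [_ +].
    rewrite nthE (nthE _ (Ordinal is_)) /= -qE => <-.
    by congr (f (_ (q _))); apply: val_inj.
  have := h3 t (ltn_ord t) => -[_ +]; rewrite nthE /= -qE.
  by congr (f (_ (q _)) != 0); apply: val_inj.
have BE : (perm_mx p^-1)^T *m B *m perm_mx q^-1 =
    map_mx f (\matrix_(i, t) (e_ t).1.2 (p i)) *m map_mx f (\matrix_(t, k) (e_ t).2 (q k)).
  rewrite tr_perm_mx invgK; apply/matrixP => i k.
  rewrite -mulmxA -col_permE -row_permE !mxE.
  have -> a b : B a b = \sum_(t < size es) f ((e_ t).1.2 a) * f ((e_ t).2 b).
    by rewrite (valid_sum (hall f h) hv) esE mxE addr0 big_map big_tnth.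
  by apply: eq_bigr => t _; rewrite !mxE.
split=> //=.
have nz1 (x : F) : x = 1 -> x != 0 by move=> ->; apply: oner_neq0.
have rkL := lower_trap_rank nz1 szr hL.
have rkU : \rank (map_mx f (\matrix_(t, k) (e_ t).2 (q k)))^T = size es.
  apply: (@lower_trap_rank _ (fun x => x != 0)) => // i k; rewrite mxE.
  by have [h1 h2] := hU k i; split=> // ki; apply: h2.
by rewrite -(rank_perm B p^-1 q^-1) BE mxrankMfree ?rkL // -row_leq_rank -mxrank_tr rkU.
Qed.

End Conversions.

(** * Independence of rows and columns *)

Section ValidTheory.
Variables (F : fieldType) (star : {rmorphism F -> F}) (m n : nat).
Implicit Types (Al Fr : {set 'I_(n + m)}) (X : 'M[F]_(m, n)) (ops : seq (op F m n)).

Lemma valid_cat Al X ops1 Al1 X1 ops2 Al2 X2 :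
  valid star Al X ops1 Al1 X1 -> valid star Al1 X1 ops2 Al2 X2 ->
  valid star Al X (ops1 ++ ops2) Al2 X2.
Proof.
elim: ops1 Al X => [|[i j l u us|i w|j w] ops1 IH] Al X /=.
- by move=> [-> ->].
- by move=> [? ? ? ? h] h2; split=> //; apply: IH.
- by move=> [? ? ? h] h2; split=> //; apply: IH.
- by move=> [? ? ? h] h2; split=> //; apply: IH.
Qed.

Lemma valid_frame Al X ops Al' X' Fr :
  [disjoint Fr & Al] -> valid star Al X ops Al' X' ->
  valid star (Al :|: Fr) X ops (Al' :|: Fr) X'.
Proof.
have frame (A : {set 'I_(n + m)}) x : [disjoint Fr & A] -> x \in A ->
    (A :|: Fr) :\ x = (A :\ x) :|: Fr /\ [disjoint Fr & A :\ x].
  move=> dis xA; split; last by apply: disjointWr dis; apply: subsetDl.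
  rewrite setDUl; congr (_ :|: _); apply/setDidPl.
  by rewrite disjoint_sym disjoints1 (disjointFl dis xA).
elim: ops Al X => [|[i j l u us|i w|j w] ops IH] Al X dis /=.
- by move=> [-> ->].
- move=> [[iA jA li uj] hus hr hc hv]; rewrite !inE iA jA.
  have [E1 d1] := frame _ _ dis iA.
  have jA' : col_vertex m j \in Al :\ row_vertex n i.
    by rewrite !inE jA andbT /row_vertex /col_vertex eq_lrshift.
  have [E2 d2] := frame _ _ d1 jA'.
  by split=> //; rewrite E1 E2; apply: IH.
- move=> [iA hw hX hv]; have [E1 d1] := frame _ _ dis iA; rewrite inE iA E1.
  by split=> // [k /hw|]; [move=> kA; rewrite inE kA | apply: IH].
- move=> [jA hw hX hv]; have [E1 d1] := frame _ _ dis jA; rewrite inE jA E1.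
  by split=> // [k /hw|]; [move=> kA; rewrite inE kA | apply: IH].
Qed.

Definition rows_free Al X : Prop := forall y : 'I_m -> F,
  (forall k, y k != 0 -> row_vertex n k \in Al) ->
  (forall b, \sum_k y k * X k b = 0) -> forall k, y k = 0.

Definition cols_free Al X : Prop := forall y : 'I_n -> F,
  (forall k, y k != 0 -> col_vertex m k \in Al) ->
  (forall a, \sum_k X a k * y k = 0) -> forall k, y k = 0.

Lemma sum_delta k (y : 'I_k -> F) (i : 'I_k) (G : 'I_k -> F) c :
  \sum_a (y a + (if a == i then c else 0)) * G a = \sum_a y a * G a + c * G i.
Proof.
under eq_bigr do rewrite mulrDl.
rewrite big_split /=; congr (_ + _); rewrite (bigD1 i) //= eqxx big1 ?addr0 //.
by move=> a /negPf ->; rewrite mul0r.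
Qed.

(** A relation among the remaining rows of [X1] becomes a relation among the rows of [X] once [c]
    times the pivot row, which equals [u], is subtracted. *)
Lemma rows_free_elim Al X i j (l : 'I_m -> F) (u : 'I_n -> F) :
  let X1 := \matrix_(a, b) (X a b - l a * u b) in
  row_vertex n i \in Al -> l i = 1 -> (forall b, X1 i b = 0) ->
  rows_free Al X -> rows_free (Al :\ row_vertex n i :\ col_vertex m j) X1.
Proof.
move=> X1 iA li X1i free y hy hX1.
pose c := \sum_k y k * l k; pose y' a := y a + (if a == i then - c else 0).
have y'0 : forall k, y' k = 0.
  apply: free => [k|b].
    rewrite /y'; case: (eqVneq k i) => [-> //|_]; rewrite addr0 => /hy.
    by rewrite !inE => /andP[_ /andP[]].
  have XE k : X k b = X1 k b + l k * u b by rewrite mxE subrK.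
  rewrite sum_delta; under eq_bigr do rewrite XE mulrDr mulrA.
  by rewrite big_split /= hX1 add0r -mulr_suml -/c XE X1i add0r li mul1r mulNr subrr.
have yi : y i = 0.
  apply/eqP/negPn/negP => /hy; rewrite !inE eqxx andbF //.
have c0 : c = 0.
  by have := y'0 i; rewrite /y' eqxx yi add0r => /eqP; rewrite oppr_eq0 => /eqP.
by move=> k; have := y'0 k; rewrite /y' c0 oppr0 if_same addr0.
Qed.

Lemma cols_free_elim Al X i j (l : 'I_m -> F) (u : 'I_n -> F) :
  let X1 := \matrix_(a, b) (X a b - l a * u b) in
  col_vertex m j \in Al -> u j != 0 -> (forall a, X1 a j = 0) ->
  cols_free Al X -> cols_free (Al :\ row_vertex n i :\ col_vertex m j) X1.
Proof.
move=> X1 jA uj X1j free y hy hX1.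
pose c := (\sum_k y k * u k) / u j; pose y' a := y a + (if a == j then - c else 0).
have y'0 : forall k, y' k = 0.
  apply: free => [k|a].
    rewrite /y'; case: (eqVneq k j) => [-> //|_]; rewrite addr0 => /hy.
    by rewrite !inE => /andP[_ /andP[]].
  have XE k : X a k = X1 a k + l a * u k by rewrite mxE subrK.
  under eq_bigr do rewrite mulrC.
  rewrite sum_delta; under eq_bigr do rewrite XE mulrDr mulrCA.
  rewrite big_split /= -mulr_sumr; under eq_bigr do rewrite mulrC.
  by rewrite hX1 add0r XE X1j add0r mulNr mulrCA /c divfK // subrr.
have yj : y j = 0 by apply/eqP/negPn/negP => /hy; rewrite !inE eqxx.
have c0 : c = 0.
  by have := y'0 j; rewrite /y' eqxx yj add0r => /eqP; rewrite oppr_eq0 => /eqP.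
by move=> k; have := y'0 k; rewrite /y' c0 oppr0 if_same addr0.
Qed.

(** A peeling exhibits its row or column as a combination of other alive ones, which is a relation
    with coefficient -1 at the peeled index. *)
Lemma valid_free_all_elim Al X ops Al' X' :
  valid star Al X ops Al' X' -> rows_free Al X -> cols_free Al X ->
  all (@is_elim m n F) ops.
Proof.
elim: ops Al X => [|[i j l u us|i w|j w] ops IH] Al X //=.
- move=> [[iA jA li uj] _ hr hc hv] fr fc; apply: IH hv _ _.
    exact: rows_free_elim fr.
  exact: cols_free_elim fc.
- move=> [iA hw hX _] fr _; exfalso.
  have wi : w i = 0 by apply/eqP/negPn/negP => /hw; rewrite !inE eqxx.
  have /(_ i) : forall k, w k + (if k == i then -1 else 0) = 0.
    apply: fr => [k|b].
      by case: (eqVneq k i) => [-> //|_]; rewrite addr0 => /hw; rewrite inE => /andP[].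
    by rewrite sum_delta -hX mulN1r subrr.
  by rewrite eqxx wi add0r => /eqP; rewrite oppr_eq0 oner_eq0.
- move=> [jA hw hX _] _ fc; exfalso.
  have wj : w j = 0 by apply/eqP/negPn/negP => /hw; rewrite !inE eqxx.
  have /(_ j) : forall k, star (w k) + (if k == j then -1 else 0) = 0.
    apply: fc => [k|a].
      case: (eqVneq k j) => [-> //|_]; rewrite addr0 fmorph_eq0 => /hw.
      by rewrite inE => /andP[].
    under eq_bigr do rewrite mulrC.
    rewrite sum_delta; under eq_bigr do rewrite mulrC.
    by rewrite -hX mulN1r subrr.
  by rewrite eqxx wj rmorph0 add0r => /eqP; rewrite oppr_eq0 oner_eq0.
Qed.

Fixpoint pivots (V : Type) (s : seq (op V m n)) : {set 'I_(n + m)} :=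
  match s with
  | OElim i j _ _ _ :: s' => row_vertex n i |: (col_vertex m j |: pivots s')
  | _ :: s' => pivots s'
  | [::] => set0
  end.

Lemma pivots_map (V : Type) (f : V -> F) (s : seq (op V m n)) :
  pivots (map (map_op f) s) = pivots s.
Proof. by elim: s => //= -[i j l u us|i w|j w] s /= ->. Qed.

Lemma pivots_sub Al X ops Al' X' : valid star Al X ops Al' X' -> pivots ops \subset Al.
Proof.
elim: ops Al X => [|[i j l u us|i w|j w] ops IH] Al X /=; first by rewrite sub0set.
- move=> [[iA jA _ _] _ _ _ /IH h]; rewrite !subUset !sub1set iA jA /=.
  by apply: subset_trans h _; rewrite setDDl subsetDl.
- by move=> [_ _ _ /IH h]; apply: subset_trans h (subsetDl _ _).
- by move=> [_ _ _ /IH h]; apply: subset_trans h (subsetDl _ _).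
Qed.

(** Column [j] of a relation [y] among the rows says that the sum of [y k * l k] is 0. Hence [y] is
    also a relation for [X1], where row [i] is zero and may be dropped; induction kills the other
    coefficients, and [l i = 1] kills the last one. Columns are symmetric. *)
Lemma valid_pivots_free Al X ops Al' X' : valid star Al X ops Al' X' ->
  rows_free (pivots ops) X /\ cols_free (pivots ops) X.
Proof.
elim: ops Al X => [|[i j l u us|i w|j w] ops IH] Al X /=.
- by move=> _; split=> y hy _ k; apply/eqP/negPn/negP => /hy; rewrite inE.
- set X1 := \matrix_(a, b) _ => -[[iA jA li uj] _ hr hc hv].
  have [fr fc] := IH _ _ hv; have sub := subsetP (pivots_sub hv).
  have XE a b : X a b = l a * u b + X1 a b by rewrite mxE addrC subrK.
  split=> y hy hX.
  + have yl : \sum_k y k * l k = 0.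
      have := hX j; under eq_bigr do rewrite XE hc addr0 mulrA.
      by rewrite -mulr_suml => /eqP; rewrite mulf_eq0 (negPf uj) orbF => /eqP.
    have hX1 b : \sum_k y k * X1 k b = 0.
      rewrite -[RHS](hX b); under [RHS]eq_bigr do rewrite XE mulrDr mulrA.
      by rewrite big_split /= -mulr_suml yl mul0r add0r.
    have y'0 : forall k, y k + (if k == i then - y i else 0) = 0.
      apply: fr => [k|b]; last by rewrite sum_delta hX1 hr mulr0 addr0.
      case: (eqVneq k i) => [->|ki]; first by rewrite subrr eqxx.
      rewrite addr0 => /hy; rewrite !inE (inj_eq (@rshift_inj n m)) (negPf ki) /=.
      by rewrite /row_vertex /col_vertex eq_rlshift.
    have yk k : k != i -> y k = 0 by move=> ki; have := y'0 k; rewrite (negPf ki) addr0.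
    move=> k; case: (eqVneq k i) => [->|]; last exact: yk.
    by have := yl; rewrite (bigD1 i) //= big1 => [|a /yk ->]; rewrite ?mul0r // addr0 li mulr1.
  + have yu : \sum_k u k * y k = 0.
      have := hX i; under eq_bigr do rewrite XE hr addr0 li mul1r.
      by [].
    have hX1 a : \sum_k X1 a k * y k = 0.
      rewrite -[RHS](hX a); under [RHS]eq_bigr do rewrite XE mulrDl -mulrA.
      by rewrite big_split /= -mulr_sumr yu mulr0 add0r.
    have y'0 : forall k, y k + (if k == j then - y j else 0) = 0.
      apply: fc => [k|a].
        case: (eqVneq k j) => [->|kj]; first by rewrite subrr eqxx.
        rewrite addr0 => /hy; rewrite !inE (inj_eq (@lshift_inj n m)) (negPf kj) /=.
        by rewrite /row_vertex /col_vertex eq_lrshift.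
      under eq_bigr do rewrite mulrC.
      rewrite sum_delta hc mulr0 addr0; under eq_bigr do rewrite mulrC.
      exact: hX1.
    have yk k : k != j -> y k = 0 by move=> kj; have := y'0 k; rewrite (negPf kj) addr0.
    move=> k; case: (eqVneq k j) => [->|]; last exact: yk.
    have := yu; rewrite (bigD1 j) //= big1 => [|a /yk ->]; rewrite ?mulr0 // addr0.
    by move/eqP; rewrite mulf_eq0 (negPf uj) => /eqP.
(* The peeled row is not among the later pivots, and a relation between columns survives the zeroing
   of a row. *)
- set X1 := \matrix_(a, b) _ => -[iA hw hX hv].
  have [fr fc] := IH _ _ hv; have sub := subsetP (pivots_sub hv).
  split=> y hy hXy.
  + apply: fr => // b; rewrite -[RHS](hXy b); apply: eq_bigr => k _; rewrite mxE.
    case: eqP => // ki; apply/eqP; rewrite mulr0 eq_sym mulf_eq0; apply/orP; left.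
    by apply/negPn/negP => /hy /sub; rewrite ki !inE eqxx.
  + apply: fc => // a; rewrite -[RHS](hXy a); case: (eqVneq a i) => [ai|ai].
      by rewrite hXy big1 // => k _; rewrite mxE ai eqxx mul0r.
    by apply: eq_bigr => k _; rewrite mxE (negPf ai).
- set X1 := \matrix_(a, b) _ => -[jA hw hX hv].
  have [fr fc] := IH _ _ hv; have sub := subsetP (pivots_sub hv).
  split=> y hy hXy.
  + apply: fr => // b; rewrite -[RHS](hXy b); case: (eqVneq b j) => [bj|bj].
      by rewrite hXy big1 // => k _; rewrite mxE bj eqxx mulr0.
    by apply: eq_bigr => k _; rewrite mxE (negPf bj).
  + apply: fc => // a; rewrite -[RHS](hXy a); apply: eq_bigr => k _; rewrite mxE.
    case: eqP => // kj; apply/eqP; rewrite mul0r eq_sym mulf_eq0; apply/orP; right.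
    by apply/negPn/negP => /hy /sub; rewrite kj !inE eqxx.
Qed.

(** An elimination subtracts a matrix of rank one and accounts for one row and one column. A peeling
    is undone by a matrix product, which cannot raise the rank. *)
Lemma valid_rank Al X ops Al' : valid star Al X ops Al' 0 ->
  (2 * \rank X <= #|pivots ops|)%N.
Proof.
elim: ops Al X => [|[i j l u us|i w|j w] ops IH] Al X /=.
- by move=> [_ <-]; rewrite mxrank0.
- set X1 := \matrix_(a, b) _ => -[[iA jA li uj] _ hr hc hv].
  have sub := subsetP (pivots_sub hv).
  have -> : #|row_vertex n i |: (col_vertex m j |: pivots ops)| = (2 + #|pivots ops|)%N.
    rewrite cardsU1 cardsU1 !inE /row_vertex /col_vertex eq_rlshift /=.
    have -> : rshift n i \notin pivots ops by apply/negP => /sub; rewrite !inE eqxx andbF.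
    by have -> : lshift m j \notin pivots ops by apply/negP => /sub; rewrite !inE eqxx.
  have XE : X = (\col_a l a) *m (\row_b u b) + X1.
    by apply/matrixP => a b; rewrite mxE mxE big_ord1 !mxE addrC subrK.
  have rk : (\rank X <= 1 + \rank X1)%N.
    rewrite XE; apply: leq_trans (mxrank_add _ _) _; rewrite leq_add2r.
    exact: leq_trans (mxrankM_maxl _ _) (rank_leq_col _).
  by have := IH _ _ hv; lia.
- set X1 := \matrix_(a, b) _ => -[iA hw hX hv].
  apply: leq_trans (IH _ _ hv); rewrite leq_mul2l /=.
  have -> : X = (\matrix_(a, b) if a == i then w b else (a == b)%:R) *m X1.
    have wi : w i = 0 by apply/eqP/negPn/negP => /hw; rewrite !inE eqxx.
    apply/matrixP => a b; rewrite mxE; case: (eqVneq a i) => [->|ai].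
      rewrite hX; apply: eq_bigr => k _; rewrite !mxE eqxx.
      by case: eqP => [->|//]; rewrite wi !mul0r.
    rewrite (bigD1 a) //= big1 => [|k ka].
      by rewrite !mxE (negPf ai) eqxx mul1r addr0.
    by rewrite !mxE (negPf ai) eq_sym (negPf ka) mul0r.
  exact: mxrankM_maxr.
- set X1 := \matrix_(a, b) _ => -[jA hw hX hv].
  apply: leq_trans (IH _ _ hv); rewrite leq_mul2l /=.
  have -> : X = X1 *m (\matrix_(a, b) if b == j then star (w a) else (a == b)%:R).
    have wj : w j = 0 by apply/eqP/negPn/negP => /hw; rewrite !inE eqxx.
    apply/matrixP => a b; rewrite mxE; case: (eqVneq b j) => [->|bj].
      rewrite hX; apply: eq_bigr => k _; rewrite !mxE eqxx.
      by case: eqP => [->|//]; rewrite wj rmorph0 !mulr0.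
    rewrite (bigD1 b) //= big1 => [|k kb].
      by rewrite !mxE (negPf bj) eqxx mulr1 addr0.
    by rewrite !mxE (negPf bj) (negPf kb) mulr0.
  exact: mxrankM_maxl.
Qed.

End ValidTheory.

(** * Elimination plans from tree decompositions *)

Section Plan.
Variables (V : finType) (e : rel V).

Definition separates (S A : {set V}) : Prop :=
  [disjoint A & S] /\ forall u v, u \in A -> e u v -> v \in A :|: S.

(* [plan k S A]: a schedule for eliminating the vertices of [A], whose other
   neighbours all belong to the current bag [S]. *)
Inductive plan (k : nat) : {set V} -> {set V} -> Prop :=
  | PlanEmpty (S : {set V}) : (#|S| <= k)%N -> plan k S set0
  | PlanJoin (S A B : {set V}) : plan k S A -> plan k S B -> [disjoint A & B] ->
      plan k S (A :|: B)
  | PlanMove (S S' A : {set V}) : plan k S A -> (#|S'| <= k)%N ->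
      separates S' (A :|: (S :\: S')) -> plan k S' (A :|: (S :\: S')).

Implicit Types (S A : {set V}).

Lemma plan_bag k S A : plan k S A -> (#|S| <= k)%N.
Proof. by elim. Qed.

Lemma plan_separates k S A : plan k S A -> separates S A.
Proof.
elim=> {S A} [S _|S A B _ [dA hA] _ [dB hB] _|//].
  by split=> [|u v]; [rewrite disjoints_subset sub0set | rewrite inE].
split=> [|u v].
  by rewrite -setI_eq0 setIUl; move: dA dB; rewrite -!setI_eq0 => /eqP-> /eqP->; rewrite setU0.
by rewrite inE => /orP[uA|uB] euv; [have := hA u v uA euv | have := hB u v uB euv];
   rewrite !inE => /orP[->|->]; rewrite ?orbT.
Qed.

(** Separation is preserved because a neighbour that leaves the schedule for [Z] is found in the
    enlarged bag. *)
Lemma plan_augment k S A (Z : {set V}) k' : plan k S A -> (k + #|Z| <= k')%N ->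
  plan k' (S :|: Z) (A :\: Z).
Proof.
move=> pl le; elim: pl => {S A} [S leS|S A B _ IA _ IB dAB|S S' A _ IA leS' [dis hsep]].
- rewrite set0D; apply: PlanEmpty; apply: leq_trans le.
  by apply: leq_trans (leq_card_setU _ _) _; rewrite leq_add2r.
- rewrite setDUl; apply: PlanJoin => //.
  by apply: disjointW dAB; apply: subsetDl.
- have -> : (A :|: S :\: S') :\: Z = (A :\: Z) :|: ((S :|: Z) :\: (S' :|: Z)).
    by apply/setP => x; rewrite !inE; do !case: (x \in _).
  apply: PlanMove => //.
    apply: leq_trans le.
    by apply: leq_trans (leq_card_setU _ _) _; rewrite leq_add2r.
  have -> : (A :\: Z) :|: ((S :|: Z) :\: (S' :|: Z)) = (A :|: S :\: S') :\: Z.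
    by apply/setP => x; rewrite !inE; do !case: (x \in _).
  split=> [|u v].
    rewrite disjoint_subset; apply/subsetP => x; rewrite inE => /andP[xZ xA].
    by rewrite !inE negb_or xZ andbT (disjointFr dis xA).
  rewrite inE => /andP[uZ uA] /(hsep _ _ uA).
  by rewrite !inE; do 4!case: (v \in _).
Qed.

Section Tree.
Variables (T : finType) (t : rel T) (bag : T -> {set V}) (k : nat).
Hypothesis t_sym : symmetric t.
Hypothesis t_irr : irreflexive t.
Hypothesis t_acyclic : forall c : seq T, ucycle t c -> (size c < 3)%N.
Hypothesis bag_card : forall x, (#|bag x| <= k)%N.

Definition bag_rel (W : {set T}) v : rel T :=
  [rel a b | [&& t a b, a \in W, b \in W, v \in bag a & v \in bag b]].

Definition bags_connected (W : {set T}) : Prop := forall v x y,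
  x \in W -> y \in W -> v \in bag x -> v \in bag y -> connect (bag_rel W v) x y.

(** [None] is a virtual node with an empty bag. It acts as the neighbour of an isolated node and
    carries the whole schedule in the end. *)
Definition node_in (W : {set T}) (o : option T) := if o is Some x then x \in W else true.
Definition node_bag (o : option T) := if o is Some x then bag x else set0.

(** Take an end of a longest path: a neighbour off the path would lengthen it, and one further along
    the path would close a cycle. *)
Lemma exists_leaf (W : {set T}) : W != set0 ->
  exists2 y, y \in W & exists o, [/\ o <> Some y, node_in W o
    & forall x, x \in W -> t y x -> o = Some x].
Proof.
move=> /set0Pn[x1 x1W].
pose P l := `[< exists x p, [/\ path t x p, all (mem W) (x :: p), uniq (x :: p) & size p = l] >].
have exP : exists l, P l.
  by exists 0; apply/asboolP; exists x1, [::]; rewrite /= x1W.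
have ubP l : P l -> (l <= #|T|)%N.
  move=> /asboolP[x [p [_ _ /card_uniqP u <-]]].
  by apply: ltnW; have := max_card (mem (x :: p)); rewrite u.
case: (ex_maxnP exP ubP) => l /asboolP[y [p [yp pW up sp]]] lmax.
have yW : y \in W by case/andP: pW.
exists y => //; exists (ohead p); split.
- by case: p up {yp pW sp} => //= h p /andP[/[!inE] /norP[/eqP yh _] _] [hy]; apply: yh.
- by case: p pW {yp up sp} => //= h p /and3P[].
- move=> z zW tyz; have zp : z \in p.
    apply/negPn/negP => zp; have : P l.+1.
      apply/asboolP; exists z, (y :: p); split=> //=.
      + by rewrite t_sym tyz.
      + by rewrite [z \in W]zW.
      + rewrite inE negb_or zp andbT; move: up; rewrite /= => ->.
        by rewrite andbT; apply: contraTneq tyz => ->; rewrite t_irr.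
      + by rewrite sp.
    by move/lmax; rewrite ltnn.
  move: yp up {pW sp}; case/splitPr: zp => [[|h p1] p2] //= yp up.
  suff : ucycle t [:: y, h & rcons p1 z].
    by move/t_acyclic; rewrite /= size_rcons !ltnS ltn0.
  rewrite /ucycle /=; apply/andP; split.
    move: yp; rewrite rcons_path cat_path /= last_rcons => /and4P[-> h1 h2 _].
    by rewrite rcons_path h1 h2 t_sym tyz.
  have : uniq ((y :: h :: rcons p1 z) ++ p2) by rewrite /= cat_rcons.
  by rewrite cat_uniq => /andP[].
Qed.

Lemma leaf_intersection (W : {set T}) y o v z : bags_connected W ->
  y \in W -> (forall x, x \in W -> t y x -> o = Some x) ->
  z \in W -> z != y -> v \in bag y -> v \in bag z -> v \in node_bag o.
Proof.
move=> hc yW ho zW zy vy vz; case/connectP: (hc _ _ _ yW zW vy vz) => -[|b p] /=.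
  by move=> _ zE; rewrite zE eqxx in zy.
by move=> /andP[/and5P[tyb _ bW _ vb] _] _; rewrite (ho _ bW tyb).
Qed.

(** A simple path with ends other than the leaf avoids it, as it would have to enter and leave the
    leaf through the same neighbour. *)
Lemma bags_connected_leaf (W : {set T}) y o : bags_connected W ->
  (forall x, x \in W -> t y x -> o = Some x) -> bags_connected (W :\ y).
Proof.
move=> hc ho v a b; rewrite !inE => /andP[ay aW] /andP[by_ bW] va vb.
case/connectP: (hc _ _ _ aW bW va vb) => p0 /shortenP[p pp up _ bE]; apply/connectP; exists p => //.
apply: (sub_in_path (P := [pred x | x != y])) (pp).
  move=> x1 x2 /= /[!inE] n1 n2 /and5P[h1 h2 h3 h4 h5].
  by apply/and5P; split; rewrite // !inE ?n1 ?n2.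
rewrite /= ay; apply/allP => x xp /=; apply: contraNneq by_ => xE; subst x.
move: pp up bE; case/splitPr: xp => p1 [|c p2]; first by rewrite last_cat => _ _ ->.
move=> /[swap]; rewrite -cat_cons cat_uniq => /and3P[_ /hasPn /(_ c) hp _].
rewrite cat_path /= => /and4P[_ /and5P[t1 w1 _ _ _] /and5P[t2 _ w2 _ _] _] _.
have E1 := ho _ w1 (etrans (t_sym _ _) t1); have := ho _ w2 t2; rewrite E1 => -[E].
by move: hp; rewrite -E !inE eqxx /= orbT -in_cons mem_last => /(_ isT).
Qed.

(** Induction by removal of leaves; [A o] is what already hangs from node [o]. The invariants say
    that these parts are disjoint and avoid the remaining bags, and that each vertex and each edge
    is still seen at some remaining node. *)
Lemma tree_plan_from (N : nat) (W : {set T}) (A : option T -> {set V}) :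
  (#|W| <= N)%N -> bags_connected W ->
  (forall o, node_in W o -> plan k (node_bag o) (A o)) ->
  (forall o1 o2 v, node_in W o1 -> node_in W o2 -> v \in A o1 -> v \in A o2 -> o1 = o2) ->
  (forall o1 o2 v, node_in W o1 -> node_in W o2 -> v \in A o1 -> v \notin node_bag o2) ->
  (forall v, exists2 o, node_in W o & v \in A o :|: node_bag o) ->
  (forall u v, e u v -> exists o, [/\ node_in W o, u \in A o :|: node_bag o
     & v \in A o :|: node_bag o]) ->
  plan k set0 setT.
Proof.
elim: N W A => [|N IH] W A cW hc pl disA disB cov edge; have [W0|Wn0] := eqVneq W set0.
- have -> : setT = A None; last exact: (pl None).
  apply/esym/setP => v; rewrite inE; case: (cov v) => -[x|] /=.
    by rewrite W0 inE.
  by rewrite !inE orbF.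
- by move: Wn0; rewrite -card_gt0; move: cW; rewrite leqn0 => /eqP ->.
- have -> : setT = A None; last exact: (pl None).
  apply/esym/setP => v; rewrite inE; case: (cov v) => -[x|] /=.
    by rewrite W0 inE.
  by rewrite !inE orbF.
have [y yW [o [oy oW ho]]] := exists_leaf Wn0.
pose Y := Some y; have YW : node_in W Y by [].
have rip := leaf_intersection hc yW ho.
(* What the leaf hands over to its neighbour: its own schedule and the vertices that leave the bag.
   By connectedness the latter lie in no other remaining bag. *)
pose D := A Y :|: (bag y :\: node_bag o).
have ripo o' v : node_in W o' -> o' <> Y -> v \in bag y -> v \in node_bag o' -> v \in node_bag o.
  case: o' => [z|] /=; last by rewrite inE.
  by move=> zW zy; apply: rip => //; apply/eqP => zE; apply: zy; rewrite zE.
pose W' := W :\ y; pose A' o' := if o' == o then A o :|: D else A o'.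
have nW' o' : node_in W' o' -> node_in W o' /\ o' <> Y.
  case: o' => [z|] //=; rewrite !inE => /andP[/eqP zy zW]; split=> // -[].
  exact: zy.
have Wn' o' : node_in W o' -> o' <> Y -> node_in W' o'.
  by case: o' => [z|] //= zW zy; rewrite !inE zW andbT; apply/eqP => zE; apply: zy; rewrite zE.
have inA' o' v : v \in A' o' -> v \in A o' \/ o' = o /\ v \in D.
  by rewrite /A'; case: eqP => [->|_]; [rewrite in_setU => /orP[]; [left|right] | left].
have A'in o' v : v \in A o' -> v \in A' o'.
  by rewrite /A'; case: eqP => [->|_] // vA; rewrite in_setU vA.
have A'D v : v \in D -> v \in A' o by move=> vD; rewrite /A' eqxx in_setU vD orbT.
have inD v : v \in D -> v \in A Y \/ v \in bag y /\ v \notin node_bag o.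
  by rewrite !inE => /orP[|/andP[]]; [left | right].
have DY o' v : node_in W o' -> o' <> Y -> v \in D -> v \notin A o' /\ v \notin node_bag o'.
  move=> o'W o'Y /inD[vY|[vy vo]]; split.
  - by apply/negP => /(disA _ _ _ YW o'W vY) E; apply: o'Y.
  - exact: disB vY.
  - by apply/negP => /(disB _ _ _ o'W YW); rewrite /= vy.
  - by apply: contra vo; apply: ripo.
have Dcov v : v \in A Y :|: bag y -> (v \in D) || (v \in node_bag o).
  by rewrite !inE; do 3!case: (v \in _).
apply: (IH W' A').
- by have := cardsD1 y W; rewrite yW; rewrite /W' => cE; rewrite cE in cW.
- exact: bags_connected_leaf ho.
- move=> o' /nW' [o'W o'Y]; rewrite /A'; case: eqP => [->|_]; last exact: pl.
  apply: PlanJoin; [exact: pl | | ].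
  + apply: PlanMove; first exact: (pl Y).
      by case: (o) => [x|] /=; rewrite ?cards0.
    split=> [|u v uD euv].
      by rewrite disjoint_subset; apply/subsetP => u uD; have [] := DY _ _ oW oy uD.
    (* A vertex of [D] is present at no remaining node but the leaf, so an edge at it is covered by
       the leaf. *)
    have [o1 [o1W uo1 vo1]] := edge _ _ euv; rewrite in_setU; apply: Dcov.
    suff E : o1 = Y by rewrite E in vo1.
    apply/eqP/negPn/negP => /eqP o1Y; have [n1 n2] := DY _ _ o1W o1Y uD.
    by move: uo1; rewrite inE (negPf n1) (negPf n2).
  + rewrite disjoint_sym disjoint_subset; apply/subsetP => u uD.
    by have [] := DY _ _ oW oy uD.
- move=> o1 o2 v /nW'[o1W o1Y] /nW'[o2W o2Y] /inA'[v1|[E1 v1]] /inA'[v2|[E2 v2]].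
  + exact: disA v1 v2.
  + by have [] := DY _ _ o1W o1Y v2; rewrite v1.
  + by have [] := DY _ _ o2W o2Y v1; rewrite v2.
  + by rewrite E1 E2.
- move=> o1 o2 v /nW'[o1W o1Y] /nW'[o2W o2Y] /inA'[v1|[E1 v1]]; first exact: disB v1.
  by have [] := DY _ _ o2W o2Y v1.
- move=> v; have [o1 o1W vo1] := cov v.
  have [E|/eqP o1Y] := eqVneq o1 Y; last first.
    by exists o1; [exact: Wn' | move: vo1; rewrite !inE => /orP[/A'in ->|->]; rewrite ?orbT].
  exists o; first exact: Wn'.
  rewrite E in vo1; by case/orP: (Dcov _ vo1) => h; rewrite in_setU ?(A'D _ h) ?h ?orbT.
- move=> u v /edge[o1 [o1W uo1 vo1]].
  have [E|/eqP o1Y] := eqVneq o1 Y; last first.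
    exists o1; split; first exact: Wn'.
      by move: uo1; rewrite !inE => /orP[/A'in ->|->]; rewrite ?orbT.
    by move: vo1; rewrite !inE => /orP[/A'in ->|->]; rewrite ?orbT.
  rewrite E in uo1 vo1; exists o; split; first exact: Wn'.
    by case/orP: (Dcov _ uo1) => h; rewrite in_setU ?(A'D _ h) ?h ?orbT.
  by case/orP: (Dcov _ vo1) => h; rewrite in_setU ?(A'D _ h) ?h ?orbT.
Qed.

End Tree.

Lemma tree_decomposition_plan (T : finType) (t : rel T) (bag : T -> {set V}) k :
  is_tree_decomposition e t bag -> (forall x, (#|bag x| <= k)%N) ->
  plan k set0 setT.
Proof.
move=> [[_ t_sym t_irr _ t_acyclic] cov edge conn] bag_card.
apply: (tree_plan_from t_sym t_irr t_acyclic bag_card (leqnn _) (W := setT)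
  (A := fun=> set0)).
- move=> v x y _ _ vx vy; have := conn v x y vx vy; apply: connect_sub => a b.
  by move=> /= /and3P[tab va vb]; apply: connect1; rewrite /bag_rel /= tab !inE va vb.
- by move=> [x|] _; apply: PlanEmpty; rewrite /= ?cards0.
- by move=> o1 o2 v _ _; rewrite inE.
- by move=> o1 o2 v _ _; rewrite inE.
- by move=> v; have [x vx] := cov v; exists (Some x) => //=; rewrite ?inE // vx.
- move=> u v /edge[x /andP[ux vx]]; exists (Some x).
  by split=> //=; rewrite !inE ?ux ?vx.
Qed.

End Plan.

(** * Elimination of a front *)

Section Vertices.
Variables (m n : nat).

Definition rows_of (D : {set 'I_(n + m)}) : {set 'I_m} := [set i | row_vertex n i \in D].
Definition cols_of (D : {set 'I_(n + m)}) : {set 'I_n} := [set j | col_vertex m j \in D].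
Definition row_set (s : seq 'I_m) : {set 'I_(n + m)} := [set x in map (@row_vertex n m) s].
Definition col_set (s : seq 'I_n) : {set 'I_(n + m)} := [set x in map (@col_vertex n m) s].

Lemma row_vertex_inj : injective (@row_vertex n m).
Proof. exact: rshift_inj. Qed.

Lemma col_vertex_inj : injective (@col_vertex n m).
Proof. exact: lshift_inj. Qed.

Lemma row_col_vertex i j : (row_vertex n i == col_vertex m j :> 'I_(n + m)) = false.
Proof. by rewrite /row_vertex /col_vertex eq_rlshift. Qed.

Lemma col_row_vertex i j : (col_vertex m j == row_vertex n i :> 'I_(n + m)) = false.
Proof. by rewrite eq_sym row_col_vertex. Qed.

Lemma row_in_row_set i s : (row_vertex n i \in row_set s) = (i \in s).
Proof. by rewrite inE (mem_map row_vertex_inj). Qed.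

Lemma col_in_col_set j s : (col_vertex m j \in col_set s) = (j \in s).
Proof. by rewrite inE (mem_map col_vertex_inj). Qed.

Lemma row_in_col_set i s : (row_vertex n i \in col_set s) = false.
Proof.
rewrite inE; apply/negP => /mapP[j _ /eqP]; by rewrite row_col_vertex.
Qed.

Lemma col_in_row_set j s : (col_vertex m j \in row_set s) = false.
Proof.
rewrite inE; apply/negP => /mapP[i _ /eqP]; by rewrite col_row_vertex.
Qed.

Definition in_vertex_set :=
  (row_in_row_set, col_in_col_set, row_in_col_set, col_in_row_set).

Lemma vertexW (P : 'I_(n + m) -> Prop) :
  (forall i, P (row_vertex n i)) -> (forall j, P (col_vertex m j)) -> forall x, P x.
Proof. by move=> hr hc x; rewrite -[x]splitK; case: (split x). Qed.

Lemma card_rows_cols D : (#|rows_of D| + #|cols_of D| <= #|D|)%N.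
Proof.
rewrite -(card_imset _ row_vertex_inj) -(card_imset _ col_vertex_inj) -cardsUI.
have -> : [set row_vertex n x | x in rows_of D] :&: [set col_vertex m x | x in cols_of D] = set0.
  apply/setP => x; rewrite !inE; apply/negP => /andP[/imsetP[i _ ->] /imsetP[j _ /eqP]].
  by rewrite row_col_vertex.
rewrite cards0 addn0; apply: subset_leq_card; rewrite subUset.
by apply/andP; split; apply/subsetP => _ /imsetP[x + ->]; rewrite inE.
Qed.

Lemma card_rows D : (#|rows_of D| <= #|D|)%N.
Proof. by apply: leq_trans (card_rows_cols D); rewrite leq_addr. Qed.

Lemma card_cols D : (#|cols_of D| <= #|D|)%N.
Proof. by apply: leq_trans (card_rows_cols D); rewrite leq_addl. Qed.

Lemma card_row_set s : (#|row_set s| <= size s)%N.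
Proof. by rewrite cardsE -(size_map (@row_vertex n m)) card_size. Qed.

Lemma card_col_set s : (#|col_set s| <= size s)%N.
Proof. by rewrite cardsE -(size_map (@col_vertex n m)) card_size. Qed.

End Vertices.

Section OpsHold.
Variables (F : fieldType) (star : {rmorphism F -> F}) (m n : nat).
Implicit Types (mem : seq F) (X : 'M[F]_(m, n)) (Al : {set 'I_(n + m)}).

Definition op_holds mem (x : op nat m n) (v : op F m n) : Prop :=
  match x, v with
  | OElim i j l u us, OElim i' j' l' u' us' =>
    [/\ i = i', j = j', forall a, holds mem (l a) (l' a),
        forall b, holds mem (u b) (u' b) & forall b, holds mem (us b) (us' b)]
  | ORow i w, ORow i' w' => i = i' /\ forall a, holds mem (w a) (w' a)
  | OCol j w, OCol j' w' => j = j' /\ forall b, holds mem (w b) (w' b)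
  | _, _ => False
  end.

Definition ops_hold mem := List.Forall2 (op_holds mem).

Lemma ops_hold_prefix mem mem' ops vops :
  prefix mem mem' -> ops_hold mem ops vops -> ops_hold mem' ops vops.
Proof.
move=> pre; elim=> {ops vops} [|x v ops vops hxv _ IH]; constructor=> //.
case: x v hxv => [i j l u us|i w|j w] [i' j' l' u' us'|i' w'|j' w'] //=.
- by move=> [? ? h1 h2 h3]; split=> // a; apply: (holds_prefix pre).
- by move=> [? h]; split=> // a; apply: (holds_prefix pre).
- by move=> [? h]; split=> // a; apply: (holds_prefix pre).
Qed.

Lemma ops_hold_map mem ops vops :
  ops_hold mem ops vops -> map (map_op (fetch mem)) ops = vops.
Proof.
elim=> {ops vops} [//|x v ops vops hxv _ IH] /=; rewrite IH; congr (_ :: _).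
case: x v hxv => [i j l u us|i w|j w] [i' j' l' u' us'|i' w'|j' w'] //=.
- move=> [-> -> h1 h2 h3]; congr OElim; apply/funext => a /=.
  + by have [] := h1 a. + by have [] := h2 a. + by have [] := h3 a.
- by move=> [-> h]; congr ORow; apply/funext => a /=; have [] := h a.
- by move=> [-> h]; congr OCol; apply/funext => a /=; have [] := h a.
Qed.

Lemma ops_hold_cat mem ops1 vops1 ops2 vops2 :
  ops_hold mem ops1 vops1 -> ops_hold mem ops2 vops2 ->
  ops_hold mem (ops1 ++ ops2) (vops1 ++ vops2).
Proof. exact: List.Forall2_app. Qed.

Lemma ops_hold_seq (I : Type) mem (s : seq I) (f : I -> op nat m n) g :
  (forall x, op_holds mem (f x) (g x)) -> ops_hold mem (map f s) (map g s).
Proof. by move=> h; elim: s => /= [|x s IH]; constructor. Qed.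

Definition elim_op (V : Type) (L : 'M[V]_m) (U Us : 'M[V]_(m, n)) (p : 'I_m * 'I_n) : op V m n :=
  OElim p.1 p.2 (fun a => L a p.1) (fun b => U p.1 b) (fun b => Us p.1 b).

Lemma valid_gauss Al X ps (L : 'M[F]_m) U X' :
  gauss X ps L U X' ->
  (forall p, p \in ps -> row_vertex n p.1 \in Al /\ col_vertex m p.2 \in Al) ->
  valid star Al X (map (elim_op L U (map_mx star U)) ps)
    (Al :\: (row_set n (map fst ps) :|: col_set m (map snd ps))) X'.
Proof.
elim: ps Al X => [|[i j] ps IH] Al X /=.
  move=> -> _; split=> //; rewrite (_ : _ :|: _ = set0) ?setD0 //.
  by apply/setP; apply: vertexW => x; rewrite in_setU !in_vertex_set.
move=> [Li Uij hr hc hg] hAl; have [iAl jAl] := hAl _ (mem_head _ _).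
have hr' := row_eq0P hr; have hc' := col_eq0P hc.
have [_ iN _] := gauss_row0 hg hr'; have [_ jN _] := gauss_col0 hg hc'.
have XE : \matrix_(a, b) (X a b - L a i * U i b) = X - col i L *m row i U.
  by apply/matrixP => a b; rewrite 2!mxE [in RHS]mxE rank1E.
rewrite XE; split=> // [b|]; first by rewrite mxE.
have -> : Al :\: (row_set n (i :: map fst ps) :|: col_set m (j :: map snd ps)) =
   (Al :\ row_vertex n i :\ col_vertex m j) :\: (row_set n (map fst ps) :|: col_set m (map snd ps)).
  apply/setP; apply: vertexW => x; rewrite !in_setD !in_setU !in_set1 !in_vertex_set.
    rewrite !inE row_col_vertex (inj_eq (@row_vertex_inj m n)) !orbF /=.
    by case: (x == i); rewrite /= ?andbF.
  rewrite !inE col_row_vertex (inj_eq (@col_vertex_inj m n)) /=.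
  by case: (x == j); rewrite /= ?andbF.
apply: IH => // p pps; have [] := hAl p; first by rewrite inE pps orbT.
move=> p1 p2; rewrite !inE p1 p2 row_col_vertex col_row_vertex.
rewrite (inj_eq (@row_vertex_inj m n)) (inj_eq (@col_vertex_inj m n)) /= !andbT.
by split; [apply: contraNneq iN => <- | apply: contraNneq jN => <-]; apply: map_f.
Qed.

Lemma valid_rows Al X (s : seq 'I_m) (W : 'M[F]_m) :
  uniq s -> (forall i, i \in s -> row_vertex n i \in Al) ->
  (forall i k, i \in s -> W i k != 0 -> row_vertex n k \in Al /\ k \notin s) ->
  (forall i b, i \in s -> X i b = \sum_k W i k * X k b) ->
  valid star Al X [seq ORow n i (fun k => W i k) | i <- s] (Al :\: row_set n s)
    (\matrix_(a, b) if a \in s then 0 else X a b).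
Proof.
elim: s Al X => [|i s IH] Al X /=.
  move=> _ _ _ _; split; last by apply/matrixP => a b; rewrite mxE.
  by apply/setP => x; rewrite !inE.
move=> /andP[iN us] sAl hW hX; split.
- by apply: sAl; rewrite mem_head.
- move=> k /(hW _ _ (mem_head _ _)) [kAl]; rewrite inE negb_or => /andP[ki _].
  by rewrite !inE kAl (inj_eq (@row_vertex_inj m n)) ki.
- by move=> b; apply: hX; rewrite mem_head.
set X1 := \matrix_(a, b) _.
have -> : Al :\: row_set n (i :: s) = Al :\ row_vertex n i :\: row_set n s.
  apply/setP; apply: vertexW => x; rewrite !in_setD !in_set1 !in_vertex_set /=.
    by rewrite inE (inj_eq (@row_vertex_inj m n)) negb_or andbA [(x != i) && _]andbC.
  by rewrite col_row_vertex.
have -> : \matrix_(a, b) (if a \in i :: s then 0 else X a b) =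
    \matrix_(a, b) if a \in s then 0 else X1 a b.
  by apply/matrixP => a b; rewrite !mxE inE; case: eqP; case: (a \in s).
apply: IH => //.
- move=> k ks; rewrite !inE (inj_eq (@row_vertex_inj m n)) sAl ?inE ?ks ?orbT //.
  by rewrite andbT; apply: contraNneq iN => <-.
- move=> k l ks; have ks' : k \in i :: s by rewrite inE ks orbT.
  move=> /(hW _ _ ks') [lAl]; rewrite inE negb_or => /andP[li ls].
  by rewrite !inE lAl (inj_eq (@row_vertex_inj m n)) li ls.
- move=> k b ks; have ks' : k \in i :: s by rewrite inE ks orbT.
  rewrite mxE (negPf (_ : k != i)); last by apply: contraNneq iN => <-.
  rewrite hX //; apply: eq_bigr => l _; rewrite mxE; case: eqP => // ->.
  suff -> : W k i = 0 by rewrite !mul0r.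
  by apply/eqP/negPn/negP => /(hW _ _ ks') []; rewrite mem_head.
Qed.

Lemma valid_cols Al X (s : seq 'I_n) (W : 'M[F]_n) :
  involutive star ->
  uniq s -> (forall j, j \in s -> col_vertex m j \in Al) ->
  (forall j k, j \in s -> W k j != 0 -> col_vertex m k \in Al /\ k \notin s) ->
  (forall a j, j \in s -> X a j = \sum_k X a k * W k j) ->
  valid star Al X [seq OCol m j (fun k => map_mx star W k j) | j <- s] (Al :\: col_set m s)
    (\matrix_(a, b) if b \in s then 0 else X a b).
Proof.
move=> starK; elim: s Al X => [|j s IH] Al X /=.
  move=> _ _ _ _; split; last by apply/matrixP => a b; rewrite mxE.
  by apply/setP => x; rewrite !inE.
move=> /andP[jN us] sAl hW hX; split.
- by apply: sAl; rewrite mem_head.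
- move=> k; rewrite mxE fmorph_eq0.
  move=> /(hW _ _ (mem_head _ _)) [kAl]; rewrite inE negb_or => /andP[kj _].
  by rewrite !inE kAl (inj_eq (@col_vertex_inj m n)) kj.
- move=> a; rewrite hX ?mem_head //; apply: eq_bigr => k _.
  by rewrite mxE starK.
set X1 := \matrix_(a, b) _.
have -> : Al :\: col_set m (j :: s) = Al :\ col_vertex m j :\: col_set m s.
  apply/setP; apply: vertexW => x; rewrite !in_setD !in_set1 !in_vertex_set /=.
    by rewrite row_col_vertex.
  by rewrite inE (inj_eq (@col_vertex_inj m n)) negb_or andbA [(x != j) && _]andbC.
have -> : \matrix_(a, b) (if b \in j :: s then 0 else X a b) =
    \matrix_(a, b) if b \in s then 0 else X1 a b.
  by apply/matrixP => a b; rewrite !mxE inE; case: eqP; case: (b \in s).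
apply: IH => //.
- move=> k ks; rewrite !inE (inj_eq (@col_vertex_inj m n)) sAl ?inE ?ks ?orbT //.
  by rewrite andbT; apply: contraNneq jN => <-.
- move=> k l ks; have ks' : k \in j :: s by rewrite inE ks orbT.
  move=> /(hW _ _ ks') [lAl]; rewrite inE negb_or => /andP[lj ls].
  by rewrite !inE lAl (inj_eq (@col_vertex_inj m n)) lj ls.
- move=> a k ks; have ks' : k \in j :: s by rewrite inE ks orbT.
  rewrite mxE (negPf (_ : k != j)); last by apply: contraNneq jN => <-.
  rewrite hX //; apply: eq_bigr => l _; rewrite mxE; case: eqP => // ->.
  suff -> : W j k = 0 by rewrite !mulr0.
  by apply/eqP/negPn/negP => /(hW _ _ ks') []; rewrite mem_head.
Qed.

End OpsHold.

(** * Programs for one front and their correctness *)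

Definition front_elim (F : fieldType) (t : forall h, ctree F 'M[nat]_(2 ^ h)) m n h
    (S D : {set 'I_(n + m)}) (X : 'M[nat]_(m, n)) :
    prog F (seq ('I_m * 'I_n) * seq (op nat m n) * 'M[nat]_(m, n)) :=
  let I := rows_of D in let J := cols_of D in
  let I1 := rows_of (D :|: S) in let J1 := cols_of (D :|: S) in
  do d <- lu t h I J X;
  let: (ps, L, U) := d in
  do LF <- block_mul (t h) I1 J I X U;
  do UF <- block_mul (t h) I I J1 L X;
  do V <- block_mul (t h) I1 I J1 LF UF;
  do Y <- matrix_sub F I1 J1 X V;
  do Us <- matrix_star F I J1 UF;
  ret F (ps, map (elim_op LF UF Us) ps,
         \matrix_(i, j) if (i \in I1) && (j \in J1) then Y i j else X i j).

(* After [front_elim], the rows in [D] are supported on the columns in [S]: a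
   maximal set of independent ones is kept, and the others are peeled; likewise
   for columns. *)
Definition front_peel (F : fieldType) (t : forall h, ctree F 'M[nat]_(2 ^ h)) m n h
    (S D : {set 'I_(n + m)}) (ps : seq ('I_m * 'I_n)) (X : 'M[nat]_(m, n)) :
    prog F (seq (op nat m n) * {set 'I_(n + m)} * 'M[nat]_(m, n)) :=
  let I := rows_of D in let J := cols_of D in
  let IS := rows_of S in let JS := cols_of S in
  do z <- emit (Const 0);
  do dr <- lu t h I JS X;
  let: (psr, Lr, Ur) := dr in
  do T1 <- block_mul (t h) I JS I X Ur;
  do T2 <- block_mul (t h) I I I T1 Lr;
  do dc <- lu t h IS J X;
  let: (psc, Lc, Uc) := dc in
  do G1 <- block_mul (t h) IS IS J Lc X;
  do G2 <- block_mul (t h) J IS J Uc G1;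
  do Gs <- matrix_star F J J G2;
  let rs := [seq i <- enum I | (i \notin map fst ps) && (i \notin map fst psr)] in
  let cs := [seq j <- enum J | (j \notin map snd ps) && (j \notin map snd psc)] in
  ret F ([seq ORow n i (fun k => T2 i k) | i <- rs] ++
         [seq OCol m j (fun k => Gs k j) | j <- cs],
         row_set n (map fst psr) :|: col_set m (map snd psc),
         \matrix_(i, j) if (i \in rs) || (j \in cs) then z else X i j).

Definition event (F : fieldType) (t : forall h, ctree F 'M[nat]_(2 ^ h)) m n h
    (S D : {set 'I_(n + m)}) (X : 'M[nat]_(m, n)) :
    prog F (seq (op nat m n) * {set 'I_(n + m)} * 'M[nat]_(m, n)) :=
  do r <- front_elim t h S D X;
  let: (ps, ops1, X1) := r in
  do q <- front_peel t h S D ps X1;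
  let: (ops2, D', X2) := q in
  ret F (ops1 ++ ops2, D', X2).

Section Front.
Variables (R : realType) (F : fieldType) (star : {rmorphism F -> F}).
Hypothesis star_involutive : involutive star.
Variable t : forall h, ctree F 'M[nat]_(2 ^ h).
Variables (u T : nat -> R).
Hypothesis tP : forall h (A B : 'M[F]_(2 ^ h)),
  let res := run star (t h) (entries A ++ entries B) in
  map_mx (fetch (memory res)) (result res) = A *m B /\ (cost res)%:R <= u h.
Hypothesis u_sq : forall h, ((2 ^ h) * (2 ^ h))%:R <= u h.
Hypothesis T0 : 2 <= T 0.
Hypothesis TS : forall h, 4 * (T h + 14 * u h.+1) <= T h.+1.
Variables (m n : nat).
Implicit Types (S D A : {set 'I_(n + m)}) (X : 'M[F]_(m, n)) (mem : seq F).

Definition confined X D S : Prop := forall i j, X i j != 0 ->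
  row_vertex n i \in D \/ col_vertex m j \in D ->
  row_vertex n i \in D :|: S /\ col_vertex m j \in D :|: S.

Definition agree_off A X X1 : Prop := forall i j, X1 i j != X i j ->
  row_vertex n i \in A /\ col_vertex m j \in A.

Definition vanishes A X : Prop := forall i j,
  row_vertex n i \in A \/ col_vertex m j \in A -> X i j = 0.

Lemma supp_mul_exists p q r (I : {set 'I_p}) (J : {set 'I_r}) (A : 'M[F]_(p, q)) (B : 'M[F]_(q, r)) :
  (forall i k j, A i k != 0 -> B k j != 0 -> (i \in I) && (j \in J)) -> supp I J (A *m B).
Proof.
move=> h i j; apply: contraNT => nij; rewrite mxE big1 // => k _.
apply/eqP; rewrite mulf_eq0; apply/negPn/negP; rewrite negb_or => /andP[a b].
by rewrite (h i k j) in nij.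
Qed.

Lemma u_ge0 h : 0 <= u h.
Proof. exact: le_trans (ler0n _ _) (u_sq h). Qed.

Definition front_post S D X mem ps ops (X1' : 'M[nat]_(m, n)) (X1 : 'M[F]_(m, n)) vops : Prop :=
  [/\ rep mem X1' X1, ops_hold mem ops vops,
      valid star D X vops (D :\: (row_set n (map fst ps) :|: col_set m (map snd ps))) X1,
      [/\ zero_on (rows_of D) (cols_of D) X1, confined X1 D S & agree_off (D :|: S) X X1]
    & [/\ within (rows_of D) (cols_of D) ps, all (@is_elim m n nat) ops
        & vanishes (row_set n (map fst ps) :|: col_set m (map snd ps)) X1]].

(** Since [X] is confined, [X *m U] and [L *m X] are supported in the front, and the update inside
    the front is the whole Schur complement. The 5 operations are three products, a subtraction and
    the involution. *)
Lemma spec_front_elim h S D (X' : 'M[nat]_(m, n)) X mem :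
  (#|D :|: S| <= 2 ^ h)%N -> rep mem X' X -> confined X D S ->
  spec star (front_elim t h S D X') mem (T h + 5 * u h)
    (fun mem' r => exists X1 vops, front_post S D X mem' r.1.1 r.1.2 r.2 X1 vops).
Proof.
move=> leDS rX cX.
set I := rows_of D; set J := cols_of D; set I1 := rows_of (D :|: S); set J1 := cols_of (D :|: S).
have leI1 : (#|I1| <= 2 ^ h)%N := leq_trans (card_rows _) leDS.
have leJ1 : (#|J1| <= 2 ^ h)%N := leq_trans (card_cols _) leDS.
have sI : I \subset I1 by apply/subsetP => i; rewrite !inE => ->.
have sJ : J \subset J1 by apply/subsetP => i; rewrite !inE => ->.
have leI : (#|I| <= 2 ^ h)%N := leq_trans (subset_leq_card sI) leI1.
have leJ : (#|J| <= 2 ^ h)%N := leq_trans (subset_leq_card sJ) leJ1.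
have cXr i j : X i j != 0 -> i \in I -> j \in J1.
  by move=> Xij; rewrite !inE => iI; have [] := cX i j Xij (or_introl iI); rewrite !inE.
have cXc i j : X i j != 0 -> j \in J -> i \in I1.
  by move=> Xij; rewrite !inE => jJ; have [] := cX i j Xij (or_intror jJ); rewrite !inE.
apply: (spec_step (spec_lu tP u_sq T0 TS leI leJ (rep_onW rX))).
move=> mem1 [[ps L'] U'] pre [L [U [[/= [rL rU] E sL sU W] Z]]]; lift pre.
have sXU : supp I1 I (X *m U).
  by apply: supp_mul_exists => i k j Xik /sU /andP[kJ ->]; rewrite (cXc _ _ Xik kJ).
have sLX : supp I J1 (L *m X).
  by apply: supp_mul_exists => i k j /sL /andP[-> kI] /cXr ->.
have sJU : supp J setT U by apply: suppS sU.
have sLI : supp setT I L by apply: suppS sL.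
apply: (spec_step (spec_mul tP (rep_onW rX) (rep_onW rU) (or_intror sJU) leI1 leJ leI)).
move=> mem2 LF pre; rewrite (supp_restr sXU) => rLF; lift pre.
apply: (spec_step (spec_mul tP (rep_onW rL) (rep_onW rX) (or_introl sLI) leI leI leJ1)).
move=> mem3 UF pre; rewrite (supp_restr sLX) => rUF; lift pre.
have sI1 : supp setT I (X *m U) by apply: suppS sXU.
have sV : supp I1 J1 (X *m U *m (L *m X)) := supp_mul sXU sLX.
apply: (spec_step (spec_mul tP (rep_onW rLF) (rep_onW rUF) (or_introl sI1) leI1 leI leJ1)).
move=> mem4 V pre; rewrite (supp_restr sV) => rV; lift pre.
apply: (spec_step (spec_sub star u_sq (rep_onW rX) (rep_onW rV) leI1 leJ1)).
move=> mem5 Y pre rY; lift pre.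
have sStar : supp I J1 (map_mx star (L *m X)).
  by move=> i j; rewrite mxE fmorph_eq0; apply: sLX.
apply: (spec_step (spec_star star u_sq (rep_onW rUF) leI leJ1)).
move=> mem6 Us pre; rewrite (supp_restr sStar) => rUs; lift pre.
apply: spec_ret; first by have := u_ge0 h; lra.
have [g _ _ _ _] := E.
set X1 := resid X L U in g Z *.
have X1E i j : ~~ ((i \in I1) && (j \in J1)) -> X1 i j = X i j.
  by move=> nij; rewrite /X1 /resid mxE [X in _ + X]mxE (suppE sV) // subr0.
exists X1; exists (map (elim_op (X *m U) (L *m X) (map_mx star (L *m X))) ps).
have Wp p : p \in ps -> row_vertex n p.1 \in D /\ col_vertex m p.2 \in D.
  by move=> pps; have /andP[] := allP W p pps; rewrite !inE.
have agr : agree_off (D :|: S) X X1.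
  move=> i j; case: (boolP ((i \in I1) && (j \in J1))) => [/andP[]|/X1E ->].
    by rewrite !inE.
  by rewrite eqxx.
split=> //=.
- move=> i j; rewrite mxE; case: ifPn => [/andP[iI jJ]|nij]; last by rewrite X1E.
  by have := rY i j; rewrite mxE iI jJ.
- by apply: ops_hold_seq => p; split.
- exact: valid_gauss.
- split=> // i j nz hD.
  have [e|ne] := eqVneq (X1 i j) (X i j); last exact: agr ne.
  by apply: cX => //; rewrite -e.
- have [_ _ h1 h2] := gauss_pivots g.
  split=> //; first by rewrite all_map; apply/allP.
  move=> i j; rewrite !in_setU !in_vertex_set orbF /= => -[|].
    exact: h1.
  exact: h2.
Qed.

Lemma within_size (I : {set 'I_m}) (J : {set 'I_n}) ps :
  within I J ps -> uniq (map fst ps) -> uniq (map snd ps) ->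
  (size ps <= #|I|)%N /\ (size ps <= #|J|)%N.
Proof.
move=> /allP W u1 u2; split.
  rewrite -(size_map fst) cardE; apply: uniq_leq_size => // _ /mapP[p /W /andP[pI _] ->].
  by rewrite mem_enum.
rewrite -(size_map snd) cardE; apply: uniq_leq_size => // _ /mapP[p /W /andP[_ pJ] ->].
by rewrite mem_enum.
Qed.

(** [r.1.2] is the part of [A] that is still alive, and [b] bounds its size. *)
Definition step_post S A X mem (r : seq (op nat m n) * {set 'I_(n + m)} * 'M[nat]_(m, n))
    (b : nat) : Prop :=
  exists X2 vops,
  [/\ rep mem r.2 X2, ops_hold mem r.1.1 vops, valid star A X vops r.1.2 X2,
      agree_off (A :|: S) X X2
    & [/\ r.1.2 \subset A, vanishes (A :\: r.1.2) X2 & (#|r.1.2| <= b)%N]].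

Lemma spec_front_peel h S D (ps : seq ('I_m * 'I_n)) (X' : 'M[nat]_(m, n)) X mem :
  let P := row_set n (map fst ps) :|: col_set m (map snd ps) in
  (#|D :|: S| <= 2 ^ h)%N -> rep mem X' X -> confined X D S ->
  zero_on (rows_of D) (cols_of D) X -> vanishes P X ->
  spec star (front_peel t h S D ps X') mem (2 * T h + 5 * u h)
    (fun mem' r => exists X2 vops,
      [/\ rep mem' r.2 X2, ops_hold mem' r.1.1 vops, valid star (D :\: P) X vops r.1.2 X2,
          agree_off (D :|: S) X X2
        & [/\ r.1.2 \subset D, vanishes (D :\: r.1.2) X2 & (#|r.1.2| <= #|S|)%N]]).
Proof.
move=> P leDS rX cX zX vX.
set I := rows_of D; set J := cols_of D; set IS := rows_of S; set JS := cols_of S.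
have leDS1 := leq_trans (subset_leq_card (subsetUl D S)) leDS.
have leDS2 := leq_trans (subset_leq_card (subsetUr D S)) leDS.
have leI : (#|I| <= 2 ^ h)%N := leq_trans (card_rows _) leDS1.
have leJ : (#|J| <= 2 ^ h)%N := leq_trans (card_cols _) leDS1.
have leIS : (#|IS| <= 2 ^ h)%N := leq_trans (card_rows _) leDS2.
have leJS : (#|JS| <= 2 ^ h)%N := leq_trans (card_cols _) leDS2.
(* An interior row vanishes on the interior columns, so its nonzero entries lie in the columns of
   the bag. *)
have cXr i j : X i j != 0 -> i \in I -> j \in JS.
  move=> Xij; rewrite !inE => iI; have [_] := cX i j Xij (or_introl iI).
  rewrite inE => /orP[jD|//]; by rewrite zX ?inE ?eqxx in Xij.
have cXc i j : X i j != 0 -> j \in J -> i \in IS.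
  move=> Xij; rewrite !inE => jJ; have [+ _] := cX i j Xij (or_intror jJ).
  rewrite inE => /orP[iD|//]; by rewrite zX ?inE ?eqxx in Xij.
apply: spec_const => mem0 z pre hz; lift pre.
apply: (spec_step (spec_lu tP u_sq T0 TS leI leJS (rep_onW rX))).
move=> mem1 [[psr Lr'] Ur'] pre [Lr [Ur [[/= [rLr rUr] Er sLr sUr Wr] Zr]]]; lift pre.
have sUr' : supp JS setT Ur by apply: suppS sUr.
have sLr' : supp I setT Lr by apply: suppS sLr.
apply: (spec_step (spec_mul tP (rep_onW rX) (rep_onW rUr) (or_intror sUr') leI leJS leI)).
move=> mem2 T1 pre rT1; lift pre.
apply: (spec_step (spec_mul tP (rep_onW rT1) (rep_onW rLr) (or_intror sLr') leI leI leI)).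
move=> mem3 T2 pre rT2; lift pre.
apply: (spec_step (spec_lu tP u_sq T0 TS leIS leJ (rep_onW rX))).
move=> mem4 [[psc Lc'] Uc'] pre [Lc [Uc [[/= [rLc rUc] Ec sLc sUc Wc] Zc]]]; lift pre.
have sLc' : supp setT IS Lc by apply: suppS sLc.
have sUc' : supp setT IS Uc by apply: suppS sUc.
apply: (spec_step (spec_mul tP (rep_onW rLc) (rep_onW rX) (or_introl sLc') leIS leIS leJ)).
move=> mem5 G1 pre rG1; lift pre.
apply: (spec_step (spec_mul tP (rep_onW rUc) (rep_onW rG1) (or_introl sUc') leJ leIS leJ)).
move=> mem6 G2 pre rG2; lift pre.
apply: (spec_step (spec_star star u_sq (rep_onW rG2) leJ leJ)).
move=> mem7 Gs pre rGs; lift pre.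
apply: spec_ret; first by have := u_ge0 h; lra.
set W1 := restr I I _ in rT2; set W2 := restr J J _ in rG2 rGs.
set rs := [seq i <- enum I | _]; set cs := [seq j <- enum J | _].
have {}rGs : rep mem7 Gs (map_mx star W2).
  suff -> : map_mx star W2 = restr J J (map_mx star W2) by [].
  by apply/matrixP => i j; rewrite !mxE; case: ifP => _; rewrite ?rmorph0.
have [gr _ _ _ [LrD _]] := Er; have [gc _ _ _ [_ UcD]] := Ec.
have [ur1 ur2 _ _] := gauss_pivots gr; have [uc1 uc2 _ _] := gauss_pivots gc.
have Wr1 i : i \in map fst psr -> i \in I by move=> /mapP[p /(allP Wr) /andP[pI _] ->].
have Wc2 j : j \in map snd psc -> j \in J by move=> /mapP[p /(allP Wc) /andP[_ pJ] ->].
(* A row eliminated before is zero and cannot be a pivot here, so the rows that are kept are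
   alive. *)
have psr_ps i : i \in map fst psr -> i \notin map fst ps.
  move=> ir; apply/negP => ip; have Xi b : X i b = 0.
    by apply: vX; left; rewrite in_setU !in_vertex_set ip.
  by have [_ /negP + _] := gauss_row0 gr Xi; apply.
have psc_ps j : j \in map snd psc -> j \notin map snd ps.
  move=> jr; apply/negP => jp; have Xj a : X a j = 0.
    by apply: vX; right; rewrite in_setU !in_vertex_set jp.
  by have [_ /negP + _] := gauss_col0 gc Xj; apply.
(* [Lr] is supported on the columns indexed by its pivot rows, so only kept rows get a
   coefficient. *)
have W1r i k : W1 i k != 0 -> k \in map fst psr.
  rewrite mxE; case: ifP => [_|]; last by rewrite eqxx.
  rewrite -{1}LrD mulmxA idm_mulr; case: ifP => //; by rewrite eqxx.
have W2c k j : W2 k j != 0 -> k \in map snd psc.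
  rewrite mxE; case: ifP => [_|]; last by rewrite eqxx.
  rewrite -{1}UcD -mulmxA idm_mull; case: ifP => //; by rewrite eqxx.
(* On the columns of the bag the Schur complement is zero, that is [X = X *m Ur *m (Lr *m X)] there;
   on the other columns all interior rows are zero. *)
have rowE i b : i \in I -> X i b = \sum_k W1 i k * X k b.
  move=> iI; case: (boolP (b \in JS)) => bJ; last first.
    have X0 a : a \in I -> X a b = 0.
      by move=> aI; apply/eqP/negPn/negP => /cXr /(_ aI); rewrite (negPf bJ).
    rewrite X0 // big1 // => k _; case: (eqVneq (W1 i k) 0) => [->|/W1r /Wr1 /X0 ->].
      by rewrite mul0r.
    by rewrite mulr0.
  have := Zr i b iI bJ; rewrite /resid mxE [X in _ + X]mxE => /eqP; rewrite subr_eq0 => /eqP ->.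
  rewrite mulmxA mxE; apply: eq_bigr => k _.
  rewrite [W1 i k]mxE iI /=; case: ifPn => kI.
    congr (_ * _); rewrite [LHS]mxE [RHS]mxE; apply: eq_bigr => l _; congr (_ * _).
    case: (boolP (l \in I)) => lI; first by rewrite [RHS]mxE iI lI.
    rewrite [RHS]mxE (negPf lI) andbF mxE big1 // => c _.
    by rewrite (suppE sUr) ?mulr0 // (negPf lI) andbF.
  rewrite mul0r mxE big1 ?mul0r // => l _.
  by rewrite (suppE sLr) ?mulr0 // (negPf kI) andbF.
have colE a j : j \in J -> X a j = \sum_k X a k * W2 k j.
  move=> jJ; case: (boolP (a \in IS)) => aI; last first.
    have X0 b : b \in J -> X a b = 0.
      by move=> bJ; apply/eqP/negPn/negP => /cXc /(_ bJ); rewrite (negPf aI).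
    rewrite X0 // big1 // => k _; case: (eqVneq (W2 k j) 0) => [->|/W2c /Wc2 /X0 ->].
      by rewrite mulr0.
    by rewrite mul0r.
  have := Zc a j aI jJ; rewrite /resid mxE [X in _ + X]mxE => /eqP; rewrite subr_eq0 => /eqP ->.
  rewrite -mulmxA mxE; apply: eq_bigr => k _; congr (_ * _).
  rewrite [W2 k j]mxE jJ andbT; case: ifPn => kJ.
    rewrite [LHS]mxE [RHS]mxE; apply: eq_bigr => l _; congr (_ * _).
    case: (boolP (l \in IS)) => lI; first by rewrite [RHS]mxE lI jJ.
    rewrite [RHS]mxE (negPf lI) /= mxE big1 // => c _.
    by rewrite (suppE sLc) ?mul0r // (negPf lI).
  rewrite mxE big1 // => l _.
  by rewrite (suppE sUc) ?mul0r // (negPf kJ).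
pose X1 := \matrix_(a, b) if a \in rs then 0 else X a b.
pose X2 := \matrix_(a, b) if b \in cs then 0 else X1 a b.
exists X2; exists ([seq ORow n i (fun k => W1 i k) | i <- rs] ++
  [seq OCol m j (fun k => map_mx star W2 k j) | j <- cs]).
have rsE i : (i \in rs) = [&& i \in I, i \notin map fst ps & i \notin map fst psr].
  by rewrite mem_filter mem_enum andbC.
have csE j : (j \in cs) = [&& j \in J, j \notin map snd ps & j \notin map snd psc].
  by rewrite mem_filter mem_enum andbC.
have [PEr PEc] : (forall i, (row_vertex n i \in D :\: P) = (i \in I) && (i \notin map fst ps)) /\
          (forall j, (col_vertex m j \in D :\: P) = (j \in J) && (j \notin map snd ps)).
  by split=> x; rewrite in_setD in_setU !in_vertex_set ?orbF !inE andbC.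
have D'E : row_set n (map fst psr) :|: col_set m (map snd psc) =
    D :\: P :\: row_set n rs :\: col_set m cs.
  apply/setP; apply: vertexW => x; rewrite in_setU !in_setD in_setU !in_vertex_set ?orbF /=.
    rewrite rsE !inE; case: (boolP (x \in map fst psr)) => xr.
      by rewrite psr_ps // !andbF /=; have := Wr1 x xr; rewrite !inE.
    rewrite andbT; case: (x \in map fst ps); rewrite /= ?andbF ?andbT //.
    by case: (row_vertex n x \in D).
  rewrite csE !inE; case: (boolP (x \in map snd psc)) => xr.
    by rewrite psc_ps // !andbF /=; have := Wc2 x xr; rewrite !inE.
  rewrite andbT; case: (x \in map snd ps); rewrite /= ?andbF ?andbT //.
  by case: (col_vertex m x \in D).
split=> /=.
- move=> i j; rewrite !mxE; case: (i \in rs) => /=; first by rewrite if_same.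
  by case: (j \in cs).
- apply: ops_hold_cat; apply: ops_hold_seq => x; split=> // k.
- rewrite D'E; apply: (valid_cat (X1 := X1)).
    apply: valid_rows.
    + by rewrite filter_uniq ?enum_uniq.
    + by move=> i; rewrite rsE PEr => /and3P[-> -> _].
    + move=> i k irs /W1r kr; rewrite PEr Wr1 // psr_ps //; split=> //.
      by rewrite rsE kr !andbF.
    + by move=> i b; rewrite rsE => /andP[iI _]; apply: rowE.
  apply: valid_cols => //.
  + by rewrite filter_uniq ?enum_uniq.
  + move=> j; rewrite csE in_setD in_vertex_set PEc => /and3P[-> -> _] //.
  + move=> j k jcs /W2c kr; rewrite in_setD in_vertex_set PEc Wc2 // psc_ps //; split=> //.
    by rewrite csE kr !andbF.
  (* The column coefficients were computed before the rows were peeled; the relation persists, as a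
     zeroed row is zero on both sides. *)
  + move=> a j; rewrite csE => /andP[jJ _]; rewrite mxE; case: ifP => ars.
      by rewrite big1 // => k _; rewrite [X1 a k]mxE ars mul0r.
    by rewrite colE //; apply: eq_bigr => k _; rewrite [X1 a k]mxE ars.
- move=> i j ne; apply: cX.
    apply: contra_neq ne => X0; rewrite !mxE X0.
    by rewrite !if_same.
  move: ne; rewrite !mxE rsE csE !inE; case: (boolP (col_vertex m j \in D)) => jD; first by right.
  by case: (boolP (row_vertex n i \in D)) => iD; [left | rewrite eqxx].
- split.
  + apply/subsetP; apply: vertexW => x; rewrite in_setU !in_vertex_set ?orbF /=.
      by move/Wr1; rewrite inE.
    by move/Wc2; rewrite inE.
  + move=> i j; rewrite !in_setD !in_setU !in_vertex_set ?orbF /= => h'.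
    rewrite !mxE; case: ifPn => // jcs; case: ifPn => // ircs.
    apply: vX; rewrite !in_setU !in_vertex_set ?orbF /=.
    case: h' => /andP[nr xD]; [left | right].
      by apply/negPn/negP => np; move: ircs; rewrite rsE !inE xD np nr.
    by apply/negPn/negP => np; move: jcs; rewrite csE !inE xD np nr.
  (* Kept rows are matched with distinct columns of the bag, and kept columns with distinct rows of
     the bag. *)
  + apply: leq_trans (card_rows_cols S); apply: leq_trans (leq_card_setU _ _) _.
    have [_ l1] := within_size Wr ur1 ur2; have [l2 _] := within_size Wc uc1 uc2.
    rewrite addnC; apply: leq_add.
      by apply: leq_trans (card_col_set _ _) _; rewrite size_map.
    by apply: leq_trans (card_row_set _ _) _; rewrite size_map.
Qed.

Lemma spec_event h S D (X' : 'M[nat]_(m, n)) X mem :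
  (#|D :|: S| <= 2 ^ h)%N -> rep mem X' X -> confined X D S ->
  spec star (event t h S D X') mem (3 * T h + 10 * u h)
    (fun mem' r => step_post S D X mem' r #|S|).
Proof.
move=> leDS rX cX.
apply: (spec_step (spec_front_elim leDS rX cX)).
move=> mem1 [[ps ops1] X1'] pre [X1 [vops1 [/= rX1 h1 v1 [z1 c1 a1] [w1 _ n1]]]].
lift pre.
apply: (spec_step (spec_front_peel leDS rX1 c1 z1 n1)).
move=> mem2 [[ops2 D'] X2'] pre [X2 [vops2 [/= rX2 h2 v2 a2 [s2 n2 l2]]]].
apply: spec_ret; first by have := u_ge0 h; lra.
exists X2; exists (vops1 ++ vops2); split=> //=.
- apply: ops_hold_cat => //; exact: ops_hold_prefix h1.
- exact: valid_cat v2.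
- move=> i j; have [->|/a2 //] := eqVneq (X2 i j) (X1 i j); exact: a1.
Qed.

(** * Scheduling the fronts *)

Section Loop.
Variables (adj : rel 'I_(n + m)) (k h : nat).
Implicit Types B : {set 'I_(n + m)}.

(** Only entries that meet [A] have to be edges: fill-in between two vertices of the bag need not be
    one. *)
Definition adapted A X : Prop := forall i j, X i j != 0 ->
  row_vertex n i \in A \/ col_vertex m j \in A ->
  adj (row_vertex n i) (col_vertex m j) /\ adj (col_vertex m j) (row_vertex n i).

(* [e] bounds the number of fronts and [b] the number of vertices of [A] that are
   left: the inequality says that each front gets rid of at least [k] vertices. *)
Definition loop_ok S A (b e : nat)
    (p : 'M[nat]_(m, n) -> prog F (seq (op nat m n) * {set 'I_(n + m)} * 'M[nat]_(m, n))) :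
    Prop :=
  (e * k + b <= #|A|)%N /\
  forall (X' : 'M[nat]_(m, n)) X mem, rep mem X' X -> adapted A X ->
    spec star (p X') mem (e%:R * (3 * T h + 10 * u h))
      (fun mem' r => step_post S A X mem' r b).

Lemma adaptedS A B X : A \subset B -> adapted B X -> adapted A X.
Proof.
move=> /subsetP sub hB i j nz hA; apply: hB nz _.
by case: hA => /sub; [left | right].
Qed.

(** A modified entry lies in [A :|: S]; an unmodified one is an edge, which separation keeps there
    too. Vertices of [A] outside [D] have zero rows and columns. *)
Lemma step_confined S A X X1 (D : {set 'I_(n + m)}) :
  separates adj S A -> adapted A X -> agree_off (A :|: S) X X1 -> D \subset A ->
  vanishes (A :\: D) X1 -> confined X1 D S.
Proof.
move=> [dis sep] hA agr /subsetP DA van i j nz hD.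
have iAS : row_vertex n i \in A :|: S /\ col_vertex m j \in A :|: S.
  have [e|ne] := eqVneq (X1 i j) (X i j); last exact: agr ne.
  rewrite e in nz; have hD' : row_vertex n i \in A \/ col_vertex m j \in A.
    by case: hD => /DA; [left | right].
  have [e1 e2] := hA i j nz hD'.
  case: hD' => hA'; split; try by rewrite in_setU hA'.
    exact: sep e1.
  exact: sep e2.
have alive x : x \in A :|: S -> (x \in A :\: D -> X1 i j = 0) -> x \in D :|: S.
  rewrite !inE => /orP[xA|->]; last by rewrite orbT.
  case: (boolP (x \in D)) => //= xD; rewrite xA => /(_ isT) X0.
  by rewrite X0 eqxx in nz.
case: iAS => iA jA; split; apply: alive => // h'; apply: van; by [left | right].
Qed.

Lemma step_post_event S A X mem mem' ops1 D1 (b2 : nat) X1 vops1 r :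
  separates adj S A -> prefix mem mem' ->
  ops_hold mem ops1 vops1 -> valid star A X vops1 D1 X1 ->
  agree_off (A :|: S) X X1 -> D1 \subset A -> vanishes (A :\: D1) X1 ->
  step_post S D1 X1 mem' r b2 ->
  step_post S A X mem' (ops1 ++ r.1.1, r.1.2, r.2 : 'M[nat]_(m, n)) b2.
Proof.
move=> [dis _] pre h1 v1 a1 s1 n1 [X2 [vops2 [rX2 h2 v2 a2 [s2 n2 l2]]]].
exists X2; exists (vops1 ++ vops2); split=> //=.
- by apply: ops_hold_cat => //; apply: ops_hold_prefix pre h1.
- exact: valid_cat v2.
- move=> i j; have [->|/a2 []] := eqVneq (X2 i j) (X1 i j); first exact: a1.
  rewrite !in_setU => hi hj; split.
    by case/orP: hi => [/(subsetP s1) ->|->]; rewrite ?orbT.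
  by case/orP: hj => [/(subsetP s1) ->|->]; rewrite ?orbT.
- split=> //; first exact: subset_trans s1.
  move=> i j hij.
  have [hd|hd] : (row_vertex n i \in D1 :\: r.1.2 \/ col_vertex m j \in D1 :\: r.1.2) \/
      (row_vertex n i \in A :\: D1 \/ col_vertex m j \in A :\: D1).
    rewrite !inE; case: hij; rewrite inE => /andP[-> xA] /=.
      by case: (boolP (row_vertex n i \in D1)); [left; left | right; left].
    by case: (boolP (col_vertex m j \in D1)); [left; right | right; right].
  - exact: n2.
  - have [->|/a2 [i2 j2]] := eqVneq (X2 i j) (X1 i j); first exact: n1.
    case: hd; rewrite inE => /andP[xD xA]; exfalso.
      move: i2; rewrite inE (negPf xD) /= => xS.
      by rewrite (disjointFr dis xA) in xS.
    move: j2; rewrite inE (negPf xD) /= => xS.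
    by rewrite (disjointFr dis xA) in xS.
Qed.

Lemma loop_reduce S A b e p : separates adj S A -> (#|S| <= k)%N -> (b + k <= 2 ^ h)%N ->
  loop_ok S A b e p -> exists b' e' p', (b' <= 2 * k)%N /\ loop_ok S A b' e' p'.
Proof.
move=> sep leS leb [le hp]; case: (leqP b (2 * k)) => bk.
  by exists b, e, p.
(* More than [2 * k] vertices are pending and at most [k] survive the front, so the new budget
   [e.+1 * k + k] stays below [e * k + b]. *)
exists k; exists e.+1.
exists (fun X' : 'M[nat]_(m, n) => do r <- p X'; let: (ops, D, X1) := r in
  do q <- event t h S D X1; let: (ops2, D2, X2) := q in ret F (ops ++ ops2, D2, X2)).
split; first by lia.
split=> [|X' X mem rX aX]; first by lia.
apply: (spec_step (hp _ _ _ rX aX)).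
move=> mem1 [[ops1 D1] X1'] pre [X1 [vops1 [/= rX1 h1 v1 a1 [s1 n1 l1]]]].
have leDS : (#|D1 :|: S| <= 2 ^ h)%N.
  by apply: leq_trans (leq_card_setU _ _) _; apply: leq_trans leb; apply: leq_add.
have c1 := step_confined sep aX a1 s1 n1.
apply: (spec_step (spec_event leDS rX1 c1)).
move=> mem2 [[ops2 D2] X2'] pre2 [X2 [vops2 [rX2 h2 v2 a2 [s2 n2 l2]]]].
apply: spec_ret; first by rewrite -natr1 mulrDl mul1r; lra.
apply: (@step_post_event _ _ _ mem1 mem2 _ D1 k X1 vops1 (ops2, D2, X2')) => //.
by exists X2; exists vops2; split=> //; split=> //; apply: leq_trans leS.
Qed.

(** The worst case is a join: two pending sets of at most [2 * k] vertices each and their common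
    bag. *)
Hypothesis leh : (5 * k <= 2 ^ h)%N.

Lemma plan_loop S A : plan adj k S A ->
  exists b e p, (b <= 2 * k)%N /\ loop_ok S A b e p.
Proof.
move=> pl; elim: pl => {S A} [S leS|S A B pA IA pB IB dAB|S S' A pA IA leS' sepM].
- exists 0; exists 0; exists (fun X' : 'M[nat]_(m, n) => ret F ([::], set0, X')); split=> //.
  split=> [|X' X mem rX _]; first by rewrite cards0.
  apply: spec_ret; first by rewrite mul0r.
  exists X; exists [::]; split=> //=.
    by move=> i j; rewrite eqxx.
  split=> //; last by rewrite cards0.
  by move=> i j; rewrite !inE => -[].
- have [b1 [e1 [p1 [le1 [c1 h1]]]]] := IA; have [b2 [e2 [p2 [le2 [c2 h2]]]]] := IB.
  have leS := plan_bag pA; have sep := plan_separates (PlanJoin pA pB dAB).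
  have [disA sepA] := plan_separates pA; have [disB sepB] := plan_separates pB.
  apply: (@loop_reduce _ _ (b1 + b2) (e1 + e2) (fun X' : 'M[nat]_(m, n) =>
    do r <- p1 X'; let: (ops1, D1, X1) := r in
    do q <- p2 X1; let: (ops2, D2, X2) := q in ret F (ops1 ++ ops2, D1 :|: D2, X2))) => //.
    by lia.
  split.
    have -> : #|A :|: B| = (#|A| + #|B|)%N.
      by apply/eqP; rewrite (eq_leqif (leq_card_setU A B)).
    by rewrite mulnDl addnACA leq_add.
  move=> X' X mem rX aX.
  apply: (spec_step (h1 _ _ _ rX (adaptedS (subsetUl _ _) aX))).
  move=> mem1 [[ops1 D1] X1'] pre1 [X1 [vops1 [/= rX1 o1 v1 a1 [s1 n1 l1]]]].
  have offB x : x \in B -> x \notin A :|: S.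
    by move=> xB; rewrite inE negb_or (disjointFl dAB xB) (disjointFr disB xB).
  have offA x : x \in A -> x \notin B :|: S.
    by move=> xA; rewrite inE negb_or (disjointFr dAB xA) (disjointFr disA xA).
  (* The work on [A] changed entries of [A :|: S] only, and [B] is disjoint from that set. *)
  have aX1 : adapted B X1.
    move=> i j nz hB; have [e|/a1 [iA jA]] := eqVneq (X1 i j) (X i j); last first.
      by case: hB => /offB; rewrite ?iA ?jA.
    rewrite e in nz; apply: aX nz _; rewrite !inE.
    by case: hB => ->; rewrite orbT; [left | right].
  apply: (spec_step (h2 _ _ _ rX1 aX1)).
  move=> mem2 [[ops2 D2] X2'] pre2 [X2 [vops2 [/= rX2 o2 v2 a2 [s2 n2 l2]]]].
  apply: spec_ret; first by rewrite natrD mulrDl; lra.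
  exists X2; exists (vops1 ++ vops2); split=> //=.
  + by apply: ops_hold_cat => //; apply: ops_hold_prefix pre2 o1.
  + apply: (valid_cat (Al1 := D1 :|: B) (X1 := X1)).
      by apply: valid_frame v1; rewrite disjoint_sym.
    rewrite (setUC D1 B) (setUC D1 D2); apply: valid_frame v2.
    by apply: disjointWl dAB.
  + move=> i j; have [->|/a2 []] := eqVneq (X2 i j) (X1 i j).
      move=> /a1[]; rewrite !inE => hi hj; split.
        by case/orP: hi => ->; rewrite ?orbT.
      by case/orP: hj => ->; rewrite ?orbT.
    rewrite !inE => hi hj; split.
      by case/orP: hi => ->; rewrite ?orbT.
    by case/orP: hj => ->; rewrite ?orbT.
  + split; first exact: setUSS.
      move=> i j hij.
      have [hd|hd] : (row_vertex n i \in B :\: D2 \/ col_vertex m j \in B :\: D2) \/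
          (row_vertex n i \in A :\: D1 \/ col_vertex m j \in A :\: D1).
        case: hij; rewrite !inE negb_or => /andP[/andP[n1' n2'] /orP[xA|xA]];
          rewrite ?n1' ?n2' ?xA; by [right; left | left; left | right; right | left; right].
      - exact: n2.
      - have [->|/a2 [i2 j2]] := eqVneq (X2 i j) (X1 i j); first exact: n1.
        by case: hd; rewrite inE => /andP[_ /offA]; rewrite ?i2 ?j2.
    apply: leq_trans (leq_card_setU _ _) _; exact: leq_add.
- have [b [e [p [le [c hp]]]]] := IA; have leS := plan_bag pA.
  have [disA sepA] := plan_separates pA.
  have cA : #|A :|: (S :\: S')| = (#|A| + #|S :\: S'|)%N.
    apply/eqP; rewrite (eq_leqif (leq_card_setU A (S :\: S'))).
    by apply: disjointWr disA; apply: subsetDl.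
  have leM : (#|S :\: S'| <= k)%N by apply: leq_trans leS; apply: subset_leq_card; apply: subsetDl.
  apply: (@loop_reduce _ _ (b + #|S :\: S'|) e (fun X' : 'M[nat]_(m, n) =>
    do r <- p X'; let: (ops, D, X1) := r in
    ret F (ops, D :|: (S :\: S'), X1))) => //; first by lia.
  split; first by rewrite cA addnA leq_add2r.
  move=> X' X mem rX aX.
  apply: (spec_step (hp _ _ _ rX (adaptedS (subsetUl _ _) aX))).
  move=> mem1 [[ops1 D1] X1'] pre1 [X1 [vops1 [/= rX1 o1 v1 a1 [s1 n1 l1]]]].
  apply: spec_ret; first by rewrite subrr.
  exists X1; exists vops1; split=> //=.
  + apply: valid_frame v1; rewrite disjoint_sym.
    by apply: disjointWr disA; apply: subsetDl.
  + move=> i j /a1[]; rewrite !inE => hi hj; split.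
      by case/orP: hi => ->; case: (_ \in S'); rewrite ?orbT.
    by case/orP: hj => ->; case: (_ \in S'); rewrite ?orbT.
  + split; first exact: setSU.
      have sub x : x \in (A :|: S :\: S') :\: (D1 :|: S :\: S') -> x \in A :\: D1.
        rewrite in_setD !in_setU negb_or => /andP[/andP[xD xM] /orP[xA|]].
          by rewrite inE xD.
        by rewrite (negPf xM).
      by move=> i j hij; apply: n1; case: hij => /sub; [left | right].
    apply: leq_trans (leq_card_setU _ _) _; exact: leq_add.
Qed.

Lemma peeling_pass : plan adj k set0 setT ->
  exists (e : nat) (p : 'M[nat]_(m, n) -> prog F (seq (op nat m n))),
  (e * k <= n + m)%N /\
  forall (X' : 'M[nat]_(m, n)) (X : 'M[F]_(m, n)) mem, rep mem X' X -> adapted setT X ->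
  spec star (p X') mem (e.+1%:R * (3 * T h + 10 * u h))
    (fun mem' ops => exists2 vops, ops_hold mem' ops vops & valid star setT X vops set0 0).
Proof.
move=> pl; have [b [e [p [leb [lee hp]]]]] := plan_loop pl.
exists e; exists (fun X' : 'M[nat]_(m, n) => do r <- p X'; let: (ops, D, X1) := r in
  do q <- event t h set0 D X1; let: (ops2, _, _) := q in ret F (ops ++ ops2)).
split; first by apply: leq_trans (leq_addr b _) _; rewrite cardsT card_ord in lee.
move=> X' X mem rX aX; apply: (spec_step (hp _ _ _ rX aX)).
move=> mem1 [[ops1 D1] X1'] pre [X1 [vops1 [/= rX1 h1 v1 a1 [s1 n1 l1]]]].
have c1 := step_confined (plan_separates pl) aX a1 s1 n1.
have leD : (#|D1 :|: set0| <= 2 ^ h)%N.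
  rewrite setU0; apply: leq_trans l1 (leq_trans leb (leq_trans _ leh)).
  by rewrite leq_mul2r orbT.
apply: (spec_step (spec_event leD rX1 c1)).
move=> mem2 [[ops2 D2] X2'] pre2 hpost.
apply: spec_ret; first by rewrite -natr1 mulrDl mul1r; lra.
have [X2 [vops [/= rX2 h2 v2 _ [_ n2 l2]]]] :=
  step_post_event (plan_separates pl) pre2 h1 v1 a1 s1 n1 hpost.
(* The last bag is empty, so no vertex survives the last front. *)
have D20 : D2 = set0 by apply/eqP; rewrite -cards_eq0 -leqn0 -(cards0 'I_(n + m)).
exists vops => //; rewrite D20 in v2 n2.
suff <- : X2 = 0 by [].
by apply/matrixP => i j; rewrite mxE n2 //; left; rewrite !inE.
Qed.

(* The last front contains [Z]; it is eliminated without peeling. *)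
Lemma lu_pass (Z : {set 'I_(n + m)}) : plan adj k Z (setT :\: Z) ->
  exists (e : nat) (p : 'M[nat]_(m, n) -> prog F (seq (op nat m n))),
  (e * k <= n + m)%N /\
  forall (X' : 'M[nat]_(m, n)) (X : 'M[F]_(m, n)) mem, rep mem X' X -> adapted setT X ->
  rows_free (setT :\: Z) X -> cols_free (setT :\: Z) X ->
  spec star (p X') mem (e.+1%:R * (3 * T h + 10 * u h))
    (fun mem' ops => all (@is_elim m n nat) ops /\
       exists vops Al, ops_hold mem' ops vops /\ valid star setT X vops Al 0).
Proof.
move=> pl; have [b [e [p [leb [lee hp]]]]] := plan_loop pl.
exists e; exists (fun X' : 'M[nat]_(m, n) => do r <- p X'; let: (ops, D, X1) := r in
  do q <- front_elim t h set0 (D :|: Z) X1; let: (_, ops2, _) := q in ret F (ops ++ ops2)).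
split.
  apply: leq_trans (leq_addr b _) _; apply: leq_trans lee _.
  by apply: leq_trans (max_card _) _; rewrite card_ord.
move=> X' X mem rX aX fr fc.
apply: (spec_step (hp _ _ _ rX (adaptedS (subsetT _) aX))).
move=> mem1 [[ops1 D1] X1'] pre [X1 [vops1 [/= rX1 h1 v1 a1 [s1 n1 l1]]]].
(* The fronts still run the peeling program, but independence outside [Z] makes its list of peelings
   empty. *)
have el1 := valid_free_all_elim v1 fr fc.
have out x : x \notin D1 :|: Z -> x \in setT :\: Z :\: D1.
  by rewrite !inE negb_or => /andP[-> ->].
have alive i j : X1 i j != 0 -> row_vertex n i \in D1 :|: Z /\ col_vertex m j \in D1 :|: Z.
  move=> nz; split; apply/negPn/negP => /out hout; case/negP: nz; apply/eqP; apply: n1.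
    by left.
  by right.
have c1 : confined X1 (D1 :|: Z) set0 by move=> i j /alive; rewrite setU0.
have leD : (#|D1 :|: Z :|: set0| <= 2 ^ h)%N.
  rewrite setU0; apply: leq_trans (leq_card_setU _ _) _.
  apply: leq_trans (leq_add (leq_trans l1 leb) (plan_bag pl)) (leq_trans _ leh).
  by rewrite -{2}(mul1n k) -mulnDl leq_mul2r orbT.
apply: (spec_step (spec_front_elim leD rX1 c1)).
move=> mem2 [[ps ops2] X2'] pre2 [X2 [vops2 [/= rX2 h2 v2 [z2 _ a2] [_ el2 _]]]].
apply: spec_ret.
  have u0 := u_ge0 h; have := T_ge u_sq T0 TS h.
  by rewrite -natr1 mulrDl mul1r; lra.
split.
  rewrite all_cat el2 andbT; move: el1; rewrite -(ops_hold_map h1) all_map.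
  by rewrite (eq_all (a2 := @is_elim m n nat)) // => -[].
exists (vops1 ++ vops2).
exists ((D1 :|: Z) :\: (row_set n (map fst ps) :|: col_set m (map snd ps))); split.
  by apply: ops_hold_cat => //; apply: ops_hold_prefix pre2 h1.
(* All remaining nonzero entries lie in the last front, whose interior is the whole front, so its
   elimination clears them. *)
have X20 : X2 = 0.
  apply/matrixP => i j; rewrite [RHS]mxE; apply/eqP/negPn/negP => nz.
  have [iD jD] : row_vertex n i \in D1 :|: Z /\ col_vertex m j \in D1 :|: Z.
    have [e21|ne] := eqVneq (X2 i j) (X1 i j); first by apply: alive; rewrite -e21.
    by have := a2 i j ne; rewrite setU0.
  by case/negP: nz; apply/eqP; apply: z2; rewrite inE.
rewrite -X20; apply: valid_cat _ v2.
have -> : setT = setT :\: Z :|: Z :> {set 'I_(n + m)} by apply/setP => x; rewrite !inE andbT orNb.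
apply: valid_frame v1.
by rewrite disjoint_subset; apply/subsetP => x xZ; rewrite !inE xZ.
Qed.

End Loop.
End Front.

(** * Costs *)

Section Costs.
Variables (R : realType) (F : fieldType) (star : F -> F) (omega : R).
Hypothesis omega_gt2 : 2 < omega.

Lemma powR_nat_exp (h : nat) : (2 ^ h)%:R `^ omega = (2 `^ omega) ^+ h :> R.
Proof.
elim: h => [|h IH]; first by rewrite expn0 expr0 powR1.
by rewrite expnS natrM powRM ?ler0n // IH exprS.
Qed.

Lemma two_powR_gt4 : 4 < 2 `^ omega :> R.
Proof.
have -> : 4 = 2 `^ 2 :> R by rewrite powR_mulrn ?ler0n // expr2 -natrM.
rewrite lt_neqAle ler_powR ?ler1n ?ltW // andbT; apply/eqP => e2.
have : 2 `^ (omega - 2) == 1 :> R.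
  by rewrite powRB ?pnatr_eq0 ?implybT // -e2 divff // gt_eqF // powR_gt0.
rewrite powR_eq1 => /or3P[]; first by rewrite -[1]/(1%:R) eqr_nat.
  by rewrite ltNge ler0n.
by rewrite subr_eq0 gt_eqF.
Qed.

Lemma block_costs : matmul_exponent star omega ->
  exists (t : forall h, ctree F 'M[nat]_(2 ^ h)) (u T : nat -> R) (G : R),
  [/\ forall h (A B : 'M[F]_(2 ^ h)),
        let res := run star (t h) (entries A ++ entries B) in
        map_mx (fetch (memory res)) (result res) = A *m B /\ (cost res)%:R <= u h,
      forall h, ((2 ^ h) * (2 ^ h))%:R <= u h,
      2 <= T 0, forall h, 4 * (T h + 14 * u h.+1) <= T h.+1
    & 0 <= G /\ forall h, 3 * T h + 10 * u h <= G * (2 ^ h)%:R `^ omega].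
Proof.
move=> [C0 hC]; set w := 2 `^ omega : R; have w4 : 4 < w := two_powR_gt4.
(* The maximum with 1 makes [a * w ^+ h] dominate the number [4 ^+ h] of entries too. *)
pose a := Num.max 1 C0; have a1 : 1 <= a by rewrite le_max lexx.
have aC : C0 <= a by rewrite le_max lexx orbT.
have wh0 h : 0 < w ^+ h by rewrite exprn_gt0 //; lra.
(* Solves [La * w = 4 * La + 56 * a * w + 2 * (w - 4)], where 56 is 4 times 14; the summand 2 takes
   care of [T 0]. Dividing by [w - 4] is where [omega > 2] enters. *)
pose La := 56 * a * w / (w - 4) + 2.
have La2 : 2 <= La.
  by rewrite lerDr divr_ge0 //; [apply: mulr_ge0; lra | lra].
exists (fun h => projT1 (cid (hC (2 ^ h)%N))); exists (fun h => a * w ^+ h).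
exists (fun h => La * w ^+ h); exists (3 * La + 10 * a); split.
- move=> h A B /=; case: cid => tr /= /(_ A B) [-> le]; split=> //.
  apply: le_trans le _; rewrite powR_nat_exp; apply: ler_wpM2r => //.
  exact: ltW.
- move=> h; have : 4 ^+ h <= w ^+ h by apply: lerXn2r; rewrite ?nnegrE; lra.
  have -> : (2 ^ h * 2 ^ h)%:R = 4 ^+ h :> R.
    by rewrite -expnMn natrX.
  move=> le; apply: le_trans le _; rewrite ler_peMl // ltW //.
- by rewrite expr0 mulr1.
- move=> h; rewrite exprS.
  have -> : 4 * (La * w ^+ h + 14 * (a * (w * w ^+ h))) = (4 * La + 56 * a * w) * w ^+ h by ring.
  rewrite mulrA; apply: ler_wpM2r; first exact: ltW.
  have LaE : La * w - 4 * La = 56 * a * w + 2 * (w - 4).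
    by rewrite /La; field; rewrite subr_eq0 gt_eqF.
  by lra.
- split; first by lra.
  by move=> h; rewrite powR_nat_exp -/w !mulrA -mulrDl.
Qed.

(** A front costs at most [G] times the power [omega] of [10 * k]; one factor [k] is traded against
    the number of fronts for [M]. *)
Lemma events_cost (G E : R) (e k h M : nat) :
  0 <= G -> (0 < k)%N -> (2 ^ h <= 10 * k)%N -> (e.+1 * k <= M)%N ->
  E <= G * (2 ^ h)%:R `^ omega ->
  e.+1%:R * E <= (G * 10 `^ omega) * M%:R * k%:R `^ (omega - 1).
Proof.
move=> G0 k0 leh leM leE.
have kk : k%:R `^ omega = k%:R * k%:R `^ (omega - 1) :> R.
  by rewrite mulr_powRB1 ?ler0n // (lt_trans _ omega_gt2).
have E2 : E <= G * 10 `^ omega * (k%:R * k%:R `^ (omega - 1)).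
  apply: le_trans leE _; rewrite -kk -mulrA -powRM ?ler0n // -natrM.
  apply: ler_wpM2l => //; apply: ge0_ler_powR; rewrite ?nnegrE ?ler0n ?ler_nat //.
  exact: ltW (lt_trans _ omega_gt2).
apply: le_trans (ler_wpM2l (ler0n _ _) E2) _.
have -> : e.+1%:R * (G * 10 `^ omega * (k%:R * k%:R `^ (omega - 1))) =
    (G * 10 `^ omega) * (e.+1 * k)%:R * k%:R `^ (omega - 1) :> R by rewrite natrM; ring.
apply: ler_wpM2r; first exact: powR_ge0.
by apply: ler_wpM2l; rewrite ?ler_nat // mulr_ge0 // powR_ge0.
Qed.

End Costs.

Lemma pow2_between q : (0 < q)%N -> exists h, (q <= 2 ^ h <= 2 * q)%N.
Proof.
case: q => [|[|q]] // _; first by exists 0.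
have /andP[lt le] := up_log_bounds (isT : 1 < 2)%N (isT : 1 < q.+2)%N.
exists (up_log 2 q.+2); rewrite le /=; case: (up_log 2 q.+2) lt le => [|l] //= lt _.
by rewrite expnS leq_mul2l ltnW.
Qed.

(** * The bipartite graph of a matrix *)

Section Bipartite.
Variables (F : fieldType) (star : {rmorphism F -> F}) (m n : nat).
Implicit Types B : 'M[F]_(m, n).

Lemma adj_graph_pattern B B0 : pattern B = pattern B0 ->
  adj_graph (bip_mx star B) = adj_graph (bip_mx star B0).
Proof.
move=> /matrixP pat; have nz i j : (B i j != 0) = (B0 i j != 0).
  by have := pat i j; rewrite !mxE.
apply/funext => x; apply/funext => y; rewrite /adj_graph; congr (_ && _).
rewrite /bip_mx; elim/vertexW: x => i; elim/vertexW: y => j; rewrite /row_vertex /col_vertex.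
- by rewrite !block_mxEdr !mxE eqxx.
- by rewrite !block_mxEdl nz.
- by rewrite !block_mxEur !mxE !fmorph_eq0 nz.
- by rewrite !block_mxEul !mxE eqxx.
Qed.

Lemma bip_mx_adapted B : adapted (adj_graph (bip_mx star B)) setT B.
Proof.
move=> i j nz _; rewrite /adj_graph row_col_vertex col_row_vertex /bip_mx /=.
rewrite /row_vertex /col_vertex block_mxEdl block_mxEur !mxE fmorph_eq0.
by rewrite nz.
Qed.

Lemma treewidth_unique (V : finType) (e : rel V) tau tau' :
  is_treewidth e tau -> is_treewidth e tau' -> tau = tau'.
Proof.
move=> [[T1 [t1 [b1 [d1 w1]]]] min1] [[T2 [t2 [b2 [d2 w2]]]] min2].
by apply/eqP; rewrite eqn_leq -{1}w2 (min1 _ _ _ d2) -{1}w1 (min2 _ _ _ d1).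
Qed.

(** Use a single bag with all vertices. The bound makes the extra final front affordable, since then
    [tau.+1 <= m + n]. *)
Lemma treewidth_lt_card (V : finType) (e : rel V) tau :
  (0 < #|V|)%N -> is_treewidth e tau -> (tau < #|V|)%N.
Proof.
move=> V0 [_ min].
have /min : is_tree_decomposition e (fun _ _ : unit => false) (fun=> [set: V]).
  split.
  - split=> //; [by rewrite card_unit | by move=> [] []; apply: connect0 | by move=> [|x [|y c]]].
  - by move=> v; exists tt; rewrite in_setT.
  - by move=> v w _; exists tt; rewrite !in_setT.
  - by move=> v [] [] _ _; apply: connect0.
rewrite /td_width => le; apply: leq_ltn_trans le _.
rewrite -[X in (_ < X)%N]prednK // ltnS -!subn1 leq_sub2r //.
by apply/bigmax_leqP => x _; rewrite cardsT.
Qed.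

Lemma treewidth_gt0 (V : finType) (e : rel V) tau u v :
  u != v -> e u v -> is_treewidth e tau -> (0 < tau)%N.
Proof.
move=> uv euv [[T [t [b [[_ _ edge _] <-]]]] _].
have [x /andP[ux vx]] := edge _ _ euv.
rewrite /td_width -subn1 subn_gt0; apply: leq_trans (leq_bigmax x).
apply: (@leq_trans #|[set u; v]|); first by rewrite cards2 uv.
by apply: subset_leq_card; rewrite subUset !sub1set ux vx.
Qed.

Lemma treewidth_plan (V : finType) (e : rel V) tau :
  is_treewidth e tau -> plan e tau.+1 set0 setT.
Proof.
move=> [[T [t [b [dec <-]]]] _]; apply: (tree_decomposition_plan dec) => x.
have := leq_bigmax (F := fun x => #|b x|) x; rewrite /td_width.
by case: (\max_x _) => [|w]; rewrite ?leqn0 // => /eqP ->.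
Qed.

End Bipartite.

(** * Input layout and the two algorithms *)

Definition input_cells m n : seq ('I_m * 'I_n) := [seq (i, j) | i <- enum 'I_m, j <- enum 'I_n].

Definition input_addr m n : 'M[nat]_(m, n) := \matrix_(i, j) index (i, j) (input_cells m n).

Lemma entries_input (V : Type) m n (B : 'M[V]_(m, n)) :
  entries B = [seq B p.1 p.2 | p <- input_cells m n].
Proof. by rewrite /entries /input_cells map_allpairs. Qed.

Lemma rep_input (F : fieldType) m n (B : 'M[F]_(m, n)) : rep (entries B) (input_addr m n) B.
Proof.
move=> i j; have ij : (i, j) \in input_cells m n by apply/allpairsP; exists (i, j); rewrite !mem_enum.
rewrite entries_input mxE; split; first by rewrite size_map index_mem.
by rewrite /fetch (nth_map (i, j)) ?index_mem // nth_index.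
Qed.

Lemma run_spec (R : realType) (F : fieldType) (star : F -> F) O (p : prog F O) m n
    (B : 'M[F]_(m, n)) (c : R) Q :
  spec star p (entries B) c Q ->
  let res := run star (p (size (input_cells m n))) (entries B) in
  Q (memory res) (result res) /\ (cost res)%:R <= c.
Proof.
have -> : size (input_cells m n) = size (entries B) by rewrite entries_input size_map.
by move=> [_ ? ?].
Qed.

Section Final.
Variables (R : realType) (F : fieldType) (star : {rmorphism F -> F}).
Hypothesis star_involutive : involutive star.
Variable t : forall h, ctree F 'M[nat]_(2 ^ h).
Variables (u T : nat -> R) (omega G : R).
Hypothesis omega_gt2 : 2 < omega.
Hypothesis tP : forall h (A B : 'M[F]_(2 ^ h)),
  let res := run star (t h) (entries A ++ entries B) in
  map_mx (fetch (memory res)) (result res) = A *m B /\ (cost res)%:R <= u h.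
Hypothesis u_sq : forall h, ((2 ^ h) * (2 ^ h))%:R <= u h.
Hypothesis T0 : 2 <= T 0.
Hypothesis TS : forall h, 4 * (T h + 14 * u h.+1) <= T h.+1.
Hypothesis G0 : 0 <= G.
Hypothesis GE : forall h, 3 * T h + 10 * u h <= G * (2 ^ h)%:R `^ omega.

Lemma omega_subr1_ge0 : 0 <= omega - 1.
Proof. by rewrite subr_ge0 ltW // (lt_trans _ omega_gt2) // ltr1n. Qed.

(** Applied to addresses when the output is formed, hence free of cost. *)
Definition peeled_of m n z o (ops : seq (op nat m n)) : peeled_data nat m n :=
  projT1 (cid (convert_peeled star_involutive z o ops)).

Lemma peeled_ofP m n z o (ops : seq (op nat m n)) vops mem (B X' : 'M[F]_(m, n)) :
  holds mem z 0 -> holds mem o 1 -> ops_hold mem ops vops ->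
  valid star setT B vops set0 X' ->
  is_peeled_LU star B (map_peeled (fetch mem) (peeled_of z o ops)).
Proof.
move=> hz ho hops hv; rewrite /peeled_of; case: cid => d /= hd; apply: hd.
  by split; [exact: hz.2 | exact: ho.2].
by rewrite (ops_hold_map hops); exact: hv.
Qed.

Definition lu_of m n (ops : seq (op nat m n)) : lu_data nat m n :=
  projT1 (cid (convert_lu star ops)).

Lemma lu_ofP m n (ops : seq (op nat m n)) vops mem (B : 'M[F]_(m, n)) Al :
  all (@is_elim m n nat) ops -> ops_hold mem ops vops ->
  valid star setT B vops Al 0 -> is_LU B (map_lu (fetch mem) (lu_of ops)).
Proof.
move=> hel hops hv; rewrite /lu_of; case: cid => d /= hd; apply: hd => //.
by rewrite (ops_hold_map hops); exact: hv.
Qed.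

(** For the zero matrix every row and column is peeled with the constant zero as coefficients, which
    takes no counted operation. *)
Definition peel_all m n (z : nat) : seq (op nat m n) :=
  [seq ORow n i (fun k => (const_mx z : 'M_m) i k) | i <- enum 'I_m] ++
  [seq OCol m j (fun k => (const_mx z : 'M_n) k j) | j <- enum 'I_n].

Lemma peel_all_valid m n mem z : holds mem z (0 : F) ->
  exists2 vops, ops_hold mem (peel_all m n z) vops &
    exists X', valid star setT (0 : 'M[F]_(m, n)) vops set0 X'.
Proof.
move=> hz; exists ([seq ORow n i (fun k => (0 : 'M[F]_m) i k) | i <- enum 'I_m] ++
  [seq OCol m j (fun k => map_mx star (0 : 'M[F]_n) k j) | j <- enum 'I_n]).
  by apply: ops_hold_cat; apply: ops_hold_seq => x; split=> // k; rewrite !mxE ?rmorph0.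
have hr : valid star setT (0 : 'M[F]_(m, n)) [seq ORow n i (fun k => (0 : 'M[F]_m) i k) | i <- enum 'I_m]
    (setT :\: row_set n (enum 'I_m)) (\matrix_(a, b) if a \in enum 'I_m then 0 else (0 : 'M[F]_(m, n)) a b).
  apply: valid_rows => //; first exact: enum_uniq.
  - by move=> i _; rewrite in_setT.
  - by move=> i k _; rewrite mxE eqxx.
  - by move=> i b _; rewrite mxE big1 // => k _; rewrite mxE mul0r.
eexists; apply: (valid_cat hr).
set X1 := \matrix_(a, b) _; set Al := _ :\: _.
have -> : set0 = Al :\: col_set m (enum 'I_n).
  apply/setP; apply: vertexW => x; rewrite !in_setD !in_vertex_set !mem_enum !inE //=.
apply: valid_cols => //; first exact: enum_uniq.
- by move=> j _; rewrite in_setD in_vertex_set inE.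
- by move=> j k _; rewrite mxE eqxx.
- move=> a j _; rewrite [LHS]mxE mem_enum /= big1 // => k _.
  by rewrite mxE mem_enum /= mul0r.
Qed.

Lemma front_size_exists k : (0 < k)%N -> exists h, (5 * k <= 2 ^ h)%N /\ (2 ^ h <= 10 * k)%N.
Proof.
move=> k0; have [|h /andP[h1 h2]] := @pow2_between (5 * k); first by rewrite muln_gt0.
by exists h; split=> //; rewrite (leq_trans h2) // mulnA.
Qed.

Lemma nonzero_entry m n (B : 'M[F]_(m, n)) : B != 0 -> exists i j, B i j != 0.
Proof.
move=> B0; apply: contrapT => no; case/eqP: B0; apply/matrixP => i j.
by rewrite mxE; apply/eqP/negPn/negP => nz; apply: no; exists i, j.
Qed.

Lemma treewidth_bounds m n (B : 'M[F]_(m, n)) tau : B != 0 ->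
  is_treewidth (adj_graph (bip_mx star B)) tau -> (0 < tau)%N /\ (tau < m + n)%N.
Proof.
move=> /nonzero_entry[i [j nz]] tw; split.
  have [e1 _] := bip_mx_adapted star nz (or_introl (in_setT (row_vertex n i))).
  by apply: treewidth_gt0 e1 tw; rewrite row_col_vertex.
rewrite addnC -[X in (_ < X)%N]card_ord; apply: treewidth_lt_card tw.
by rewrite card_ord; apply: leq_ltn_trans (ltn_ord (row_vertex n i)).
Qed.

Lemma first_pass m n (B0 : 'M[F]_(m, n)) tau : B0 != 0 ->
  is_treewidth (adj_graph (bip_mx star B0)) tau ->
  exists p : 'M[nat]_(m, n) -> prog F (seq (op nat m n)),
  forall B X' mem, pattern B = pattern B0 -> rep mem X' B ->
  spec star (p X') mem
    (G * 10 `^ omega * (2 * (m + n))%:R * (2 * tau)%:R `^ (omega - 1))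
    (fun mem' ops => exists2 vops, ops_hold mem' ops vops & valid star setT B vops set0 0).
Proof.
move=> nz tw; have [tau0 tauN] := treewidth_bounds nz tw.
have [h [h1 h2]] := front_size_exists (ltn0Sn tau).
have [e [p [le hp]]] := peeling_pass star_involutive tP u_sq T0 TS h1 (treewidth_plan tw).
exists p => B X' mem pat rX.
have aB : adapted (adj_graph (bip_mx star B0)) setT B.
  by rewrite -(adj_graph_pattern star pat); apply: bip_mx_adapted.
apply: spec_le (hp _ _ _ rX aB).
(* One [m + n] pays for the [e] fronts of the loop, the other for the final one. *)
have leM : (e.+1 * tau.+1 <= 2 * (m + n))%N.
  by rewrite mulSn mul2n -addnn leq_add // addnC.
apply: le_trans (events_cost omega_gt2 G0 (ltn0Sn tau) h2 leM (GE h)) _.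
apply: ler_wpM2l; first by rewrite !mulr_ge0 // powR_ge0.
apply: ge0_ler_powR; rewrite ?nnegrE ?ler0n ?ler_nat //; first exact: omega_subr1_ge0.
by lia.
Qed.

Lemma second_pass m n (B0 : 'M[F]_(m, n)) tau K (Z : {set 'I_(n + m)}) : B0 != 0 ->
  is_treewidth (adj_graph (bip_mx star B0)) tau -> (#|Z| <= 2 * (K * tau))%N ->
  exists p : 'M[nat]_(m, n) -> prog F (seq (op nat m n)),
  forall B X' mem, pattern B = pattern B0 -> rep mem X' B ->
  rows_free (setT :\: Z) B -> cols_free (setT :\: Z) B ->
  spec star (p X') mem
    (G * 10 `^ omega * ((2 * K + 2) * (m + n))%:R * ((2 * K + 2) * tau)%:R `^ (omega - 1))
    (fun mem' ops => all (@is_elim m n nat) ops /\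
       exists vops Al, ops_hold mem' ops vops /\ valid star setT B vops Al 0).
Proof.
move=> nz tw leZ; have [tau0 tauN] := treewidth_bounds nz tw.
(* Bag size plus the bound on [Z]; at most [(2 * K + 2) * tau], as a nonzero matrix has
   [tau > 0]. *)
pose k := (tau.+1 + 2 * (K * tau))%N.
have [h [h1 h2]] := front_size_exists (isT : 0 < k)%N.
have pl : plan (adj_graph (bip_mx star B0)) k Z (setT :\: Z).
  by rewrite -[Z in plan _ _ Z]set0U; apply: plan_augment (treewidth_plan tw) _; rewrite leq_add2l.
have [e [p [le hp]]] := lu_pass star_involutive tP u_sq T0 TS h1 pl.
exists p => B X' mem pat rX fr fc.
have aB : adapted (adj_graph (bip_mx star B0)) setT B.
  by rewrite -(adj_graph_pattern star pat); apply: bip_mx_adapted.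
apply: spec_le (hp _ _ _ rX aB fr fc).
have leM : (e.+1 * k <= (2 * K + 2) * (m + n))%N.
  have : (K * tau <= K * (m + n))%N by rewrite leq_mul2l ltnW ?orbT.
  by rewrite mulSn mulnDl -mulnA /k in le *; lia.
apply: le_trans (events_cost omega_gt2 G0 (isT : 0 < k)%N h2 leM (GE h)) _.
apply: ler_wpM2l; first by rewrite !mulr_ge0 // powR_ge0.
apply: ge0_ler_powR; rewrite ?nnegrE ?ler0n ?ler_nat //; first exact: omega_subr1_ge0.
by rewrite /k mulnDl -mulnA; lia.
Qed.

Lemma peeled_tree m n (pat : 'M[bool]_(m, n)) :
  exists tr : ctree F (peeled_data nat m n),
  forall (B : 'M[F]_(m, n)) tau, pattern B = pat ->
    is_treewidth (adj_graph (bip_mx star B)) tau ->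
    let res := run star tr (entries B) in
    is_peeled_LU star B (map_peeled (fetch (memory res)) (result res)) /\
    (cost res)%:R <=
      (G * 10 `^ omega * 2 * 2 `^ (omega - 1)) * (m + n)%:R * tau%:R `^ (omega - 1).
Proof.
have C0 : 0 <= G * 10 `^ omega * 2 * 2 `^ (omega - 1) by rewrite !mulr_ge0 // powR_ge0.
(* The tree may depend on the pattern only. Any [B0] with that pattern supplies a decomposition, and
   every other such matrix has the same graph and treewidth. *)
case: (pselect (exists B0 tau0, pattern B0 = pat /\
    is_treewidth (adj_graph (bip_mx star B0)) tau0)); last first.
  move=> no; exists (Output F (peeled_of (m := m) (n := n) 0 0 [::])) => B tau hB hw.
  by case: no; exists B, tau.
move=> [B0 [tau0 [patE tw0]]].
have [B00|nz] := eqVneq B0 0.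
  pose p : prog F (peeled_data nat m n) :=
    do z <- emit (Const 0); do o <- emit (Const 1); ret F (peeled_of z o (peel_all m n z)).
  exists (p (size (input_cells m n))) => B tau patB tw.
  have B0' : B = 0.
    apply/matrixP => i j; have /matrixP/(_ i j) := etrans patB (esym patE).
    by rewrite !mxE B00 mxE eqxx => /negbFE/eqP.
  have hs : spec star p (entries B) (0 : R) (fun mem' d =>
      is_peeled_LU star B (map_peeled (fetch mem') d)).
    apply: spec_const => mem1 z pre hz; lift pre.
    apply: spec_const => mem2 o pre ho; lift pre.
    apply: spec_ret => //.
    have [vops h1 [X' h2]] := peel_all_valid m n hz.
    by apply: (peeled_ofP hz ho h1 (X' := X')); rewrite B0'.
  have [h1 h2] := run_spec hs; split=> //; apply: le_trans h2 _.
  by rewrite !mulr_ge0 ?powR_ge0.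
have [p hp] := first_pass nz tw0.
pose q : prog F (peeled_data nat m n) :=
  do z <- emit (Const 0); do o <- emit (Const 1);
  do ops <- p (input_addr m n); ret F (peeled_of z o ops).
exists (q (size (input_cells m n))) => B tau patB tw.
have patB0 : pattern B = pattern B0 by rewrite patB patE.
have tauE : tau = tau0.
  by apply: treewidth_unique tw _; rewrite (adj_graph_pattern star patB0).
apply: (run_spec (Q := fun mem' d => is_peeled_LU star B (map_peeled (fetch mem') d))).
have rB := rep_input B.
apply: spec_const => mem1 z pre hz; lift pre.
apply: spec_const => mem2 o pre ho; lift pre.
apply: (spec_step (hp _ _ _ patB0 rB)) => mem3 ops pre [vops h1 h2]; lift pre.
apply: spec_ret; last exact: (peeled_ofP hz ho h1 h2).
rewrite tauE natrM [(2 * tau0)%:R]natrM powRM ?ler0n // subr_ge0 le_eqVlt.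
by apply/orP; left; apply/eqP; ring.
Qed.

Lemma lu_tree K m n (pat : 'M[bool]_(m, n)) :
  exists tr : ctree F (lu_data nat m n),
  forall (B : 'M[F]_(m, n)) tau, pattern B = pat ->
    is_treewidth (adj_graph (bip_mx star B)) tau -> (maxn m n - \rank B <= K * tau)%N ->
    let res := run star tr (entries B) in
    is_LU B (map_lu (fetch (memory res)) (result res)) /\
    (cost res)%:R <=
      (G * 10 `^ omega * (2 * 2 `^ (omega - 1) + (2 * K + 2)%:R * (2 * K + 2)%:R `^ (omega - 1)))
      * (m + n)%:R * tau%:R `^ (omega - 1).
Proof.
set C := G * _ * _.
have C0 : 0 <= C by rewrite !mulr_ge0 ?addr_ge0 ?mulr_ge0 ?powR_ge0 ?ler0n.
case: (pselect (exists B0 tau0, pattern B0 = pat /\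
    is_treewidth (adj_graph (bip_mx star B0)) tau0)); last first.
  move=> no; exists (Output F (lu_of (m := m) (n := n) [::])) => B tau hB hw.
  by case: no; exists B, tau.
move=> [B0 [tau0 [patE tw0]]].
have [B00|nz] := eqVneq B0 0.
  exists (Output F (lu_of (m := m) (n := n) [::])) => B tau patB tw _.
  have B0' : B = 0.
    apply/matrixP => i j; have /matrixP/(_ i j) := etrans patB (esym patE).
    by rewrite !mxE B00 mxE eqxx => /negbFE/eqP.
  rewrite /run /=; split; last by rewrite mulr0n mulr_ge0 ?powR_ge0 // mulr_ge0 ?ler0n.
  by apply: (lu_ofP (vops := [::]) (Al := setT)).
have [p hp] := first_pass nz tw0.
(* [Z] is read off the operations at each leaf of the first pass, so a second program is needed for
   every [Z], even one too large to occur under the rank hypothesis. *)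
have second (Z : {set 'I_(n + m)}) : exists p2 : 'M[nat]_(m, n) -> prog F (seq (op nat m n)),
    (#|Z| <= 2 * (K * tau0))%N ->
    forall B X' mem, pattern B = pattern B0 -> rep mem X' B ->
    rows_free (setT :\: Z) B -> cols_free (setT :\: Z) B ->
    spec star (p2 X') mem
      (G * 10 `^ omega * ((2 * K + 2) * (m + n))%:R * ((2 * K + 2) * tau0)%:R `^ (omega - 1))
      (fun mem' ops => all (@is_elim m n nat) ops /\
         exists vops Al, ops_hold mem' ops vops /\ valid star setT B vops Al 0).
  case: (boolP (#|Z| <= 2 * (K * tau0))%N) => [leZ|_]; last by exists (fun=> ret F [::]).
  by have [p2 h2] := second_pass nz tw0 leZ; exists p2.
pose p2 Z := projT1 (cid (second Z)).
(* The second pass starts again from the input, which the append-only memory still holds at its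
   original addresses. *)
pose q : prog F (lu_data nat m n) :=
  do ops <- p (input_addr m n);
  do ops2 <- p2 (~: pivots ops) (input_addr m n); ret F (lu_of ops2).
exists (q (size (input_cells m n))) => B tau patB tw rk.
have patB0 : pattern B = pattern B0 by rewrite patB patE.
have tauE : tau = tau0.
  by apply: treewidth_unique tw _; rewrite (adj_graph_pattern star patB0).
rewrite tauE in rk *; apply: (run_spec (Q := fun mem' d => is_LU B (map_lu (fetch mem') d))).
have rB := rep_input B.
apply: (spec_step (hp _ _ _ patB0 rB)) => mem1 ops pre [vops h1 h2]; lift pre.
have pivE : pivots ops = pivots vops by rewrite -(ops_hold_map h1) pivots_map.
have TZ : setT :\: ~: pivots ops = pivots vops by rewrite setTD setCK pivE.
have [fr fc] := valid_pivots_free h2.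
(* At most [m + n - 2 * \rank B] vertices are not pivots, which is at most twice
   [maxn m n - \rank B]. *)
have leZ : (#|~: pivots ops| <= 2 * (K * tau0))%N.
  have := valid_rank h2; rewrite -pivE => le2.
  have := cardsC (pivots ops); rewrite card_ord => cE.
  have : (m <= maxn m n)%N by exact: leq_maxl.
  have : (n <= maxn m n)%N by exact: leq_maxr.
  move: rk le2 cE; move: (K * tau0)%N (maxn m n) (\rank B) #|pivots ops| #|~: pivots ops|.
  by lia.
have hp2 := projT2 (cid (second (~: pivots ops))) leZ B (input_addr m n) mem1 patB0 rB.
rewrite -TZ in fr fc.
apply: (spec_step (hp2 fr fc)) => mem2 ops2 pre [el [vops2 [Al [h3 h4]]]].
apply: spec_ret; last exact: (lu_ofP el h3 h4).
rewrite /C !(natrM _ _ (m + n)) !(natrM _ _ tau0) !powRM ?ler0n //.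
by rewrite le_eqVlt; apply/orP; left; apply/eqP; ring.
Qed.

End Final.
Theorem corollary5p12 (R : realType) (F : fieldType)
    (star : {rmorphism F -> F}) (omega : R)
    (star_involutive : involutive star)
    (omega_gt2 : 2 < omega)
    (omega_matmul : matmul_exponent star omega) :
  (exists (C : R)
          (alg : forall m n : nat, 'M[bool]_(m, n) ->
                   ctree F (peeled_data nat m n)),
    forall (m n : nat) (B : 'M[F]_(m, n)) (tau : nat),
      is_treewidth (adj_graph (bip_mx star B)) tau ->
      let res := run star (alg m n (pattern B)) (entries B) in
      is_peeled_LU star B (map_peeled (fetch (memory res)) (result res)) /\
      (cost res)%:R <= C * (m + n)%:R * tau%:R `^ (omega - 1))
  /\
  (forall K : nat,
    exists (C : R)
           (alg : forall m n : nat, 'M[bool]_(m, n) ->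
                    ctree F (lu_data nat m n)),
    forall (m n : nat) (B : 'M[F]_(m, n)) (tau : nat),
      is_treewidth (adj_graph (bip_mx star B)) tau ->
      (maxn m n - \rank B <= K * tau)%N ->
      let res := run star (alg m n (pattern B)) (entries B) in
      is_LU B (map_lu (fetch (memory res)) (result res)) /\
      (cost res)%:R <= C * (m + n)%:R * tau%:R `^ (omega - 1)).

Proof.
have [t [u [T [G [tP u_sq T0 TS [G0 GE]]]]]] := block_costs omega_gt2 omega_matmul.
split.
  pose tree m n pat := peeled_tree star_involutive omega_gt2 tP u_sq T0 TS G0 GE (m := m) (n := n) pat.
  exists (G * 10 `^ omega * 2 * 2 `^ (omega - 1)).
  exists (fun m n pat => projT1 (cid (tree m n pat))) => m n B tau tw.
  by case: cid => tr /= h; apply: h.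
move=> K.
pose tree m n pat := lu_tree star_involutive omega_gt2 tP u_sq T0 TS G0 GE K (m := m) (n := n) pat.
eexists; exists (fun m n pat => projT1 (cid (tree m n pat))) => m n B tau tw rk.
by case: cid => tr /= h; apply: h.
Qed.
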